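(* Under the standing setup below with $r=1$, write $\theta=\theta_1$ and assume $D'_{\mu_X}(b^+)=-\infty$. Let $\rho=D^{-1}_{\mu_X}(1/\theta^2)$ when $\theta^2>1/D_{\mu_X}(b^+)$. Then as $n,m\to\infty$ with $n/m\to c$, almost surely $$w^{\rm opt}_1\to\begin{cases}\dfrac{-2}{\theta^2D'_{\mu_X}(\rho)} & \text{if }\theta^2>1/D_{\mu_X}(b^+),\\[2mm] 0&\text{otherwise,}\end{cases}$$ $$\mathrm{MSE}(w^{\rm opt})\to\begin{cases}\theta^2-\dfrac{4}{(\theta^2D'_{\mu_X}(\rho))^2}&\text{if }\theta^2>1/D_{\mu_X}(b^+),\\[2mm] \theta^2&\text{otherwise,}\end{cases}$$ $$\mathrm{MSE}(w^{\rm eym})\to\begin{cases}\theta^2+\rho^2+\dfrac{4\rho}{\theta^2D'_{\mu_X}(\rho)}&\text{if }\theta^2>1/D_{\mu_X}(b^+),\\[2mm] \theta^2+b^2&\text{otherwise.}\end{cases}$$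
   Context: Standing setup. Let $\mathbb{K}\in\{\mathbb{R},\mathbb{C}\}$ and $^H$ denote conjugate transpose. For each $n$ let $m=m(n)\ge n$ with $n/m\to c$ as $n\to\infty$. Let $X_n$ be an $n\times m$ random matrix over $\mathbb{K}$ with singular values $\sigma_1(X_n)\ge\cdots\ge\sigma_n(X_n)$, and assume its empirical singular value distribution $\mu_{X_n}=\frac1n\sum_{i=1}^n\delta_{\sigma_i(X_n)}$ converges almost surely weakly to a deterministic compactly supported probability measure $\mu_X$ supported on $[a,b]$ (with $b$ the right endpoint of the support), and that $\sigma_1(X_n)\to b$ almost surely. Assume $X_n$ is bi-unitarily (resp. bi-orthogonally) invariant: its distribution is invariant under multiplication on the left and on the right by unitary (resp. orthogonal) matrices. Fix $r\ge1$ and deterministic reals $\theta_1>\cdots>\theta_r>0$ independent of $n$; let $S_n=\sum_{i=1}^r\theta_iu_iv_i^H$ be a deterministic $n\times m$ matrix with $u_1,\dots,u_r$ orthonormal in $\mathbb{K}^n$ and $v_1,\dots,v_r$ orthonormal in $\mathbb{K}^m$, with $X_n$ independent of $S_n$. Observe $\widetilde X_n=S_n+X_n$, with SVD $\widetilde X_n=\sum_{i=1}^{q}\hat\sigma_i\hat u_i\hat v_i^H$, $q=\min(n,m)$, $\hat\sigma_1\ge\hat\sigma_2\ge\cdots$. For a probability measure $\mu$ let $\phi_\mu(z)=\int\frac{z}{z^2-t^2}\,d\mu(t)$. The $D$-transform of $\mu_X$ is $D_{\mu_X}(z)=\phi_{\mu_X}(z)\cdot\big[c\,\phi_{\mu_X}(z)+\frac{1-c}{z}\big]$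 for $z>b$; $D_{\mu_X}(b^+)=\lim_{z\downarrow b}D_{\mu_X}(z)$, $D'_{\mu_X}$ is its derivative, $D'_{\mu_X}(b^+)=\lim_{z\downarrow b}D'_{\mu_X}(z)$, and $D^{-1}_{\mu_X}$ is its functional inverse on $(b,\infty)$. For $w\in\mathbb{R}^l$, $\mathrm{MSE}(w)=\big\|S_n-\sum_{i=1}^l w_i\hat u_i\hat v_i^H\big\|_F^2$. The EYM weights are $w^{\rm eym}_i=\hat\sigma_i$, $i=1,\dots,r$, and $w^{\rm opt}=\arg\min_{w\in\mathbb{R}^r_+}\mathrm{MSE}(w)$. *)

(* Defs.v *)
From mathcomp Require Import all_boot all_order all_algebra.
From mathcomp Require Import all_classical all_reals all_analysis.
From mathcomp Require Import complex.
Import Order.TTheory GRing.Theory Num.Theory numFieldNormedType.Exports.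

Set Implicit Arguments.
Unset Strict Implicit.
Unset Printing Implicit Defensive.

Local Open Scope classical_set_scope.
Local Open Scope ring_scope.

Section Defs.
Context {R : realType}.
Local Notation C := R[i].

Definition conjT {p q : nat} (A : 'M[C]_(p, q)) : 'M[C]_(q, p) :=
  map_mx (@conjc R) A^T.

Definition orthonormal_cols {p q : nat} (A : 'M[C]_(p, q)) : Prop :=
  conjT A *m A = 1%:M.

Definition real_mx {p q : nat} (A : 'M[C]_(p, q)) : Prop :=
  forall i j, complex.Im (A i j) = 0.

Definition is_svd (Kreal : bool) {p q : nat} (M : 'M[C]_(p, q))
    (s : 'I_p -> R) (U : 'M[C]_p) (V : 'M[C]_(q, p)) : Prop :=
  [/\ orthonormal_cols U /\ orthonormal_cols V,
      (forall i, 0 <= s i),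
      (forall i j : 'I_p, (i <= j)%N -> s j <= s i),
      (Kreal -> real_mx U /\ real_mx V) &
      M = U *m diag_mx (\row_i ((s i)%:C)%C) *m conjT V].

(* the singular values sigma_1 >= ... >= sigma_p of M (p <= q);
   index ord0 is sigma_1 *)
Definition svals {p q : nat} (M : 'M[C]_(p, q)) : 'I_p -> R :=
  get [set s | exists U V, is_svd false M s U V].

Definition frob2 {p q : nat} (M : 'M[C]_(p, q)) : R :=
  \sum_i \sum_j ((complex.Re (M i j)) ^+ 2 + (complex.Im (M i j)) ^+ 2).

Definition MSE1 {p q : nat} (S : 'M[C]_(p, q)) (uh : 'cV[C]_p) (vh : 'cV[C]_q)
    (w : R) : R :=
  frob2 (S - (w%:C)%C *: (uh *m conjT vh)).

Definition wopt {p q : nat} (S : 'M[C]_(p, q)) (uh : 'cV[C]_p) (vh : 'cV[C]_q) : R :=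
  get [set w : R | 0 <= w /\ forall w', 0 <= w' -> MSE1 S uh vh w <= MSE1 S uh vh w'].

Definition phi_mu (mu : probability R R) (z : R) : R :=
  Rintegral mu setT (fun t => z / (z ^+ 2 - t ^+ 2)).

Definition Dtr (c : R) (mu : probability R R) (z : R) : R :=
  phi_mu mu z * (c * phi_mu mu z + (1 - c) / z).

Definition Dbplus (c : R) (mu : probability R R) (b : R) : \bar R :=
  lim ((Dtr c mu z)%:E @[z --> b^'+]).

Definition Dinv (c : R) (mu : probability R R) (b : R) (y : R) : R :=
  get [set z : R | b < z /\ Dtr c mu z = y].

Definition rand_mx {d} {T : measurableType d} {p q : nat} (Y : T -> 'M[C]_(p, q)) : Prop :=
  forall i j, measurable_fun setT (fun w => complex.Re (Y w i j)) /\
              measurable_fun setT (fun w => complex.Im (Y w i j)).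

(* bi-unitary (Kreal = false) / bi-orthogonal (Kreal = true) invariance:
   U Y V has the same law as Y, for all unitary (resp. orthogonal) U, V.
   Equality of laws is tested on measurable rectangles (a pi-system
   generating the Borel sigma-algebra of the matrix space). *)
Definition biinvariant {d} {T : measurableType d} (P : probability T R) (Kreal : bool)
    {p q : nat} (Y : T -> 'M[C]_(p, q)) : Prop :=
  forall (U : 'M[C]_p) (V : 'M[C]_q),
    orthonormal_cols U -> orthonormal_cols V -> (Kreal -> real_mx U /\ real_mx V) ->
  forall (A B : 'I_p -> 'I_q -> set R),
    (forall i j, measurable (A i j) /\ measurable (B i j)) ->
    P [set w | forall i j, A i j (complex.Re (Y w i j)) /\ B i j (complex.Im (Y w i j))] =
    P [set w | forall i j, A i j (complex.Re ((U *m Y w *m V) i j)) /\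
                           B i j (complex.Im ((U *m Y w *m V) i j))].

End Defs.

(* Main.v *)
(* Along a rank-one direction the top singular value
   [F(tau) = sigma_1(X + tau u v^H)] is convex in [tau], and the alignment
   [kappa = Re (uh^H u * v^H vh)] of the top singular vectors at [theta] is a
   subgradient of [F] there.  Since [MSE(w) = theta^2 + w^2 - 2 w theta kappa],
   the limits of [F] alone determine everything.

   In terms of the Hermitian dilation [H] of [X], a rank-two perturbation
   argument shows that [F(tau) < z] eventually when [tau^2 D(z) < 1], and
   [F(tau) > z] eventually when [tau^2 D(z) > 1]; only the limits of the moments
   [u^H (X X^H)^k u], [v^H (X^H X)^k v] and [u^H (X X^H)^k X v] enter.  By
   bi-invariance [u] and [v] may be replaced by random sign vectors, whose fourth
   moments give these limits by Markov and Borel-Cantelli.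

   Above the threshold, [tau^2 D(F(tau)) = 1] in the limit, and differentiating
   at [theta] gives [kappa -> -2 / (theta^3 D'(rho))].  Below it,
   [D'(b+) = -oo] makes the limit of [F] flat to first order at [theta], so
   [kappa -> 0]. *)
Require Import Defs.
From mathcomp Require Import all_boot all_order all_algebra.
From mathcomp Require Import all_classical all_reals all_analysis measurable_realfun.
From mathcomp Require Import perm complex.
From mathcomp Require Import ring lra.
Import Order.TTheory GRing.Theory Num.Theory numFieldNormedType.Exports.

Set Implicit Arguments.
Unset Strict Implicit.
Unset Printing Implicit Defensive.

Local Open Scope classical_set_scope.
Local Open Scope ring_scope.

(** The transform [D] is a 2x2 determinant in disguise. Write psi(z) = c phi(z) + (1 - c)/z. In the
    limit, phi and psi are z u^H (z^2 - X X^H)^-1 u and z v^H (z^2 - X^H X)^-1 v, and the cross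
    terms vanish, so z is an eigenvalue of the perturbed dilation when 1 = tau^2 phi(z) psi(z) =
    tau^2 D(z). No resolvent is formed. Truncated Laurent sums replace it; the remainder is small
    because ||X|| is eventually below some B < z, or harmless because limiting moments are
    nonnegative. So countably many scalar limits suffice, one null set serves every tau and z, and
    the rest is deterministic along a fixed sample. Averaging over sign vectors uses finitely many
    unitary matrices instead of Haar measure. A second moment would give tails of order 1/n, which
    are not summable; a fourth moment gives 1/n^2. As the entries of X may fail to be integrable,
    Markov's inequality is applied on events where a trace or a norm is bounded. The subgradient
    argument treats all choices of top singular vectors at once, even for a repeated top singular
    value. *)

Section HermitianProduct.
Context {R : realType}.
Local Notation C := R[i].
Local Notation "x %:CC" := (real_complex R x) (at level 2, format "x %:CC").

(** The squared modulus is kept in [R], so that [frob2] unfolds to it and all estimates take place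
    in an ordered field. *)
Definition csq (z : C) : R := (complex.Re z) ^+ 2 + (complex.Im z) ^+ 2.

Lemma csqE (z : C) : (csq z)%:CC = z^*%C * z.
Proof. by case: z => x y; apply/eqP; rewrite eq_complex /csq /=; apply/andP; split; apply/eqP; ring. Qed.

Lemma csq_ge0 (z : C) : 0 <= csq z.
Proof. by rewrite addr_ge0 ?sqr_ge0. Qed.

Lemma csq_eq0 (z : C) : (csq z == 0) = (z == 0).
Proof. by case: z => x y; rewrite /csq paddr_eq0 ?sqr_ge0// !sqrf_eq0 eq_complex. Qed.

Lemma csqM (y z : C) : csq (y * z) = csq y * csq z.
Proof. by case: y z => [a b] [x y]; rewrite /csq /=; ring. Qed.

Lemma csq_real (x : R) : csq x%:CC = x ^+ 2.
Proof. by rewrite /csq /=; ring. Qed.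

Lemma csqJ (z : C) : csq z^*%C = csq z.
Proof. by case: z => x y; rewrite /csq /=; ring. Qed.

Lemma sqrt_csq (z : C) : Num.sqrt (csq z) = Normc.normc z.
Proof. by case: z. Qed.

Lemma normc_ge0 (z : C) : 0 <= Normc.normc z.
Proof. by rewrite -sqrt_csq sqrtr_ge0. Qed.

Lemma normcJ (z : C) : Normc.normc z^*%C = Normc.normc z.
Proof. by rewrite -!sqrt_csq csqJ. Qed.

Lemma normc_real (x : R) : Normc.normc x%:CC = `|x|.
Proof. by rewrite -sqrt_csq csq_real sqrtr_sqr. Qed.

Lemma normc_sum (I : Type) (r : seq I) (F : I -> C) :
  Normc.normc (\sum_(i <- r) F i) <= \sum_(i <- r) Normc.normc (F i).
Proof.
elim: r => [|i r IH]; first by rewrite !big_nil Normc.normc0.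
by rewrite !big_cons (le_trans (le_normcD _ _))// lerD2l.
Qed.

Lemma ler_Re_normc (z : C) : `|complex.Re z| <= Normc.normc z.
Proof.
by rewrite -sqrt_csq -sqrtr_sqr ler_wsqrtr// lerDl sqr_ge0.
Qed.

Lemma normc_le_ReIm (z : C) :
  Normc.normc z <= `|complex.Re z| + `|complex.Im z|.
Proof.
rewrite -sqrt_csq -(ger0_norm (addr_ge0 (normr_ge0 (complex.Re z)) (normr_ge0 (complex.Im z)))).
rewrite -sqrtr_sqr ler_wsqrtr// /csq sqrrD !real_normK ?num_real//.
by rewrite addrAC lerDl mulrn_wge0// mulr_ge0.
Qed.

Lemma ReD (y z : C) : complex.Re (y + z) = complex.Re y + complex.Re z.
Proof. by case: y z => [a b] [x y]. Qed.

Lemma ReN (y : C) : complex.Re (- y) = - complex.Re y.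
Proof. by case: y. Qed.

Lemma ImD (y z : C) : complex.Im (y + z) = complex.Im y + complex.Im z.
Proof. by case: y z => [a b] [x y]. Qed.

Lemma ReZ (a : R) (z : C) : complex.Re (a%:CC * z) = a * complex.Re z.
Proof. by case: z => x y /=; ring. Qed.

Lemma ImZ (a : R) (z : C) : complex.Im (a%:CC * z) = a * complex.Im z.
Proof. by case: z => x y /=; ring. Qed.

Lemma Re_sum (I : Type) (r : seq I) (P : pred I) (F : I -> C) :
  complex.Re (\sum_(i <- r | P i) F i) = \sum_(i <- r | P i) complex.Re (F i).
Proof. by elim/big_ind2: _ => // x1 x2 y1 y2 <- <-; rewrite ReD. Qed.

Lemma Im_sum (I : Type) (r : seq I) (P : pred I) (F : I -> C) :
  complex.Im (\sum_(i <- r | P i) F i) = \sum_(i <- r | P i) complex.Im (F i).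
Proof. by elim/big_ind2: _ => // x1 x2 y1 y2 <- <-; rewrite ImD. Qed.

Lemma conjTE p q (A : 'M[C]_(p, q)) i j : conjT A i j = ((A j i)^*)%C.
Proof. by rewrite !mxE. Qed.

Lemma conjTK p q (A : 'M[C]_(p, q)) : conjT (conjT A) = A.
Proof. by apply/matrixP => i j; rewrite !conjTE conjcK. Qed.

Lemma conjT_mul p q r (A : 'M[C]_(p, q)) (B : 'M[C]_(q, r)) :
  conjT (A *m B) = conjT B *m conjT A.
Proof. by rewrite /conjT trmx_mul map_mxM. Qed.

Lemma conjTD p q (A B : 'M[C]_(p, q)) : conjT (A + B) = conjT A + conjT B.
Proof. by apply/matrixP => i j; rewrite !mxE rmorphD. Qed.

Lemma conjTZ p q a (A : 'M[C]_(p, q)) : conjT (a *: A) = a^*%C *: conjT A.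
Proof. by apply/matrixP => i j; rewrite !mxE rmorphM. Qed.

Lemma conjT1 p : conjT (1%:M : 'M[C]_p) = 1%:M.
Proof. by rewrite /conjT trmx1 map_mx1. Qed.

Lemma frob2_csq p q (A : 'M[C]_(p, q)) : frob2 A = \sum_i \sum_j csq (A i j).
Proof. by []. Qed.

Lemma frob2_ge0 p q (A : 'M[C]_(p, q)) : 0 <= frob2 A.
Proof. by apply: sumr_ge0 => i _; apply: sumr_ge0 => j _; exact: csq_ge0. Qed.

Definition ip p (x y : 'cV[C]_p) : C := (conjT x *m y) 0 0.

Lemma ipE p (x y : 'cV[C]_p) : ip x y = \sum_i (x i 0)^*%C * y i 0.
Proof. by rewrite /ip mxE; apply: eq_bigr => i _; rewrite conjTE. Qed.

Lemma ipDl p (x x' y : 'cV[C]_p) : ip (x + x') y = ip x y + ip x' y.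
Proof. by rewrite /ip conjTD mulmxDl mxE. Qed.

Lemma ipDr p (x y y' : 'cV[C]_p) : ip x (y + y') = ip x y + ip x y'.
Proof. by rewrite /ip mulmxDr mxE. Qed.

Lemma ipZl p a (x y : 'cV[C]_p) : ip (a *: x) y = a^*%C * ip x y.
Proof. by rewrite /ip conjTZ -scalemxAl mxE. Qed.

Lemma ipZr p a (x y : 'cV[C]_p) : ip x (a *: y) = a * ip x y.
Proof. by rewrite /ip -scalemxAr mxE. Qed.

Lemma ipNr p (x y : 'cV[C]_p) : ip x (- y) = - ip x y.
Proof. by rewrite -scaleN1r ipZr mulN1r. Qed.

Lemma ip0r p (x : 'cV[C]_p) : ip x 0 = 0.
Proof. by rewrite /ip mulmx0 mxE. Qed.

Lemma ip_suml p (I : Type) (r : seq I) (F : I -> 'cV[C]_p) y :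
  ip (\sum_(i <- r) F i) y = \sum_(i <- r) ip (F i) y.
Proof.
elim: r => [|i r IH]; last by rewrite !big_cons ipDl IH.
by rewrite !big_nil ipE big1// => i _; rewrite mxE conjc0 mul0r.
Qed.

Lemma ip_sumr p (I : Type) (r : seq I) (F : I -> 'cV[C]_p) x :
  ip x (\sum_(i <- r) F i) = \sum_(i <- r) ip x (F i).
Proof. by elim: r => [|i r IH]; rewrite ?big_nil ?ip0r// !big_cons ipDr IH. Qed.

Lemma ipC p (x y : 'cV[C]_p) : ip y x = (ip x y)^*%C.
Proof.
rewrite !ipE rmorph_sum; apply: eq_bigr => i _.
by rewrite rmorphM /= conjcK mulrC.
Qed.

Lemma ip_adj p q (A : 'M[C]_(p, q)) (x : 'cV[C]_p) (y : 'cV[C]_q) :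
  ip x (A *m y) = ip (conjT A *m x) y.
Proof. by rewrite /ip conjT_mul conjTK mulmxA. Qed.

Lemma frob2_col p (x : 'cV[C]_p) : frob2 x = \sum_i csq (x i 0).
Proof. by rewrite frob2_csq; apply: eq_bigr => i _; rewrite big_ord1. Qed.

Lemma ipxx p (x : 'cV[C]_p) : ip x x = (frob2 x)%:CC.
Proof.
rewrite ipE frob2_col rmorph_sum; apply: eq_bigr => i _; exact/esym/csqE.
Qed.

Lemma Re_ipxx p (x : 'cV[C]_p) : complex.Re (ip x x) = frob2 x.
Proof. by rewrite ipxx. Qed.

Lemma frob2D p (x y : 'cV[C]_p) :
  frob2 (x + y) = frob2 x + frob2 y + 2 * complex.Re (ip x y).
Proof.
rewrite -!Re_ipxx ipDl !ipDr !ReD [ip y x]ipC.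
have -> : complex.Re (ip x y)^*%C = complex.Re (ip x y) by case: (ip x y).
by ring.
Qed.

Lemma frob2Z p q a (x : 'M[C]_(p, q)) : frob2 (a *: x) = csq a * frob2 x.
Proof.
rewrite !frob2_csq mulr_sumr; apply: eq_bigr => i _.
by rewrite mulr_sumr; apply: eq_bigr => j _; rewrite mxE csqM.
Qed.

Lemma frob2N p q (x : 'M[C]_(p, q)) : frob2 (- x) = frob2 x.
Proof. by rewrite -scaleN1r frob2Z /csq /= oppr0 expr0n addr0 sqrrN expr1n mul1r. Qed.

Lemma frob2_eq0 p (x : 'cV[C]_p) : (frob2 x == 0) = (x == 0).
Proof.
apply/idP/eqP => [|->]; last by rewrite frob2_col big1// => i _; rewrite mxE /csq /= expr0n addr0.
rewrite frob2_col psumr_eq0; last by move=> i _; exact: csq_ge0.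
move=> /allP H; apply/matrixP => i j; rewrite ord1 mxE; apply/eqP.
by rewrite -csq_eq0; apply: (H i); rewrite mem_index_enum.
Qed.

Lemma cauchy_schwarz_csq p (x y : 'cV[C]_p) : csq (ip x y) <= frob2 x * frob2 y.
Proof.
have [/eqP|y0] := eqVneq (frob2 y) 0.
  by rewrite frob2_eq0 => /eqP ->; rewrite ip0r /csq /= expr0n addr0 mulr_ge0 ?frob2_ge0.
have fy : 0 < frob2 y by rewrite lt_neqAle eq_sym y0 frob2_ge0.
(* This vector is |y|^2 times the component of [x] orthogonal to [y]; the scaling avoids a
   division. *)
have := frob2_ge0 ((frob2 y)%:CC *: x + (- (ip y x)) *: y).
rewrite frob2D !frob2Z ipZl ipZr csq_real conjc_real ReZ mulNr ReN.
have -> : csq (- ip y x) = csq (ip x y) by rewrite -mulN1r csqM [ip y x]ipC csqJ /csq /=; ring.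
have -> : complex.Re (ip y x * ip x y) = csq (ip x y) by rewrite [ip y x]ipC -csqE.
have -> : forall a b c : R, a ^+ 2 * b + c * a + 2 * (a * - c) = a * (b * a - c) by move=> *; ring.
by rewrite pmulr_rge0// subr_ge0.
Qed.

Definition nrm p (x : 'cV[C]_p) : R := Num.sqrt (frob2 x).

Lemma nrm_sq p (x : 'cV[C]_p) : nrm x ^+ 2 = frob2 x.
Proof. by rewrite sqr_sqrtr ?frob2_ge0. Qed.

Lemma cauchy_schwarz p (x y : 'cV[C]_p) : Normc.normc (ip x y) <= nrm x * nrm y.
Proof.
by rewrite -sqrt_csq -sqrtrM ?frob2_ge0// ler_wsqrtr// cauchy_schwarz_csq.
Qed.

Lemma ler_nrm p q (x : 'cV[C]_p) (y : 'cV[C]_q) B : 0 <= B ->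
  frob2 x <= B ^+ 2 * frob2 y -> nrm x <= B * nrm y.
Proof.
move=> B0 H; rewrite -(ger0_norm B0) -sqrtr_sqr /nrm -sqrtrM ?sqr_ge0//.
exact: ler_wsqrtr.
Qed.

Lemma orthonormal_col1 p (x : 'cV[C]_p) : orthonormal_cols x -> frob2 x = 1.
Proof.
rewrite /orthonormal_cols => H.
have : ip x x = 1 by rewrite /ip H mxE eqxx.
by rewrite ipxx => /(congr1 (@complex.Re R)).
Qed.

Lemma conjT_rank1 p q (u : 'cV[C]_p) (v : 'cV[C]_q) :
  conjT (u *m conjT v) = v *m conjT u.
Proof. by rewrite conjT_mul conjTK. Qed.

Lemma rank1_mul p q (u : 'cV[C]_p) (v y : 'cV[C]_q) :
  u *m conjT v *m y = ip v y *: u.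
Proof.
by rewrite -mulmxA [conjT v *m y]mx11_scalar mul_mx_scalar.
Qed.

End HermitianProduct.

(** * Singular value decomposition *)

Section SingularValues.
Context {R : realType}.
Local Notation C := R[i].
Local Notation "x %:CC" := (real_complex R x) (at level 2, format "x %:CC").

Lemma conjcM (y z : C) : (y * z)^*%C = y^*%C * z^*%C.
Proof. exact: rmorphM. Qed.

Lemma orthonormal_cols_unitary p (U : 'M[C]_p) :
  orthonormal_cols U -> U *m conjT U = 1%:M.
Proof. exact: mulmx1C. Qed.

Lemma frob2_isometry p q (U : 'M[C]_(p, q)) (x : 'cV[C]_q) :
  orthonormal_cols U -> frob2 (U *m x) = frob2 x.
Proof. by move=> HU; rewrite -!Re_ipxx ip_adj mulmxA HU mul1mx. Qed.

(** The residual [y - V V^H y] has squared norm |y|^2 - |V^H y|^2. *)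
Lemma bessel p q (V : 'M[C]_(q, p)) (y : 'cV[C]_q) :
  orthonormal_cols V -> frob2 (conjT V *m y) <= frob2 y.
Proof.
move=> HV; have := frob2_ge0 (y + (- (V *m (conjT V *m y)))).
rewrite frob2D frob2N ipNr ReN (frob2_isometry _ HV) ip_adj Re_ipxx.
by lra.
Qed.

Lemma frob2_diag p (s : 'I_p -> R) (x : 'cV[C]_p) :
  frob2 (diag_mx (\row_i (s i)%:CC) *m x) = \sum_i s i ^+ 2 * csq (x i 0).
Proof.
rewrite frob2_col; apply: eq_bigr => i _.
by rewrite mul_diag_mx !mxE csqM csq_real.
Qed.

Lemma conjT_diag p (s : 'I_p -> R) :
  conjT (diag_mx (\row_i (s i)%:CC)) = diag_mx (\row_i (s i)%:CC).
Proof.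
apply/matrixP => i j; rewrite conjTE !mxE eq_sym.
by case: eqP => [->|_]; rewrite ?mulr1n ?mulr0n ?conjc_real ?conjc0.
Qed.

Lemma diag_real_exp p (s : 'I_p -> R) k :
  diag_mx (\row_i (s i)%:CC) ^+ k = diag_mx (\row_i (s i ^+ k)%:CC).
Proof.
elim: k => [|k IH].
  by apply/matrixP => i j; rewrite expr0 !mxE.
rewrite exprS IH -mulmxE mul_diag_mx; apply/matrixP => i j.
by rewrite !mxE exprS rmorphM mulrnAr.
Qed.

Lemma mulmx_col p q r (A : 'M[C]_(p, q)) (B : 'M[C]_(q, r)) j :
  A *m col j B = col j (A *m B).
Proof. by rewrite !colE mulmxA. Qed.

Section Facts.
Variables (K : bool) (p q : nat) (M : 'M[C]_(p.+1, q)) (s : 'I_p.+1 -> R).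
Variables (U : 'M[C]_p.+1) (V : 'M[C]_(q, p.+1)).
Hypothesis svd : is_svd K M s U V.
Let D : 'M[C]_p.+1 := diag_mx (\row_i (s i)%:CC).

Lemma svd_le0 i : s i ^+ 2 <= s ord0 ^+ 2.
Proof. by case: svd => _ s0 sd _ _; rewrite ler_sqr ?nnegrE ?s0 ?sd. Qed.

Lemma svd_mulV : M *m V = U *m D.
Proof. by case: svd => -[_ HV] _ _ _ ->; rewrite -!mulmxA HV mulmx1. Qed.

Lemma svd_mulU : conjT M *m U = V *m D.
Proof.
case: svd => -[HU _] _ _ _ ->.
by rewrite !conjT_mul conjTK conjT_diag -!mulmxA HU mulmx1.
Qed.

Lemma svd_top_right : M *m col ord0 V = (s ord0)%:CC *: col ord0 U.
Proof.
rewrite mulmx_col svd_mulV; apply/matrixP => i j.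
by rewrite mul_mx_diag !mxE mulrC.
Qed.

Lemma svd_top_left : conjT M *m col ord0 U = (s ord0)%:CC *: col ord0 V.
Proof.
rewrite mulmx_col svd_mulU; apply/matrixP => i j.
by rewrite mul_mx_diag !mxE mulrC.
Qed.

Lemma frob2_col_orthonormal r (W : 'M[C]_(r, p.+1)) :
  orthonormal_cols W -> frob2 (col ord0 W) = 1.
Proof.
move=> HW; rewrite colE (frob2_isometry _ HW) frob2_col.
rewrite (bigD1 ord0)//= big1 => [|i /negbTE i0]; rewrite !mxE ?eqxx ?i0 /csq /=; ring.
Qed.

Lemma svd_op_norm (y : 'cV[C]_q) : frob2 (M *m y) <= s ord0 ^+ 2 * frob2 y.
Proof.
case: (svd) => -[HU HV] s0 sd _ ->; rewrite -!mulmxA frob2_isometry// frob2_diag.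
apply: le_trans (ler_wpM2l (sqr_ge0 (s ord0)) (bessel y HV)).
rewrite frob2_col mulr_sumr; apply: ler_sum => i _.
by rewrite ler_wpM2r ?csq_ge0// svd_le0.
Qed.

Lemma svd_op_norm_adj (x : 'cV[C]_p.+1) : frob2 (conjT M *m x) <= s ord0 ^+ 2 * frob2 x.
Proof.
case: (svd) => -[HU HV] s0 sd _ ->; rewrite !conjT_mul conjTK conjT_diag.
rewrite -!mulmxA frob2_isometry// frob2_diag.
have HU' : orthonormal_cols (conjT U).
  by rewrite /orthonormal_cols conjTK orthonormal_cols_unitary.
rewrite -[frob2 x](frob2_isometry _ HU').
rewrite frob2_col mulr_sumr; apply: ler_sum => i _.
by rewrite ler_wpM2r ?csq_ge0// svd_le0.
Qed.

(** The variational description of the top singular value: expand |M y - s x|^2 >= 0, bound |M y|^2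
    by s^2 |y|^2 and divide by s. When s = 0 the division is impossible, but then M y = 0. *)
Lemma svd_form_le (x : 'cV[C]_p.+1) (y : 'cV[C]_q) :
  2 * complex.Re (ip x (M *m y)) <= s ord0 * (frob2 x + frob2 y).
Proof.
case: (svd) => _ s0 _ _ _.
have := svd_op_norm y; have := s0 ord0; rewrite le_eqVlt.
case/orP => [/eqP <-|sp].
  rewrite expr0n !mul0r => H.
  have /eqP : frob2 (M *m y) = 0 by apply/eqP; rewrite eq_le H frob2_ge0.
  by rewrite frob2_eq0 => /eqP ->; rewrite ip0r mulr0.
move=> _.
have := frob2_ge0 (M *m y + - ((s ord0)%:CC *: x)).
rewrite frob2D frob2N frob2Z csq_real ipNr ReN ipZr ReZ.
have -> : complex.Re (ip (M *m y) x) = complex.Re (ip x (M *m y)).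
  by rewrite [ip (M *m y) x]ipC; case: (ip x _).
have := svd_op_norm y; move: (s ord0) sp => t tp H1 H2.
by rewrite -(ler_pM2l tp); lra.
Qed.

Lemma svd_gram : M *m conjT M = U *m (D ^+ 2) *m conjT U.
Proof.
case: (svd) => -[HU HV] s0 sd _ ->; rewrite !conjT_mul conjTK conjT_diag.
by rewrite !mulmxA -[_ *m conjT V *m V]mulmxA HV mulmx1.
Qed.

Lemma svd_gram_exp k : (M *m conjT M) ^+ k = U *m (D ^+ (2 * k)) *m conjT U.
Proof.
case: (svd) => -[HU HV] _ _ _ _.
elim: k => [|k IH]; first by rewrite muln0 !expr0 mulmx1 orthonormal_cols_unitary.
rewrite exprS IH svd_gram mulnS exprD -!mulmxE !mulmxA.
by rewrite -[_ *m conjT U *m U]mulmxA HU mulmx1.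
Qed.

Lemma svd_trace k : \tr ((M *m conjT M) ^+ k) = (\sum_i s i ^+ (2 * k))%:CC.
Proof.
case: (svd) => -[HU HV] _ _ _ _.
rewrite svd_gram_exp mxtrace_mulC mulmxA HU mul1mx diag_real_exp mxtrace_diag.
by rewrite rmorph_sum; apply: eq_bigr => i _; rewrite mxE.
Qed.

End Facts.

Lemma kernel_unit_vector p q (Z : 'M[C]_(p, q)) : (\rank Z < q)%N ->
  exists2 w : 'cV[C]_q, frob2 w = 1 & Z *m w = 0.
Proof.
move=> rk; have : \rank (kermx Z^T) != 0%N.
  by rewrite mxrank_ker mxrank_tr -lt0n subn_gt0.
rewrite mxrank_eq0 => /rowV0Pn[v /sub_kermxP vZ v0].
have Zv : Z *m v^T = 0 by apply: trmx_inj; rewrite trmx_mul trmxK vZ trmx0.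
have fv : 0 < frob2 v^T.
  rewrite lt_neqAle frob2_ge0 eq_sym frob2_eq0 andbT; apply: contraNneq v0 => v0.
  by rewrite -[v]trmxK v0 trmx0.
exists ((Num.sqrt (frob2 v^T))^-1%:CC *: v^T); last by rewrite -scalemxAr Zv scaler0.
by rewrite frob2Z csq_real exprVn sqr_sqrtr ?frob2_ge0// mulVf// gt_eqF.
Qed.

(** Rows in [S] are orthonormal and the others are zero. The induction is on the number of zero
    rows: each is replaced by the conjugate of a unit vector in the kernel of [Z], which is
    orthogonal to all remaining rows. *)
Lemma extend_orthonormal_rows p q (Z : 'M[C]_(p, q)) (S : {set 'I_p}) :
  (p <= q)%N ->
  (forall i j, (Z *m conjT Z) i j = ((i == j) && (i \in S))%:R) ->
  exists2 W : 'M[C]_(p, q), W *m conjT W = 1%:M &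
    forall i, i \in S -> row i W = row i Z.
Proof.
move=> pq; have [n] := ubnP #|~: S|; elim: n => // n IH in S Z *.
rewrite ltnS => cS HZ; have [S0|[ i ]] := set_0Vmem (~: S).
  exists Z => //; apply/matrixP => i j; rewrite HZ mxE.
  by have /finset.setP/(_ i) := S0; rewrite !finset.inE => /negbFE ->; rewrite andbT.
rewrite finset.inE => iS.
have Zi : row i Z = 0.
  have := HZ i i; rewrite (negbTE iS) andbF => H.
  have : ip (conjT (row i Z)) (conjT (row i Z)) = 0.
    by rewrite /ip conjTK -row_mul mxE -[RHS]H !mxE; apply: eq_bigr => k _; rewrite !mxE.
  rewrite ipxx => /(congr1 (@complex.Re R)) /= /eqP; rewrite frob2_eq0 => /eqP H0.
  by rewrite -[row i Z]conjTK H0; apply/matrixP => a b; rewrite !mxE conjc0.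
(* A zero row adds nothing to the row space, so the rank is at most p - 1; this is where [p <= q]
   enters. *)
have rk : (\rank Z < q)%N.
  apply: leq_trans pq.
  have: (Z <= row' i Z)%MS.
    apply/row_subP => k; have [<-|] := eqVneq i k.
      by rewrite Zi sub0mx.
    case/unlift_some => k' -> _.
    have -> : row (lift i k') Z = row k' (row' i Z) by apply/rowP => b; rewrite !mxE.
    exact: row_sub.
  move=> /mxrankS /leq_ltn_trans; apply.
  by apply: leq_ltn_trans (rank_leq_row _) _; case: (p) i {iS Zi} => [[]|].
have [w w1 Zw] := kernel_unit_vector rk.
pose Z' := \matrix_(a, b) (if a == i then (w b 0)^*%C else Z a b).
have Zw0 a : \sum_b Z a b * w b 0 = 0.
  by have /matrixP/(_ a 0) := Zw; rewrite !mxE.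
have [||W W1 WZ] := IH (i |: S) Z'.
- have -> : ~: (i |: S) = (~: S) :\ i by apply/finset.setP => k; rewrite !finset.inE negb_or.
  by move: cS; rewrite (cardsD1 i (~: S)) finset.inE iS.
- move=> a b; rewrite mxE; under eq_bigr do rewrite conjTE !mxE.
  rewrite !finset.inE.
  case: (eqVneq a i) => [->|ai]; case: (eqVneq b i) => [bi|bi] /=.
  + transitivity (ip w w); last by rewrite ipxx w1.
    by rewrite ipE; apply: eq_bigr => k _; rewrite conjcK.
  + transitivity ((\sum_k Z b k * w k 0)^*%C); last by rewrite Zw0 conjc0.
    rewrite rmorph_sum.
    by apply: eq_bigr => k _; rewrite rmorphM mulrC.
  + rewrite bi (negbTE ai) /= -[RHS](Zw0 a).
    by apply: eq_bigr => k _; rewrite conjcK.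
  + have := HZ a b; rewrite mxE => <-.
    by apply: eq_bigr => k _; rewrite conjTE.
exists W => // k kS; rewrite WZ; last by rewrite finset.inE kS orbT.
apply/matrixP => a b; rewrite !mxE; case: eqP => // ki.
by move: iS; rewrite -ki kS.
Qed.

(** If [P] diagonalizes M M^H, the rows of P M are pairwise orthogonal and their norms are the
    singular values. Normalizing the nonzero rows and completing the family gives V^H, while U is
    P^H. *)
Lemma svd_unsorted p q (M : 'M[C]_(p, q)) : (p <= q)%N ->
  exists (s : 'I_p -> R) (U : 'M[C]_p) (V : 'M[C]_(q, p)),
  [/\ orthonormal_cols U /\ orthonormal_cols V, (forall i, 0 <= s i) &
      M = U *m diag_mx (\row_i (s i)%:CC) *m conjT V].
Proof.
move=> pq; pose A := M *m conjT M.
have An : A \is spectral.normalmx.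
  apply/spectral.normalmxP; have AA : conjT A = A by rewrite /A conjT_mul conjTK.
  by rewrite -[map_mx _ A^T]/(conjT A) AA.
set P := spectral.spectralmx A.
have PU : P *m conjT P = 1%:M.
  exact: (elimT spectral.unitarymxP (spectral.spectral_unitarymx A)).
have PU' : conjT P *m P = 1%:M by apply: mulmx1C.
have PA : P *m A *m conjT P = diag_mx (spectral.spectral_diag A).
  have /spectral.orthomx_spectralP := An.
  rewrite -/P spectral.invmx_unitary ?spectral.spectral_unitarymx//.
  rewrite -[map_mx _ P^T]/(conjT P) => H.
  by rewrite {1}H !mulmxA PU mul1mx -mulmxA PU mulmx1.
pose Y := P *m M.
have YY i j : (Y *m conjT Y) i j = (spectral.spectral_diag A 0 i) *+ (i == j).
  by have /matrixP/(_ i j) := PA; rewrite /A /Y conjT_mul !mulmxA => ->; rewrite !mxE.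
pose s i := Num.sqrt (\sum_k csq (Y i k)).
have YYi i : (Y *m conjT Y) i i = (s i ^+ 2)%:CC.
  rewrite mxE sqr_sqrtr; last by apply: sumr_ge0 => k _; exact: csq_ge0.
  by rewrite rmorph_sum; apply: eq_bigr => k _; rewrite conjTE mulrC -csqE.
have s0 i : 0 <= s i by exact: sqrtr_ge0.
(* Since 0^-1 = 0, a row with [s i = 0] becomes the zero row that [extend_orthonormal_rows]
   expects. *)
pose Z := \matrix_(i, k) ((s i)^-1%:CC * Y i k).
have [|W W1 WZ] := @extend_orthonormal_rows _ _ Z [set i | s i != 0]%SET pq.
  move=> i j; rewrite finset.inE mxE.
  transitivity ((s i)^-1%:CC * (s j)^-1%:CC * (Y *m conjT Y) i j).
    rewrite mxE mulr_sumr; apply: eq_bigr => k _.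
    rewrite conjTE !mxE conjcM conjc_real; ring.
  have [<-|ij] := eqVneq i j; last by rewrite YY (negbTE ij) mulr0n mulr0.
  rewrite YYi -!rmorphM; have [->|si] /= := eqVneq (s i) 0.
    by rewrite expr0n mulr0.
  by rewrite expr2 mulrA mulfVK// mulVf.
have UE : Y = diag_mx (\row_i (s i)%:CC) *m W.
  apply/matrixP => i k; rewrite mul_diag_mx [RHS]mxE [(\row__ _) _ _]mxE.
  have [si|si] := eqVneq (s i) 0.
    rewrite si mul0r; apply/eqP; rewrite -csq_eq0.
    have : \sum_k csq (Y i k) = 0.
      by apply/eqP; rewrite eq_le sumr_ge0 ?andbT => [|l _]; rewrite ?csq_ge0// -sqrtr_eq0; apply/eqP.
    move=> /eqP; rewrite psumr_eq0; last by move=> l _; exact: csq_ge0.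
    by move=> /allP/(_ k (mem_index_enum _)).
  have /matrixP/(_ 0 k) : row i W = row i Z by apply: WZ; rewrite finset.inE.
  rewrite mxE [RHS]mxE [RHS]mxE => ->.
  by rewrite mulrA -rmorphM divff// rmorph1 mul1r.
exists s, (conjT P), (conjT W); split=> //.
- by split; rewrite /orthonormal_cols conjTK.
- by rewrite conjTK -mulmxA -UE /Y mulmxA PU' mul1mx.
Qed.

Lemma svd_exists p q (M : 'M[C]_(p, q)) : (p <= q)%N ->
  exists s U V, is_svd false M s U V.
Proof.
move=> /(svd_unsorted M)[s [U [V [[HU HV] s0 ->]]]].
pose t := [tuple s i | i < p].
have /tuple_permP[f tf] : perm_eq (sort (fun x y : R => y <= x) t) t.
  by rewrite perm_sort.
have sE (i : 'I_p) : nth 0 (sort (fun x y : R => y <= x) t) i = s (f i).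
  by rewrite tf (nth_map i) ?size_enum_ord// nth_ord_enum tnth_mktuple.
have perm_orth r (A : 'M[C]_(r, p)) : orthonormal_cols A ->
    orthonormal_cols (\matrix_(i, j) A i (f j)).
  move=> HA; apply/matrixP => i j; have /matrixP/(_ (f i) (f j)) := HA.
  rewrite !mxE (inj_eq perm_inj) => <-; apply: eq_bigr => k _.
  by rewrite !conjTE !mxE.
exists (s \o f), (\matrix_(i, j) U i (f j)), (\matrix_(i, j) V i (f j)).
split=> [||i j ij||].
- by split; exact: perm_orth.
- by move=> i /=.
- rewrite /= -!sE.
  apply: (sorted_leq_nth (leT := fun x y : R => y <= x)) => //.
  + by move=> a b e; exact: ge_trans.
  + by apply: sort_sorted => a b; exact: le_total.
  + by rewrite finset.inE size_sort size_tuple.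
  + by rewrite finset.inE size_sort size_tuple.
- by [].
- apply/matrixP => i j.
  rewrite !mul_mx_diag !mxE (reindex_inj (@perm_inj _ f)) /=.
  by apply: eq_bigr => k _; rewrite !mxE.
Qed.

(** For [p <= q] the set from which [svals] chooses is inhabited, so the chosen family does come
    from a decomposition. *)
Lemma svals_svd p q (M : 'M[C]_(p, q)) : (p <= q)%N ->
  exists U V, is_svd false M (svals M) U V.
Proof.
move=> /(svd_exists M)[s sP].
by have := @getPex _ [set s | exists U V, is_svd false M s U V] (ex_intro _ s sP).
Qed.

End SingularValues.

(** * Rank-two perturbations of Hermitian matrices *)

Section RankTwoPerturbation.
Context {R : realType}.
Local Notation C := R[i].
Local Notation "x %:CC" := (real_complex R x) (at level 2, format "x %:CC").

(* Partial sums of the Laurent expansion of a resolvent entry at infinity. *)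
Definition wsum (z : R) K (h : nat -> R) := \sum_(k < K) z ^- k.+1 * h k.

Lemma conjT_exp p (H : 'M[C]_p) k : conjT H = H -> conjT (H ^+ k) = H ^+ k.
Proof.
move=> HH; elim: k => [|k IH]; first by rewrite expr0 conjT1.
by rewrite {1}exprSr -mulmxE conjT_mul HH IH mulmxE -exprS.
Qed.

Lemma frob2_exp p (H : 'M[C]_p) B k (x : 'cV[C]_p) :
  (forall y : 'cV[C]_p, frob2 (H *m y) <= B ^+ 2 * frob2 y) ->
  frob2 (H ^+ k *m x) <= (B ^+ k) ^+ 2 * frob2 x.
Proof.
move=> HB; elim: k => [|k IH]; first by rewrite !expr0 mul1mx expr1n mul1r.
rewrite exprS -mulmxE -mulmxA; apply: (le_trans (HB _)).
have -> : (B ^+ k.+1) ^+ 2 * frob2 x = B ^+ 2 * ((B ^+ k) ^+ 2 * frob2 x).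
  by rewrite [B ^+ k.+1]exprS; ring.
by apply: ler_wpM2l => //; exact: sqr_ge0.
Qed.

Variables (N : nat) (H : 'M[C]_N).
Hypothesis HH : conjT H = H.

Lemma moment_conj (x y : 'cV[C]_N) k :
  ip y (H ^+ k *m x) = (ip x (H ^+ k *m y))^*%C.
Proof. by rewrite -ipC ip_adj conjT_exp. Qed.

Lemma moment_real (x : 'cV[C]_N) k :
  ip x (H ^+ k *m x) = (complex.Re (ip x (H ^+ k *m x)))%:CC.
Proof.
have := moment_conj x x k; case: (ip x _) => a b [] /= /eqP.
by rewrite -addr_eq0 -mulr2n -mulr_natl mulf_eq0 pnatr_eq0 /= => /eqP ->.
Qed.

(** Substitutes w = sigma^-1 (H w + g) into itself [K] times; it is the Neumann series of (sigma -
    H)^-1 g with exact remainder, so neither convergence nor invertibility is at stake. *)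
Lemma resolvent_expansion (w g : 'cV[C]_N) (sigma : R) K : sigma != 0 ->
  H *m w + g = sigma%:CC *: w ->
  w = \sum_(k < K) (sigma ^- k.+1)%:CC *: (H ^+ k *m g)
      + (sigma ^- K)%:CC *: (H ^+ K *m w).
Proof.
move=> s0 wE; elim: K => [|K IH].
  by rewrite big_ord0 add0r !expr0 mul1mx invr1 scale1r.
rewrite big_ord_recr /= {1}IH -addrA; congr (_ + _).
have wE' : w = (sigma^-1)%:CC *: (H *m w + g).
  by rewrite wE scalerA -rmorphM mulVf// scale1r.
rewrite [in LHS]wE' -scalemxAr scalerA -rmorphM /= mulmxDr mulmxA mulmxE -exprSr.
rewrite -invfM -exprSr scalerDr; exact: addrC.
Qed.

(** Pairing the expansion of [w] with [e] expresses <e,w> through <f,w>, itself and a remainder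
    proportional to |w|. The energy estimate bounds |w| by a multiple of |<e,w>|, so that the
    remainder can be absorbed on the left. *)
Lemma rank2_upper_half (e f w : 'cV[C]_N) (tau sigma z B : R) K :
  0 <= B -> B < z -> z <= sigma -> w != 0 -> frob2 e = 1 -> frob2 f = 1 ->
  (forall y : 'cV[C]_N, frob2 (H *m y) <= B ^+ 2 * frob2 y) ->
  H *m w + tau%:CC *: (ip f w *: e + ip e w *: f) = sigma%:CC *: w ->
  let s := Normc.normc (ip e w) in let t := Normc.normc (ip f w) in
  0 < s /\
  s * (1 - (`|tau| * (\sum_(k < K) z ^- k.+1 * Normc.normc (ip e (H ^+ k *m f)))
            + 2 * `|tau| * (B / z) ^+ K / (z - B)))
  <= `|tau| * t * \sum_(k < K) z ^- k.+1 * Normc.normc (ip e (H ^+ k *m e)).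
Proof.
move=> B0 Bz zs w0 e1 f1 HB wE s t.
have z0 : 0 < z by exact: le_lt_trans Bz.
have s0 : 0 < sigma by exact: lt_le_trans zs.
have nw0 : 0 < nrm w by rewrite sqrtr_gt0 lt_neqAle frob2_ge0 eq_sym frob2_eq0 w0.
have nf : nrm f = 1 by rewrite /nrm f1 sqrtr1.
have ne : nrm e = 1 by rewrite /nrm e1 sqrtr1.
have tw : t <= nrm w by have := cauchy_schwarz f w; rewrite nf mul1r.
have t0 : 0 <= t by exact: normc_ge0.
have s0' : 0 <= s by exact: normc_ge0.
(* The eigenvector equation paired with [w] itself: H contributes at most B |w|^2 and the rank-two
   part at most 2 |tau| s t. *)
have energy : (sigma - B) * nrm w ^+ 2 <= 2 * `|tau| * (s * t).
  have H1 : complex.Re (ip w (H *m w)) <= B * nrm w ^+ 2.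
    apply: (le_trans (ler_norm _)); apply: (le_trans (ler_Re_normc _)).
    apply: (le_trans (cauchy_schwarz _ _)).
    have := ler_nrm B0 (HB w); move: (nrm w) nw0 (nrm _) => a a0 b ab.
    by rewrite mulrC expr2 mulrA ler_wpM2r// ltW.
  have := congr1 (fun x => complex.Re (ip w x)) wE.
  rewrite /= ipDr !ipZr ipDr !ipZr ReD !ReZ ipxx /= ReD.
  have H2 : complex.Re (ip f w * ip w e) <= s * t.
    apply: (le_trans (ler_norm _)); apply: (le_trans (ler_Re_normc _)).
    by rewrite Normc.normcM [ip w e]ipC normcJ mulrC.
  have H3 : complex.Re (ip e w * ip w f) = complex.Re (ip f w * ip w e).
    rewrite [ip w e]ipC [ip w f]ipC.
    by case: (ip e w) (ip f w) => [a b] [c d] /=; ring.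
  have H2' : - (s * t) <= complex.Re (ip f w * ip w e).
    rewrite lerNl; apply: (le_trans (ler_norm _)).
    rewrite normrN; apply: (le_trans (ler_Re_normc _)).
    by rewrite Normc.normcM [ip w e]ipC normcJ mulrC.
  rewrite H3 -nrm_sq => HE; rewrite mulrBl.
  have H4 : tau * (complex.Re (ip f w * ip w e) + complex.Re (ip f w * ip w e)) <=
      2 * `|tau| * (s * t).
    have [tau0|tau0] := leP 0 tau; [rewrite (ger0_norm tau0)|rewrite (ltr0_norm tau0)]; nra.
  by lra.
have sB : 0 < sigma - B by rewrite subr_gt0; exact: lt_le_trans zs.
(* If [s] vanished, the energy estimate would force [w = 0]. *)
have sp : 0 < s.
  rewrite lt_neqAle s0' andbT; apply/eqP => s00.
  move: energy; rewrite -s00 mul0r mulr0 leNgt mulr_gt0// exprn_gt0//.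
split=> //.
have wbound : nrm w <= 2 * `|tau| * s / (z - B).
  rewrite ler_pdivlMr ?subr_gt0//.
  rewrite -(ler_pM2r nw0); apply: le_trans (_ : 2 * `|tau| * (s * t) <= _).
    apply: le_trans energy; rewrite -mulrA mulrCA -expr2.
    by rewrite ler_wpM2r ?sqr_ge0// lerD2r.
  by rewrite -!mulrA ler_wpM2l// ler_wpM2l// ler_wpM2l.
have expn : ip e w = \sum_(k < K) (sigma ^- k.+1)%:CC *
      (tau%:CC * (ip f w * ip e (H ^+ k *m e) + ip e w * ip e (H ^+ k *m f)))
      + (sigma ^- K)%:CC * ip e (H ^+ K *m w).
  rewrite {1}(resolvent_expansion K _ wE) ?gt_eqF// ipDr ip_sumr ipZr.
  congr (_ + _); apply: eq_bigr => k _.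
  rewrite ipZr; congr (_ * _).
  by rewrite -scalemxAr ipZr mulmxDr ipDr -!scalemxAr !ipZr.
(* All terms are estimated in modulus, so the unknown [sigma] may be replaced by the fixed [z] below
   it. *)
have pw k : 0 <= sigma ^- k <= z ^- k.
  apply/andP; split; first by rewrite invr_ge0 exprn_ge0 ?ltW.
  rewrite lef_pV2 ?posrE ?exprn_gt0//.
  by apply: lerXn2r => //; rewrite nnegrE ltW.
have err : Normc.normc ((sigma ^- K)%:CC * ip e (H ^+ K *m w)) <=
    (B / z) ^+ K * (2 * `|tau| * s / (z - B)).
  rewrite Normc.normcM normc_real ger0_norm; last by have /andP[] := pw K.
  rewrite expr_div_n mulrAC [X in _ <= X]mulrC.
  apply: ler_pM => //; rewrite ?normc_ge0//; first by have /andP[] := pw K.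
    by have /andP[] := pw K.
  apply: (le_trans (cauchy_schwarz _ _)); rewrite ne mul1r.
  apply: (le_trans (ler_nrm (exprn_ge0 K B0) (frob2_exp K w HB))).
  by rewrite ler_wpM2l// exprn_ge0.
set G := \sum_(k < K) _; set A := \sum_(k < K) _.
suff : s <= `|tau| * t * A + `|tau| * s * G + (B / z) ^+ K * (2 * `|tau| * s / (z - B)).
  by move: (_ ^+ K) (_ - _)^-1 => X Y; lra.
rewrite {1}/s expn; apply: (le_trans (le_normcD _ _)); apply: lerD => //.
apply: (le_trans (normc_sum _ _)); rewrite /A /G !mulr_sumr -big_split /=.
apply: ler_sum => k _; rewrite !Normc.normcM !normc_real.
have /andP[p1 p2] := pw k.+1; rewrite ger0_norm//.
have -> : forall a b c d e1 g : R, a * b * (c * d) + a * e1 * (c * g) = c * (a * (b * d + e1 * g)).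
  by move=> *; ring.
apply: ler_pM => //; first by rewrite mulr_ge0 ?normc_ge0.
rewrite ler_wpM2l//; apply: (le_trans (le_normcD _ _)).
by rewrite !Normc.normcM.
Qed.

(* Iterating the eigenvector equation [K] times and pairing with [e] and [f] bounds
   [ip e w] and [ip f w] by each other; the remainder decays like [(B / z)^K]. *)
Lemma rank2_upper (e f w : 'cV[C]_N) (tau sigma z B : R) K :
  0 <= B -> B < z -> z <= sigma -> w != 0 -> frob2 e = 1 -> frob2 f = 1 ->
  (forall y : 'cV[C]_N, frob2 (H *m y) <= B ^+ 2 * frob2 y) ->
  H *m w + tau%:CC *: (ip f w *: e + ip e w *: f) = sigma%:CC *: w ->
  let eta := `|tau| * (wsum z K (fun k => Normc.normc (ip e (H ^+ k *m f))))
             + 2 * `|tau| * (B / z) ^+ K / (z - B) in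
  eta <= 1 ->
  (1 - eta) ^+ 2 <=
    tau ^+ 2 * (wsum z K (fun k => Normc.normc (ip e (H ^+ k *m e))))
             * (wsum z K (fun k => Normc.normc (ip f (H ^+ k *m f)))).
Proof.
rewrite /wsum => B0 Bz zs w0 e1 f1 HB wE; set eta := `|tau| * _ + _ => eta1.
have [sp Hs] := rank2_upper_half K B0 Bz zs w0 e1 f1 HB wE.
(* The equation is symmetric in [e] and [f], so the half estimate also holds with their roles
   exchanged. *)
rewrite [X in _ *: X]addrC in wE.
have [tp Ht] := rank2_upper_half K B0 Bz zs w0 f1 e1 HB wE.
have swap : \sum_(k < K) z ^- k.+1 * Normc.normc (ip f (H ^+ k *m e)) =
    \sum_(k < K) z ^- k.+1 * Normc.normc (ip e (H ^+ k *m f)).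
  by apply: eq_bigr => k _; rewrite moment_conj normcJ.
rewrite swap -/eta in Ht; rewrite -/eta in Hs.
move: Hs Ht sp tp; set s := Normc.normc (ip e w); set t := Normc.normc (ip f w).
set a := \sum_(k < K) _; set b := \sum_(k < K) _ => Hs Ht sp tp.
have st : 0 < s * t by rewrite mulr_gt0.
(* The two half estimates are multiplied and the positive factor [s * t] cancels. *)
rewrite -(ler_pM2l st) -(real_normK (num_real tau)).
have eta1' : 0 <= 1 - eta by rewrite subr_ge0.
have := ler_pM (mulr_ge0 (ltW sp) eta1') (mulr_ge0 (ltW tp) eta1') Hs Ht.
move: (`|tau|) (1 - eta) => x y; congr (_ <= _); ring.
Qed.

(* The hypothesis is tested on the truncated resolvent vector
   [\sum_(k < K) z ^- k.+1 H^k (p e + q f)]. *)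
Lemma rank2_lower (e f : 'cV[C]_N) (tau z p q : R) K : z != 0 ->
  (forall x : 'cV[C]_N, complex.Re (ip x (H *m x)) +
      2 * tau * complex.Re ((ip e x)^*%C * ip f x) <= z * frob2 x) ->
  forall a b gr gi : nat -> R,
  (forall k, complex.Re (ip e (H ^+ k *m e)) = a k) ->
  (forall k, complex.Re (ip f (H ^+ k *m f)) = b k) ->
  (forall k, complex.Re (ip e (H ^+ k *m f)) = gr k) ->
  (forall k, complex.Im (ip e (H ^+ k *m f)) = gi k) ->
  2 * tau * (p ^+ 2 * wsum z K a * wsum z K gr + p * q * wsum z K a * wsum z K b
    + p * q * (wsum z K gr ^+ 2 - wsum z K gi ^+ 2)
    + q ^+ 2 * wsum z K b * wsum z K gr) <=
  p ^+ 2 * wsum z K a + q ^+ 2 * wsum z K b + 2 * p * q * wsum z K gr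
   - z ^- K * wsum z K (fun k => p ^+ 2 * a (k + K)%N + q ^+ 2 * b (k + K)%N
                         + 2 * p * q * gr (k + K)%N).
Proof.
move=> z0 Hz a b gr gi aE bE grE giE.
pose S (h : nat -> R) := wsum z K h; rewrite -!/(S _).
pose g := p%:CC *: e + q%:CC *: f.
(* The truncated resolvent vector inverts z - H up to a telescoping defect z^-L H^L g. *)
have tele L : H *m (\sum_(k < L) (z ^- k.+1)%:CC *: (H ^+ k *m g)) =
    z%:CC *: (\sum_(k < L) (z ^- k.+1)%:CC *: (H ^+ k *m g)) - g
    + (z ^- L)%:CC *: (H ^+ L *m g).
  elim: L => [|L IH].
    by rewrite !big_ord0 mulmx0 scaler0 sub0r !expr0 invr1 mul1mx scale1r addNr.
  rewrite !big_ord_recr /= mulmxDr IH scalerDr scalerA -rmorphM /=.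
  rewrite -scalemxAr mulmxA mulmxE -exprS.
  have -> : z * z ^- L.+1 = z ^- L by rewrite exprS invfM mulrA divff// mul1r.
  congr (_ + _); exact: addrAC.
pose w := \sum_(k < K) (z ^- k.+1)%:CC *: (H ^+ k *m g).
have Hw : H *m w = z%:CC *: w - g + (z ^- K)%:CC *: (H ^+ K *m g) by exact: tele.
pose Gc := (S gr +i* S gi)%C.
have GcE : (S (fun k => complex.Re (ip e (H ^+ k *m f))) +i*
    S (fun k => complex.Im (ip e (H ^+ k *m f))))%C = Gc.
  by congr (_ +i* _)%C; apply: eq_bigr => k _; rewrite ?grE ?giE.
have SE (h : nat -> C) : \sum_(k < K) (z ^- k.+1)%:CC * (h k) =
   (S (fun k => complex.Re (h k)) +i* S (fun k => complex.Im (h k)))%C.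
  apply/eqP; rewrite eq_complex Re_sum Im_sum /=; apply/andP; split; apply/eqP;
  by apply: eq_bigr => k _; rewrite ?ReZ ?ImZ.
have S0 : S (fun=> 0) = 0 by rewrite /S /wsum big1// => k _; rewrite mulr0.
have ipew : ip e w = p%:CC * (S a)%:CC + q%:CC * Gc.
  rewrite /w ip_sumr.
  under eq_bigr do rewrite ipZr mulmxDr -!scalemxAr ipDr !ipZr moment_real mulrDr.
  rewrite big_split /=; congr (_ + _).
    under eq_bigr do rewrite mulrCA.
    by rewrite -mulr_sumr; congr (_ * _); under eq_bigr do rewrite aE; rewrite (SE (fun k => (a k)%:CC)) /= S0.
  under eq_bigr do rewrite mulrCA.
  by rewrite -mulr_sumr; congr (_ * _); rewrite (SE (fun k => ip e (H ^+ k *m f))) GcE.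
have ipfw : ip f w = p%:CC * Gc^*%C + q%:CC * (S b)%:CC.
  rewrite /w ip_sumr.
  under eq_bigr do rewrite ipZr mulmxDr -!scalemxAr ipDr !ipZr (moment_real f) mulrDr.
  rewrite big_split /=; congr (_ + _).
    under eq_bigr do rewrite mulrCA.
    rewrite -mulr_sumr; congr (_ * _).
    under eq_bigr do rewrite (moment_conj e f) -[(z ^- _)%:CC]conjc_real -conjcM.
    by rewrite -[LHS](@rmorph_sum _ _ (@conjc R)) (SE (fun k => ip e (H ^+ k *m f))) GcE.
  under eq_bigr do rewrite mulrCA.
  by rewrite -mulr_sumr; congr (_ * _); under eq_bigr do rewrite bE; rewrite (SE (fun k => (b k)%:CC)) /= S0.
have ipwg : complex.Re (ip w g) = p ^+ 2 * S a + q ^+ 2 * S b + 2 * p * q * S gr.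
  rewrite ipC /g ipDl !ipZl ipew ipfw /Gc /=; ring.
have tail : complex.Re (ip w (H ^+ K *m g)) = 
   S (fun k => p ^+ 2 * a (k + K)%N + q ^+ 2 * b (k + K)%N + 2 * p * q * gr (k + K)%N).
  rewrite /w ip_suml Re_sum; apply: eq_bigr => k _.
  rewrite ipZl conjc_real ReZ; congr (_ * _).
  have <- : ip g (H ^+ (k + K) *m g) = ip (H ^+ k *m g) (H ^+ K *m g).
    by rewrite exprD -mulmxE -mulmxA ip_adj conjT_exp.
  rewrite mulmxDr -!scalemxAr ipDl !ipDr !ipZl !ipZr !conjc_real.
  rewrite (moment_conj e f) !ReD -!mulrA !ReZ aE bE grE.
  have -> : complex.Re (ip e (H ^+ (k + K) *m f))^*%C = gr (k + K)%N.
    by rewrite -grE; case: (ip e _).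
  ring.
have := Hz w; rewrite Hw !ipDr ipNr !ipZr !ReD ReN !ReZ ipxx /= ipwg tail.
rewrite ipew ipfw.
have -> : complex.Re ((p%:CC * (S a)%:CC + q%:CC * Gc)^* * (p%:CC * Gc^* + q%:CC * (S b)%:CC))%C
  = p ^+ 2 * S a * S gr + p * q * S a * S b
    + p * q * (S gr ^+ 2 - S gi ^+ 2) + q ^+ 2 * S b * S gr.
  by rewrite /Gc /=; ring.
lra.
Qed.

End RankTwoPerturbation.

(** * Random signs *)

Section Rademacher.
Context {R : realType}.

Fixpoint signs n : seq (seq R) :=
  if n is n'.+1 then
    [seq 1 :: s | s <- signs n'] ++ [seq -1 :: s | s <- signs n']
  else [:: [::]].

Lemma size_signs n : size (signs n) = (2 ^ n)%N.
Proof. by elim: n => //= n IH; rewrite size_cat !size_map IH expnS mul2n addnn. Qed.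

Lemma signs_sq n s i : s \in signs n -> (i < n)%N -> (s`_i) ^+ 2 = 1.
Proof.
elim: n s i => // n IH s i /=; rewrite mem_cat => /orP[] /mapP[t tn ->];
by case: i => [|i] /=; rewrite ?sqrrN ?expr1n// ltnS; apply: IH.
Qed.

(** The expectation over independent uniform signs, as a finite sum; [avgS] conditions on the first
    sign. *)
Definition avg n (F : seq R -> R) : R := (2 ^+ n)^-1 * \sum_(s <- signs n) F s.

Lemma avg0 F : avg 0 F = F [::].
Proof. by rewrite /avg expr0 invr1 mul1r big_seq1. Qed.

Lemma avgS n F :
  avg n.+1 F = (avg n (fun s => F (1 :: s)) + avg n (fun s => F (-1 :: s))) / 2.
Proof.
rewrite /avg /= big_cat !big_map /= exprS invfM; ring.
Qed.

Lemma eq_avg n F G : {in signs n, F =1 G} -> avg n F = avg n G.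
Proof. by move=> FG; rewrite /avg; congr (_ * _); apply: eq_big_seq. Qed.

Lemma avgD n F G : avg n (fun s => F s + G s) = avg n F + avg n G.
Proof. by rewrite /avg big_split mulrDr. Qed.

Lemma avgZ n c F : avg n (fun s => c * F s) = c * avg n F.
Proof. by rewrite /avg -mulr_sumr mulrCA. Qed.

Lemma avg_cst n c : avg n (fun=> c) = c.
Proof.
rewrite /avg big_const_seq count_predT size_signs iter_addr addr0.
by rewrite -[c *+ _]mulr_natr natrX mulrCA mulVf ?mulr1// expf_neq0.
Qed.

Lemma avg_ge0 n F : (forall s, 0 <= F s) -> 0 <= avg n F.
Proof. by move=> F0; rewrite mulr_ge0 ?invr_ge0 ?exprn_ge0 ?sumr_ge0. Qed.

Lemma avg_cauchy_schwarz n F G :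
  avg n (fun s => F s * G s) ^+ 2 <=
  avg n (fun s => F s ^+ 2) * avg n (fun s => G s ^+ 2).
Proof.
set A := avg n (fun s => F s ^+ 2); set B := avg n (fun s => F s * G s).
set D := avg n (fun s => G s ^+ 2).
have H t : 0 <= A + - 2 * t * B + t ^+ 2 * D.
  rewrite /A /B /D -!avgZ -!avgD; apply: avg_ge0 => s.
  by rewrite (_ : _ + _ = (F s - t * G s) ^+ 2) ?sqr_ge0//; ring.
have D0 : 0 <= D by apply: avg_ge0 => s; exact: sqr_ge0.
have [D00|Dp] := eqVneq D 0; last first.
  have Dgt : 0 < D by rewrite lt_neqAle eq_sym Dp.
  have := H (B / D); rewrite -(pmulr_rge0 _ Dgt).
  have -> : D * (A + - 2 * (B / D) * B + (B / D) ^+ 2 * D) = A * D - B ^+ 2 by field.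
  by rewrite subr_ge0.
rewrite D00 mulr0; have [->|B0] := eqVneq B 0; first by rewrite expr0n.
(* With [D = 0] the polynomial in [t] is affine; this [t] would give it the value -1. *)
have := H ((A + 1) / (2 * B)); rewrite D00.
have -> : A + - 2 * ((A + 1) / (2 * B)) * B + ((A + 1) / (2 * B)) ^+ 2 * 0 = -1 by field.
by rewrite lerNr oppr0 ler10.
Qed.

Definition rlin n (b : nat -> R) (s : seq R) := \sum_(i < n) b i * s`_i.

Lemma rlin_cons n b x s :
  rlin n.+1 b (x :: s) = x * b 0%N + rlin n (fun i => b i.+1) s.
Proof. by rewrite /rlin big_ord_recl /= mulrC. Qed.

Lemma rlin_moment2 n b :
  avg n (fun s => rlin n b s ^+ 2) = \sum_(i < n) b i ^+ 2.
Proof.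
elim: n b => [|n IH] b; first by rewrite avg0 /rlin !big_ord0 expr0n.
rewrite avgS big_ord_recl /= -(IH (fun i => b i.+1)).
rewrite (@eq_avg n _ (fun s => b 0%N ^+ 2 + (2 * b 0%N * rlin n (fun i => b i.+1) s
  + rlin n (fun i => b i.+1) s ^+ 2))); last by move=> s _; rewrite rlin_cons; ring.
rewrite (@eq_avg n (fun s => rlin n.+1 b (-1 :: s) ^+ 2)
  (fun s => b 0%N ^+ 2 + (- 2 * b 0%N * rlin n (fun i => b i.+1) s
  + rlin n (fun i => b i.+1) s ^+ 2))); last by move=> s _; rewrite rlin_cons; ring.
by rewrite !avgD !avgZ !avg_cst; field.
Qed.

(** Khinchine's inequality with constant 3. Odd powers of the first sign cancel, leaving c^4 + 6 c^2
    V plus the fourth moment of the tail, and c^4 + 6 c^2 V + 3 V^2 <= 3 (c^2 + V)^2. *)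
Lemma rlin_moment4 n b :
  avg n (fun s => rlin n b s ^+ 4) <= 3 * (\sum_(i < n) b i ^+ 2) ^+ 2.
Proof.
elim: n b => [|n IH] b; first by rewrite avg0 /rlin !big_ord0 !expr0n mulr0.
rewrite avgS big_ord_recl /=.
set c := b 0%N; pose L := rlin n (fun i => b i.+1).
rewrite (@eq_avg n _ (fun s => c ^+ 4 + (4 * c ^+ 3 * L s + (6 * c ^+ 2 * L s ^+ 2
  + (4 * c * L s ^+ 3 + L s ^+ 4))))); last by move=> s _; rewrite rlin_cons -/c -/(L s); ring.
rewrite (@eq_avg n (fun s => rlin n.+1 b (-1 :: s) ^+ 4)
  (fun s => c ^+ 4 + (- 4 * c ^+ 3 * L s + (6 * c ^+ 2 * L s ^+ 2
  + (- 4 * c * L s ^+ 3 + L s ^+ 4))))); last by move=> s _; rewrite rlin_cons -/c -/(L s); ring.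
rewrite !avgD !avgZ !avg_cst rlin_moment2.
have := IH (fun i => b i.+1); rewrite -/L.
set V := \sum_(i < n) _; set X := avg n (fun s => L s ^+ 4) => HX.
set Y := avg n L; set Z := avg n (fun s => L s ^+ 3).
have := sqr_ge0 (c ^+ 2); nra.
Qed.

Definition shift (a : nat -> nat -> R) i j := a i.+1 j.+1.

(* [\sum_(i < j < n) a i j * s_i * s_j], with the first sign split off. *)
Fixpoint chaos n (a : nat -> nat -> R) (s : seq R) : R :=
  if n is n'.+1 then
    head 0 s * rlin n' (fun j => a 0%N j.+1) (behead s) + chaos n' (shift a) (behead s)
  else 0.

(** The second moment of [chaos]: the products s_i s_j with i < j are orthonormal. *)
Fixpoint chaos_var n (a : nat -> nat -> R) : R :=
  if n is n'.+1 then
    \sum_(j < n') (a 0%N j.+1) ^+ 2 + chaos_var n' (shift a)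
  else 0.

Lemma chaos_var_ge0 n a : 0 <= chaos_var n a.
Proof.
elim: n a => //= n IH a; rewrite addr_ge0//.
by apply: sumr_ge0 => i _; exact: sqr_ge0.
Qed.

(** Hypercontractivity for quadratic forms in signs, by splitting off the first sign: only L^4, 6
    L^2 Q^2 and Q^4 survive, and the mixed term is handled by Cauchy-Schwarz. The constant closes
    the induction because 3 V^2 + 108 V W + 81 W^2 <= 81 (V + W)^2. *)
Lemma chaos_moment4 n a :
  avg n (fun s => chaos n a s ^+ 4) <= 81 * chaos_var n a ^+ 2.
Proof.
elim: n a => [|n IH] a; first by rewrite avg0 /= !expr0n mulr0.
rewrite avgS /=.
have := rlin_moment4 n (fun j => a 0%N j.+1); have := IH (shift a).
set L := rlin n _; set Q := chaos n (shift a).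
set V := \sum_(j < n) _; set W := chaos_var n (shift a) => HQ HL.
have V0 : 0 <= V by apply: sumr_ge0 => i _; exact: sqr_ge0.
have W0 : 0 <= W by exact: chaos_var_ge0.
rewrite (@eq_avg n _ (fun s => L s ^+ 4 + (4 * (L s ^+ 3 * Q s) + (6 * (L s ^+ 2 * Q s ^+ 2)
  + (4 * (L s * Q s ^+ 3) + Q s ^+ 4))))); last by move=> s _; ring.
rewrite (@eq_avg n (fun s => (-1 * L s + Q s) ^+ 4)
  (fun s => L s ^+ 4 + (- 4 * (L s ^+ 3 * Q s) + (6 * (L s ^+ 2 * Q s ^+ 2)
  + (- 4 * (L s * Q s ^+ 3) + Q s ^+ 4))))); last by move=> s _; ring.
rewrite !avgD !avgZ.
have := avg_cauchy_schwarz n (fun s => L s ^+ 2) (fun s => Q s ^+ 2).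
rewrite (@eq_avg n (fun s => (L s ^+ 2) ^+ 2) (fun s => L s ^+ 4)); last by move=> s _; ring.
rewrite (@eq_avg n (fun s => (Q s ^+ 2) ^+ 2) (fun s => Q s ^+ 4)); last by move=> s _; ring.
set A := avg n (fun s => L s ^+ 4) in HL *; set B := avg n (fun s => Q s ^+ 4) in HQ *.
set M := avg n (fun s => L s ^+ 2 * Q s ^+ 2) => HM.
have A0 : 0 <= A by apply: avg_ge0 => s; rewrite exprn_even_ge0.
have B0 : 0 <= B by apply: avg_ge0 => s; rewrite exprn_even_ge0.
(* The two moment bounds give 3 * 81 = 243 times (V W)^2, and 18^2 = 324 is a convenient square
   above it. *)
have HAB : A * B <= (18 * (V * W)) ^+ 2.
  have := ler_pM A0 B0 HL HQ; have := sqr_ge0 (V * W); nra.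
have {}HM : M <= 18 * (V * W).
  have M0 : 0 <= M by apply: avg_ge0 => s; rewrite mulr_ge0// sqr_ge0.
  have VW0 : 0 <= 18 * (V * W) by rewrite mulr_ge0// mulr_ge0.
  by rewrite -(@ler_pXn2r _ 2)//; exact: le_trans HAB.
have := sqr_ge0 V; have := mulr_ge0 V0 W0; nra.
Qed.

Lemma quadratic_chaos n (B : nat -> nat -> R) s :
  size s = n ->
  \sum_(i < n) \sum_(j < n) B i j * s`_i * s`_j =
  \sum_(i < n) B i i * s`_i ^+ 2 + chaos n (fun i j => B i j + B j i) s.
Proof.
elim: n B s => [|n IH] B [|x s]//=; first by rewrite !big_ord0 addr0.
move=> [sn]; rewrite !big_ord_recl /=.
under [X in _ + X = _]eq_bigr do rewrite big_ord_recl /=.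
rewrite big_split /= (IH (shift B))// /rlin mulr_sumr.
have -> : \sum_(i < n) x * ((B 0%N i.+1 + B i.+1 0%N) * s`_i) =
   \sum_(i < n) B 0%N i.+1 * x * s`_i + \sum_(i < n) B i.+1 0%N * s`_i * x.
  by rewrite -big_split /=; apply: eq_bigr => i _; ring.
rewrite /shift /=; ring.
Qed.

Lemma chaos_var_le n (B : nat -> nat -> R) :
  chaos_var n (fun i j => B i j + B j i) <= 2 * \sum_(i < n) \sum_(j < n) B i j ^+ 2.
Proof.
elim: n B => [|n IH] B /=; first by rewrite big_ord0 mulr0.
rewrite !big_ord_recl /=.
under [X in _ <= 2 * (_ + X)]eq_bigr do rewrite big_ord_recl /=.
rewrite big_split /=.
have := IH (shift B); rewrite /shift /=.
have : \sum_(j < n) (B 0%N j.+1 + B j.+1 0%N) ^+ 2 <=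
    2 * (\sum_(i < n) B 0%N i.+1 ^+ 2 + \sum_(i < n) B i.+1 0%N ^+ 2).
  rewrite -big_split mulr_sumr /=; apply: ler_sum => i _.
  by have := sqr_ge0 (B 0%N i.+1 - B i.+1 0%N); nra.
have := sqr_ge0 (B 0%N 0%N).
move=> H1 H2 H3; lra.
Qed.

Lemma size_mem_signs n s : s \in signs n -> size s = n.
Proof.
elim: n s => [|n IH] s /=; first by rewrite inE => /eqP ->.
by rewrite mem_cat => /orP[] /mapP[t /IH tn ->] /=; rewrite tn.
Qed.

(** Since s_i^2 = 1, the diagonal is deterministic and the centred form is a pure chaos. Its
    variance is at most twice the sum of squares, whence 81 * 2^2 = 18^2. *)
Lemma quadratic_moment4 n (B : nat -> nat -> R) :
  avg n (fun s => (\sum_(i < n) \sum_(j < n) B i j * s`_i * s`_j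
                   - \sum_(i < n) B i i) ^+ 4)
  <= (18 * \sum_(i < n) \sum_(j < n) B i j ^+ 2) ^+ 2.
Proof.
rewrite (@eq_avg n _ (fun s => chaos n (fun i j => B i j + B j i) s ^+ 4)); last first.
  move=> s sn; congr (_ ^+ 4); rewrite quadratic_chaos ?(size_mem_signs sn)//.
  rewrite addrAC -sumrB big1 ?add0r// => i _.
  by rewrite (signs_sq sn)// mulr1 subrr.
apply: (le_trans (chaos_moment4 _ _)).
have := chaos_var_le n B; have := chaos_var_ge0 n (fun i j => B i j + B j i).
by nra.
Qed.

End Rademacher.

(** * Normalized sign vectors and unitary maps between unit vectors *)

Section SignVectors.
Context {R : realType}.
Local Notation C := R[i].
Local Notation "x %:CC" := (real_complex R x) (at level 2, format "x %:CC").

(** A real unit vector, so that in the real case it can be carried to [u] by an orthogonal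
    matrix. *)
Definition sgnvec p (s : seq R) : 'cV[C]_p :=
  \col_i (s`_i / Num.sqrt p%:R)%:CC.

Lemma sgnvec_real p s : real_mx (sgnvec p s).
Proof. by move=> i j; rewrite mxE. Qed.

Lemma frob2_sgnvec p s : (0 < p)%N -> s \in signs p -> frob2 (sgnvec p s) = 1.
Proof.
move=> p0 sp; rewrite frob2_col.
under eq_bigr => i _ do rewrite mxE csq_real expr_div_n (signs_sq sp)// sqr_sqrtr ?ler0n//.
by rewrite sumr_const card_ord -[LHS]mulr_natr mul1r mulVf// pnatr_eq0 -lt0n.
Qed.

Lemma sgnvec_quadratic_moment4 p (A : 'M[C]_p) : (0 < p)%N ->
  avg p (fun s => (complex.Re (ip (sgnvec p s) (A *m sgnvec p s))
                   - complex.Re (\tr A) / p%:R) ^+ 4)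
  <= (18 * (frob2 A / p%:R ^+ 2)) ^+ 2.
Proof.
move=> p0; pose i0 := Ordinal p0.
have pR : (p%:R : R) != 0 by rewrite pnatr_eq0 -lt0n.
(* Sign sums take coefficients indexed by [nat]; [insubd] extends the matrix by a default that is
   never read below [p]. *)
pose B i j := complex.Re (A (insubd i0 i) (insubd i0 j)) / p%:R.
have BE (i j : 'I_p) : B i j = complex.Re (A i j) / p%:R by rewrite /B !valKd.
rewrite (@eq_avg _ p _ (fun s => (\sum_(i < p) \sum_(j < p) B i j * s`_i * s`_j
                   - \sum_(i < p) B i i) ^+ 4)).
  apply: (le_trans (quadratic_moment4 _ _)).
  apply: lerXn2r.
  - rewrite nnegrE mulr_ge0//.
    by do 2!apply: sumr_ge0 => ? _; exact: sqr_ge0.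
  - by rewrite nnegrE mulr_ge0// divr_ge0 ?frob2_ge0 ?sqr_ge0.
  apply: ler_wpM2l => //; rewrite frob2_csq mulr_suml; apply: ler_sum => i _.
  rewrite mulr_suml; apply: ler_sum => j _.
  rewrite BE expr_div_n ler_wpM2r ?invr_ge0 ?sqr_ge0//.
  by rewrite /csq lerDl sqr_ge0.
move=> s sp; congr ((_ - _) ^+ 4); last first.
  rewrite /mxtrace Re_sum mulr_suml; apply: eq_bigr => i _; exact/esym/BE.
rewrite ipE Re_sum; apply: eq_bigr => i _.
rewrite mxE conjc_real ReZ mxE Re_sum mulr_sumr; apply: eq_bigr => j _.
rewrite mxE mulrC [A i j * _]mulrC ReZ BE.
have sq : (Num.sqrt (p%:R : R))^-1 * (Num.sqrt p%:R)^-1 = p%:R^-1.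
  by rewrite -invfM -expr2 sqr_sqrtr.
have -> : forall x y z t : R, x / z * t * (y / z) = t * (z^-1 * z^-1) * y * x.
  by move=> *; ring.
by rewrite sq.
Qed.

Lemma ip_sgnvec p s (y : 'cV[C]_p) :
  ip (sgnvec p s) y = \sum_(i < p) (s`_i / Num.sqrt p%:R)%:CC * y i 0.
Proof. by rewrite ipE; apply: eq_bigr => i _; rewrite mxE conjc_real. Qed.

Lemma sgnvec_linear_moment4 p (y : 'I_p -> R) V : (0 < p)%N ->
  \sum_i y i ^+ 2 <= V ->
  avg p (fun s => (\sum_(i < p) s`_i / Num.sqrt p%:R * y i) ^+ 4)
  <= 3 * (V / p%:R) ^+ 2.
Proof.
move=> p0 yV; pose i0 := Ordinal p0.
pose b i := y (insubd i0 i) / Num.sqrt p%:R.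
have bE (i : 'I_p) : b i = y i / Num.sqrt p%:R by rewrite /b !valKd.
rewrite (@eq_avg _ p _ (fun s => rlin p b s ^+ 4)); last first.
  move=> s sp; congr (_ ^+ 4); apply: eq_bigr => i _; rewrite bE; ring.
apply: (le_trans (rlin_moment4 _ _)); apply: ler_wpM2l => //; apply: lerXn2r.
- by rewrite nnegrE; apply: sumr_ge0 => ? _; exact: sqr_ge0.
- rewrite nnegrE divr_ge0//; apply: le_trans yV.
  by apply: sumr_ge0 => ? _; exact: sqr_ge0.
apply: (@le_trans _ _ (\sum_i y i ^+ 2 / p%:R)).
  by apply: ler_sum => i _; rewrite bE expr_div_n sqr_sqrtr.
by rewrite -mulr_suml ler_wpM2r ?invr_ge0.
Qed.

Lemma sgnvec_Re_moment4 p (y : 'cV[C]_p) : (0 < p)%N ->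
  avg p (fun s => complex.Re (ip (sgnvec p s) y) ^+ 4) <= 3 * (frob2 y / p%:R) ^+ 2.
Proof.
move=> p0; rewrite -(@eq_avg _ p
  (fun s => (\sum_(i < p) s`_i / Num.sqrt p%:R * complex.Re (y i 0)) ^+ 4)).
  apply: sgnvec_linear_moment4 => //; rewrite frob2_col.
  by apply: ler_sum => i _; rewrite /csq lerDl sqr_ge0.
by move=> s _; rewrite ip_sgnvec Re_sum; congr (_ ^+ 4); apply: eq_bigr => i _; rewrite ReZ.
Qed.

Lemma sgnvec_Im_moment4 p (y : 'cV[C]_p) : (0 < p)%N ->
  avg p (fun s => complex.Im (ip (sgnvec p s) y) ^+ 4) <= 3 * (frob2 y / p%:R) ^+ 2.
Proof.
move=> p0; rewrite -(@eq_avg _ p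
  (fun s => (\sum_(i < p) s`_i / Num.sqrt p%:R * complex.Im (y i 0)) ^+ 4)).
  apply: sgnvec_linear_moment4 => //; rewrite frob2_col.
  by apply: ler_sum => i _; rewrite /csq lerDr sqr_ge0.
by move=> s _; rewrite ip_sgnvec Im_sum; congr (_ ^+ 4); apply: eq_bigr => i _; rewrite ImZ.
Qed.

Lemma real_conjc (z : C) : complex.Im z = 0 <-> z^*%C = z.
Proof.
case: z => a b /=; split=> [->|[] /eqP]; first by rewrite oppr0.
by rewrite eq_sym -addr_eq0 -mulr2n -mulr_natl mulf_eq0 pnatr_eq0 /= => /eqP.
Qed.

(* The complex analogue of a Householder reflection: with [w = x - u] and
   [d = 1 - u^H x], unitarity amounts to [|w|^2 = d + d^*]. *)
Lemma unitary_transport (Kr : bool) p (x u : 'cV[C]_p) :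
  frob2 x = 1 -> frob2 u = 1 -> (Kr -> real_mx x /\ real_mx u) ->
  exists U : 'M[C]_p, [/\ orthonormal_cols U, (Kr -> real_mx U) & U *m x = u].
Proof.
move=> x1 u1 Kxu; pose w := x + (- u); pose d := 1 - ip u x.
have ww : ip w w = d + d^*%C.
  rewrite ipxx /w frob2D frob2N x1 u1 ipNr ReN /d [ip u x]ipC.
  by case: (ip x u) => a b; apply/eqP; rewrite eq_complex /=; apply/andP; split; apply/eqP; ring.
have [d0|d0] := eqVneq d 0.
  have w0 : w = 0.
    apply/eqP; rewrite -frob2_eq0; apply/eqP.
    by move: ww; rewrite d0 conjc0 addr0 ipxx => /(congr1 (@complex.Re R)).
  exists 1%:M; split.
  - by rewrite /orthonormal_cols conjT1 mul1mx.
  - by move=> _ i j; rewrite mxE; case: (i == j).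
  - by rewrite mul1mx; apply/eqP; rewrite -subr_eq0 -/w w0.
have dc0 : d^*%C != 0 by rewrite conjc_eq0.
pose c : C := - d^-1.
have cE : c^*%C = - (d^*%C)^-1 by rewrite rmorphN /= conjc_inv.
(* This is 1 - d^-1 w w^H. It sends [x] to [x - w = u] because w^H x = 1 - u^H x = d. *)
exists (1%:M + c *: (w *m conjT w)); split.
- rewrite /orthonormal_cols conjTD conjT1 conjTZ conjT_rank1.
  rewrite mulmxDl mul1mx mulmxDr mulmx1 -!scalemxAl -!scalemxAr.
  rewrite mulmxA rank1_mul -!scalemxAl !scalerA -addrA -!scalerDl.
  rewrite ww (_ : c + _ = 0) ?scale0r ?addr0//.
  by rewrite cE /c; field; apply/andP.
- move=> Kr1; have [xr ur] := Kxu Kr1.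
  have wr k : (w k 0)^*%C = w k 0.
    by apply/real_conjc; rewrite !mxE ImD; move: (xr k 0) (ur k 0); case: (u k 0) => a b /= -> ->; rewrite oppr0 addr0.
  have dr : d^*%C = d.
    rewrite /d rmorphB [X in X - _]conjc1 [X in _ - X]/= -ipC; congr (_ - _); rewrite !ipE.
    by apply: eq_bigr => k _; rewrite (proj1 (real_conjc _) (xr _ _)) (proj1 (real_conjc _) (ur _ _)) mulrC.
  move=> i j; apply/real_conjc; rewrite !mxE rmorphD; congr (_ + _).
    by rewrite rmorphMn rmorph1.
  rewrite rmorphM /= cE dr; congr (_ * _).
  rewrite rmorph_sum; apply: eq_bigr => k _.
  by rewrite rmorphM /= conjTE conjcK !ord1 !wr.
- rewrite mulmxDl mul1mx -scalemxAl rank1_mul scalerA.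
  have -> : ip w x = d.
    rewrite /w ipDl -scaleN1r ipZl ipxx x1 /d.
    have -> : (-1 : C)^*%C = -1 by rewrite rmorphN rmorph1.
    by rewrite mulN1r.
  by rewrite mulNr mulVf// scaleN1r /w opprD opprK addrA subrr add0r.
Qed.

End SignVectors.

(** * Moments of bi-invariant random matrices *)

Section MatrixLaws.
Context {R : realType}.
Local Notation C := R[i].
Local Notation "x %:CC" := (real_complex R x) (at level 2, format "x %:CC").

(* The sigma-algebra generated by the entries, on entry arrays rather than on
   matrices because [R[i]] is not declared pointed. *)
Definition rectangles p q : set (set ('I_p -> 'I_q -> R * R)) :=
  [set S | exists A B : 'I_p -> 'I_q -> set R,
     (forall i j, measurable (A i j) /\ measurable (B i j)) /\
     S = [set e | forall i j, A i j (e i j).1 /\ B i j (e i j).2]].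

Definition entries p q (M : 'M[C]_(p, q)) : 'I_p -> 'I_q -> R * R :=
  fun i j => (complex.Re (M i j), complex.Im (M i j)).

Definition of_entries p q (e : 'I_p -> 'I_q -> R * R) : 'M[C]_(p, q) :=
  \matrix_(i, j) ((e i j).1 +i* (e i j).2)%C.

Lemma entriesK p q : cancel (@entries p q) (@of_entries p q).
Proof.
by move=> M; apply/matrixP => i j; rewrite mxE /entries /=; case: (M i j).
Qed.

(** Measurability is tested through pullbacks by all random matrices; the test on [of_entries] gives
    membership in the sigma-algebra generated by [rectangles]. *)
Definition mx_measurable p q (S : set 'M[C]_(p, q)) :=
  forall d (T : measurableType d) (Y : T -> 'M[C]_(p, q)),
    rand_mx Y -> measurable (Y @^-1` S).

Definition mx_measurable_fun p q (f : 'M[C]_(p, q) -> R) :=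
  forall d (T : measurableType d) (Y : T -> 'M[C]_(p, q)),
    rand_mx Y -> measurable_fun setT (f \o Y).

Lemma measurable_forall d (T : measurableType d) (I : finType) (F : I -> set T) :
  (forall i, measurable (F i)) -> measurable [set w | forall i, F i w].
Proof.
move=> mF; have -> : [set w | forall i, F i w] = \bigcap_(i in setT) F i.
  by apply/seteqP; split => w /= H i; [move=> _|]; apply: H.
by apply: fin_bigcap_measurable => //; exact: finite_finset.
Qed.

Lemma rectangles_setI p q : setI_closed (@rectangles p q).
Proof.
move=> _ _ [A [B [mAB ->]]] [A' [B' [mAB' ->]]].
exists (fun i j => A i j `&` A' i j), (fun i j => B i j `&` B' i j); split.
  move=> i j; have [? ?] := mAB i j; have [? ?] := mAB' i j.
  by split; exact: measurableI.
apply/seteqP; split => [e [H H'] i j|e H].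
  by have [? ?] := H i j; have [? ?] := H' i j.
by split => i j; have [[? ?] [? ?]] := H i j.
Qed.

Lemma measurable_entries d (T : measurableType d) p q (Y : T -> 'M[C]_(p, q)) :
  rand_mx Y ->
  @measurable_fun _ _ T (g_sigma_algebraType (@rectangles p q)) setT (@entries p q \o Y).
Proof.
move=> mY; apply: (@measurability _ _ T (g_sigma_algebraType (@rectangles p q)) setT _ (@rectangles p q)); first by [].
move=> _ [_ [A [B [mAB ->]]] <-]; rewrite setTI.
apply: measurable_forall => i; apply: measurable_forall => j.
have [mR mI] := mY i j; have [mA mB] := mAB i j.
rewrite [X in measurable X](_ : _ =
   ((fun w => complex.Re (Y w i j)) @^-1` A i j) `&`
   ((fun w => complex.Im (Y w i j)) @^-1` B i j))//.
by apply: measurableI; rewrite -[X in measurable X]setTI; [exact: mR|exact: mI].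
Qed.

Lemma rand_mx_of_entries p q :
  rand_mx (@of_entries p q : g_sigma_algebraType (@rectangles p q) -> 'M[C]_(p, q)).
Proof.
move=> i j; split => _ D mD; rewrite setTI; apply: sub_sigma_algebra.
- exists (fun i' j' => if (i' == i) && (j' == j) then D else setT), (fun _ _ => setT).
  split=> [i' j'|]; first by split => //; case: ifP.
  apply/seteqP; split => e /=; rewrite mxE /= => H.
    by move=> i' j'; split => //; case: ifP => // /andP[/eqP -> /eqP ->].
  by have [] := H i j; rewrite !eqxx.
- exists (fun _ _ => setT), (fun i' j' => if (i' == i) && (j' == j) then D else setT).
  split=> [i' j'|]; first by split => //; case: ifP.
  apply/seteqP; split => e /=; rewrite mxE /= => H.
    by move=> i' j'; split => //; case: ifP => // /andP[/eqP -> /eqP ->].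
  by have [] := H i j; rewrite !eqxx.
Qed.

(** A pi-lambda argument carried out on entry arrays, where the rectangles are closed under
    intersection and generate the sigma-algebra. *)
Lemma eq_law d (T : measurableType d) (P : probability T R) p q
    (Y Z : T -> 'M[C]_(p, q)) :
  rand_mx Y -> rand_mx Z ->
  (forall (A B : 'I_p -> 'I_q -> set R),
    (forall i j, measurable (A i j) /\ measurable (B i j)) ->
    P [set w | forall i j, A i j (complex.Re (Y w i j)) /\ B i j (complex.Im (Y w i j))] =
    P [set w | forall i j, A i j (complex.Re (Z w i j)) /\ B i j (complex.Im (Z w i j))]) ->
  forall S, mx_measurable S -> P (Y @^-1` S) = P (Z @^-1` S).
Proof.
move=> mY mZ YZ S mS.
have mY' := measurable_entries mY; have mZ' := measurable_entries mZ.
pose E := @of_entries p q @^-1` S.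
have mE : <<s @rectangles p q >> E by exact: (mS _ _ _ (@rand_mx_of_entries p q)).
have pre (W : T -> 'M[C]_(p, q)) : W @^-1` S = (@entries p q \o W) @^-1` E.
  by apply/seteqP; split => w; rewrite /E /= entriesK.
rewrite !pre; move: E mE {pre}.
apply: (@dynkin_induction _ (g_sigma_algebraType (@rectangles p q))
  (@rectangles p q) (fun E => P ((@entries p q \o Y) @^-1` E) = P ((@entries p q \o Z) @^-1` E))).
- by [].
- exact: rectangles_setI.
- by rewrite !preimage_setT.
- by move=> _ [A [B [mAB ->]]]; exact: YZ.
- move=> E mE YE; rewrite preimage_setC [in RHS]preimage_setC.
  rewrite probability_setC; last by rewrite -[X in measurable X]setTI; exact: mY'.
  rewrite probability_setC; last by rewrite -[X in measurable X]setTI; exact: mZ'.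
  by rewrite YE.
- move=> F mF tF YF; rewrite !preimage_bigcup !measure_bigcup.
  + by apply: eq_eseriesr => i _; exact: YF.
  + by move=> i _; rewrite -[X in measurable X]setTI; exact: mZ'.
  + by move=> i j _ _ [w [Fi Fj]]; apply: tF => //; eexists; split; [exact: Fi|exact: Fj].
  + by move=> i _; rewrite -[X in measurable X]setTI; exact: mY'.
  + by move=> i j _ _ [w [Fi Fj]]; apply: tF => //; eexists; split; [exact: Fi|exact: Fj].
Qed.

Lemma rand_mxM d (T : measurableType d) p q r (Y : T -> 'M[C]_(p, q))
    (Z : T -> 'M[C]_(q, r)) :
  rand_mx Y -> rand_mx Z -> rand_mx (fun w => Y w *m Z w).
Proof.
move=> mY mZ i j; split.
- have -> : (fun w => complex.Re ((Y w *m Z w) i j)) = (fun w => \sum_k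
     (complex.Re (Y w i k) * complex.Re (Z w k j)
      - complex.Im (Y w i k) * complex.Im (Z w k j))).
    apply/funext => w; rewrite mxE Re_sum; apply: eq_bigr => k _.
    by case: (Y w i k) (Z w k j) => [a b] [x y].
  apply: measurable_sum => k; have [? ?] := mY i k; have [? ?] := mZ k j.
  by apply: measurable_funB; apply: measurable_funM.
- have -> : (fun w => complex.Im ((Y w *m Z w) i j)) = (fun w => \sum_k
     (complex.Re (Y w i k) * complex.Im (Z w k j)
      + complex.Im (Y w i k) * complex.Re (Z w k j))).
    apply/funext => w; rewrite mxE Im_sum; apply: eq_bigr => k _.
    by case: (Y w i k) (Z w k j) => [a b] [x y].
  apply: measurable_sum => k; have [? ?] := mY i k; have [? ?] := mZ k j.
  by apply: measurable_funD; apply: measurable_funM.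
Qed.

Lemma rand_mx_cst d (T : measurableType d) p q (M : 'M[C]_(p, q)) :
  rand_mx (fun _ : T => M).
Proof. by move=> i j; split; exact: measurable_cst. Qed.

Lemma rand_mx_conjT d (T : measurableType d) p q (Y : T -> 'M[C]_(p, q)) :
  rand_mx Y -> rand_mx (fun w => conjT (Y w)).
Proof.
move=> mY i j; have [mR mI] := mY j i; split.
- rewrite (_ : (fun w => _) = (fun w => complex.Re (Y w j i)))//.
  by apply/funext => w; rewrite conjTE; case: (Y w j i).
- rewrite (_ : (fun w => _) = (fun w => - complex.Im (Y w j i))).
    exact: measurableT_comp.
  by apply/funext => w; rewrite conjTE; case: (Y w j i).
Qed.

Lemma rand_mxX d (T : measurableType d) p (Y : T -> 'M[C]_p) k :
  rand_mx Y -> rand_mx (fun w => Y w ^+ k).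
Proof.
move=> mY; elim: k => [|k IH].
  rewrite (_ : (fun w => _) = (fun=> 1%:M)); last by apply/funext => w; rewrite expr0.
  exact: rand_mx_cst.
rewrite (_ : (fun w => _) = (fun w => Y w *m Y w ^+ k)); last first.
  by apply/funext => w; rewrite exprS.
exact: rand_mxM.
Qed.

Lemma rand_mx_Re_trace d (T : measurableType d) p (Y : T -> 'M[C]_p) :
  rand_mx Y -> measurable_fun setT (fun w => complex.Re (\tr (Y w))).
Proof.
move=> mY; rewrite (_ : (fun w => _) = (fun w => \sum_i complex.Re (Y w i i))).
  by apply: measurable_sum => i; have [] := mY i i.
by apply/funext => w; rewrite /mxtrace Re_sum.
Qed.

Lemma rand_mx_frob2 d (T : measurableType d) p q (Y : T -> 'M[C]_(p, q)) :
  rand_mx Y -> measurable_fun setT (fun w => frob2 (Y w)).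
Proof.
move=> mY; apply: measurable_sum => i; apply: measurable_sum => j.
by have [? ?] := mY i j; apply: measurable_funD; exact: measurable_funX.
Qed.

Lemma rand_mx_ip d (T : measurableType d) p (x : 'cV[C]_p) (Y : T -> 'cV[C]_p) :
  rand_mx Y -> measurable_fun setT (fun w => complex.Re (ip x (Y w))) /\
    measurable_fun setT (fun w => complex.Im (ip x (Y w))).
Proof. by move=> mY; exact: (rand_mxM (rand_mx_cst _ (conjT x)) mY 0 0). Qed.

Lemma measurable_tail d (T : measurableType d) (f g : T -> R) (e M : R) :
  measurable_fun setT f -> measurable_fun setT g ->
  measurable [set w | e < `|f w| /\ g w <= M].
Proof.
move=> mf mg.
rewrite (_ : [set w | _] = setT `&` (fun w => (e < `|f w|) && (g w <= M)) @^-1` [set true]).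
  apply: (@measurable_and _ _ setT (fun w => e < `|f w|) (fun w => g w <= M)) => //.
    by apply: measurable_fun_ltr => //; exact: measurableT_comp.
  exact: measurable_fun_ler.
by rewrite setTI; apply/seteqP; split => w /= => [[-> ->]|/andP[]].
Qed.

(* Invariance allows averaging [f] over finitely many unitary conjugations before
   applying Markov's inequality, on an event [g <= M] that they preserve. *)
Lemma invariant_markov d (T : measurableType d) (P : probability T R) Kr p q
    (Y : T -> 'M[C]_(p, q)) N (U : seq R -> 'M[C]_p) (V : seq R -> 'M[C]_q)
    (f g : 'M[C]_(p, q) -> R) (M B e : R) :
  rand_mx Y -> biinvariant P Kr Y ->
  mx_measurable_fun f -> mx_measurable_fun g ->
  (forall s, s \in signs N -> [/\ orthonormal_cols (U s), orthonormal_cols (V s),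
      (Kr -> real_mx (U s) /\ real_mx (V s)) &
      forall X, g (U s *m X *m V s) = g X]) ->
  0 < e -> 0 <= B ->
  (forall X, g X <= M -> avg N (fun s => f (U s *m X *m V s) ^+ 4) <= B) ->
  (P [set w | (e < `|f (Y w)|)%R /\ (g (Y w) <= M)%R] <= (B / e ^+ 4)%:E)%E.
Proof.
move=> mY invY mf mg HUV e0 B0 HB.
pose Ys s w := U s *m Y w *m V s.
have mYs s : rand_mx (Ys s).
  by apply: rand_mxM; [apply: rand_mxM => //|]; exact: rand_mx_cst.
pose E s := [set w | e < `|f (Ys s w)| /\ g (Y w) <= M].
have mE s : measurable (E s) by apply: measurable_tail; [exact: mf|exact: mg].
set S := [set X | e < `|f X| /\ g X <= M] : set 'M[C]_(p, q).
have mS : mx_measurable S.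
  move=> d' T' Y' mY'; exact: (measurable_tail e M (mf _ _ _ mY') (mg _ _ _ mY')).
have PE s : s \in signs N -> P (E s) = P (Y @^-1` S).
  move=> /HUV[HU HV HK Hg].
  rewrite (eq_law mY (mYs s) (invY _ _ HU HV HK) mS); congr (P _).
  by apply/seteqP; split => w; rewrite /S /E /= /Ys Hg.
(* Markov's inequality is applied pointwise, to the count of signs whose event contains [w]. Where
   [g] exceeds [M] the count is 0, so the integrand is dominated by a constant and [f] itself is
   never integrated. *)
have sumE : (\sum_(s <- signs N) P (E s) <= (2 ^+ N * (B / e ^+ 4))%:E)%E.
  have -> : (\sum_(s <- signs N) P (E s) =
      \int[P]_w \sum_(s <- signs N) (\1_(E s) w)%:E)%E.
    rewrite ge0_integral_sum//; last by move=> s; apply/measurable_EFinP; exact: measurable_indic.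
    by apply: eq_bigr => s _; rewrite integral_indic// setIT.
  apply: (@le_trans _ _ (\int[P]_w (2 ^+ N * (B / e ^+ 4))%:E)%E).
    apply: ge0_le_integral => //.
    - by move=> w _; apply: sume_ge0.
    - by apply: emeasurable_sum => s; apply/measurable_EFinP; exact: measurable_indic.
    - move=> w _; rewrite sumEFin lee_fin.
      have [gM|gM] := leP (g (Y w)) M; last first.
        rewrite big1 => [|s _].
          by rewrite mulr_ge0 ?exprn_ge0// divr_ge0// exprn_ge0// ltW.
        rewrite indicE memNset// => -[_]; rewrite leNgt => /negP; exact.
      have HB' := HB _ gM; rewrite /avg ler_pdivrMl ?exprn_gt0// in HB'.
      rewrite mulrA ler_pdivlMr ?exprn_gt0//; apply: le_trans HB'.
      rewrite mulr_suml; apply: ler_sum => s _.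
      rewrite indicE; case: (boolP (w \in E s)) => [|_]; last first.
        by rewrite mul0r exprn_even_ge0.
      rewrite inE /= mul1r => -[ef _]; rewrite -[leRHS]ger0_norm ?exprn_even_ge0// normrX.
      by apply: lerXn2r; rewrite ?nnegrE ?(ltW e0) ?(ltW ef).
  rewrite integral_cst//. by rewrite [X in (_ * X)%E]probability_setT mule1.
have := sumE; rewrite (eq_big_seq (fun=> P (Y @^-1` S))) => [|s /PE//].
have [r rE] : exists r, P (Y @^-1` S) = r%:E.
  by exists (fine (P (Y @^-1` S))); rewrite fineK// fin_num_measure//; exact: mS.
rewrite rE sumEFin lee_fin big_const_seq count_predT size_signs iter_addr addr0.
by rewrite -[r *+ _]mulr_natl natrX ler_pM2l ?exprn_gt0.
Qed.

End MatrixLaws.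

(** * From summable tail bounds to almost sure convergence *)

Section AlmostSureMoments.
Context {R : realType}.
Local Notation C := R[i].
Local Notation "x %:CC" := (real_complex R x) (at level 2, format "x %:CC").

(** The right side has increments 2/(x (x + 1)), and these dominate 1/x^2 as soon as x >= 1. *)
Lemma inv_square_sum_le N :
  \sum_(0 <= n < N) (n.+1%:R ^+ 2)^-1 <= 2 * (1 - (N.+1%:R)^-1) :> R.
Proof.
elim: N => [|N IH]; first by rewrite big_geq// invr1 subrr mulr0.
rewrite big_nat_recr//=; apply: (le_trans (lerD IH (lexx _))).
have N1 : 1 <= N.+1%:R :> R by rewrite ler1n.
have -> : N.+2%:R = N.+1%:R + 1 :> R by rewrite -natr1.
move: (N.+1%:R) N1 => x x0.
have x1 : 0 < x by lra.
have x2 : 0 < x + 1 by lra.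
rewrite -subr_ge0.
have -> : 2 * (1 - (x + 1)^-1) - (2 * (1 - x^-1) + (x ^+ 2)^-1)
   = (x - 1) / (x ^+ 2 * (x + 1)).
  by field; rewrite !gt_eqF.
by apply: divr_ge0; [lra|apply: mulr_ge0; [exact: sqr_ge0|lra]].
Qed.

Lemma borel_cantelli_inv_square d (T : measurableType d) (P : probability T R)
    (E : nat -> set T) (K : R) :
  (forall n, measurable (E n)) ->
  (forall n, (P (E n) <= (K / n.+1%:R ^+ 2)%:E)%E) ->
  {ae P, forall w, \forall n \near \oo, ~ E n w}.
Proof.
move=> mE PE.
have K0 : 0 <= K.
  have := le_trans (measure_ge0 P (E 0%N)) (PE 0%N).
  by rewrite lee_fin expr1n divr1.
have P0 : P (lim_sup_set E) = 0%E.
  apply: lim_sup_set_cvg0 => //; apply: (@le_lt_trans _ _ (K * 2)%:E); last exact: ltry.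
  apply: lime_le.
    by apply: is_cvg_nneseries => n _ _; exact: measure_ge0.
  apply: nearW => N; apply: (@le_trans _ _ (\sum_(0 <= n < N) (K / n.+1%:R ^+ 2)%:E)%E).
    by apply: lee_sum => n _; exact: PE.
  rewrite sumEFin lee_fin -mulr_sumr ler_wpM2l//.
  apply: (le_trans (inv_square_sum_le N)).
  by rewrite -[leRHS]mulr1 ler_wpM2l// lerBlDr lerDl invr_ge0 ler0n.
exists (lim_sup_set E); split => //.
  by apply: bigcap_measurable => // k _; apply: bigcup_measurable.
move=> w /= Hw n _; apply: contrapT => Hn; apply: Hw.
exists n => // j /= nj Ej; apply: Hn; exists j => //.
Qed.

(** Borel-Cantelli is run for the countably many levels 1/(j+1) and bounds [M] in [nat], which
    yields a single null set; the bound that fits a given sample is selected afterwards. *)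
Lemma ae_cvg0 d (T : measurableType d) (P : probability T R) (F G : nat -> T -> R) :
  (forall n, measurable_fun setT (F n)) -> (forall n, measurable_fun setT (G n)) ->
  (forall e : R, 0 < e -> forall M : nat, exists K, forall n,
    (P [set w | (e < `|F n w|)%R /\ (G n w <= M%:R)%R] <= (K / n.+1%:R ^+ 2)%:E)%E) ->
  {ae P, forall w, (exists M : R, \forall n \near \oo, G n w <= M) ->
    F n w @[n --> \oo] --> (0 : R)}.
Proof.
move=> mF mG H.
have H1 (j M : nat) : {ae P, forall w, \forall n \near \oo,
    ~ (j.+1%:R^-1 < `|F n w| /\ G n w <= M%:R)}.
  have [|K HK] := H (j.+1%:R^-1) _ M; first by rewrite invr_gt0 ltr0n.
  apply: (borel_cantelli_inv_square _ HK) => n; exact: measurable_tail.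
have := ae_foralln (fun j => ae_foralln (H1 j)).
apply: filterS => w Hw [M HM].
apply/cvgr0Pnorm_le => e e0.
have [j je] : exists j : nat, j.+1%:R^-1 <= e.
  exists (Num.truncn e^-1); rewrite -[leRHS]invrK lef_pV2 ?posrE ?invr_gt0 ?ltr0n//.
  by apply: ltW; apply: truncnS_gt.
have MM : M <= (Num.truncn M).+1%:R by apply: ltW; exact: truncnS_gt.
have := Hw j (Num.truncn M).+1; move: HM; apply: filterS2 => n GM nn.
rewrite leNgt; apply/negP => eF; apply: nn; split; first exact: le_lt_trans eF.
exact: le_trans MM.
Qed.

Lemma frob2_trace p q (M : 'M[C]_(p, q)) : (frob2 M)%:CC = \tr (conjT M *m M).
Proof.
rewrite frob2_csq exchange_big /= (rmorph_sum (real_complex R)) /mxtrace.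
apply: eq_bigr => i _.
by rewrite mxE rmorph_sum; apply: eq_bigr => j _; rewrite conjTE; exact: csqE.
Qed.

Lemma gram_conjT p q (M : 'M[C]_(p, q)) : conjT (M *m conjT M) = M *m conjT M.
Proof. by rewrite conjT_mul conjTK. Qed.

Lemma frob2_herm_exp p (A : 'M[C]_p) k : conjT A = A ->
  frob2 (A ^+ k) = complex.Re (\tr (A ^+ (2 * k))).
Proof.
by move=> AH; rewrite mul2n -addnn exprD -{2}(conjT_exp k AH) -mulmxE -frob2_trace.
Qed.

Lemma unitary_conj_exp p (U A : 'M[C]_p) k : orthonormal_cols U ->
  (U *m A *m conjT U) ^+ k = U *m A ^+ k *m conjT U.
Proof.
move=> HU; elim: k => [|k IH].
  by rewrite !expr0 mulmx1 orthonormal_cols_unitary.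
rewrite exprS IH [A ^+ k.+1]exprS -!mulmxE !mulmxA.
by rewrite -[_ *m conjT U *m U]mulmxA HU mulmx1.
Qed.

Lemma unitary_conj_trace p (U A : 'M[C]_p) : orthonormal_cols U ->
  \tr (U *m A *m conjT U) = \tr A.
Proof. by move=> HU; rewrite mxtrace_mulC mulmxA HU mul1mx. Qed.

Lemma orthonormal_cols_conjT p (U : 'M[C]_p) :
  orthonormal_cols U -> orthonormal_cols (conjT U).
Proof.
by move=> HU; rewrite /orthonormal_cols conjTK orthonormal_cols_unitary.
Qed.

Lemma orthonormal_cols1 p : orthonormal_cols (1%:M : 'M[C]_p).
Proof. by rewrite /orthonormal_cols conjT1 mul1mx. Qed.

Lemma real_mx1 p : real_mx (1%:M : 'M[C]_p).
Proof. by move=> i j; rewrite mxE; case: (i == j). Qed.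

Lemma real_mx_conjT p q (M : 'M[C]_(p, q)) : real_mx M -> real_mx (conjT M).
Proof. by move=> rM i j; rewrite conjTE /= ; move: (rM j i); case: (M j i) => a b /= ->; rewrite oppr0. Qed.

(** Replacing X by U X turns u^H (X X^H)^k u into the same form at U^H u, here a sign vector. *)
Lemma sign_rotation (Kr : bool) p (u : 'cV[C]_p) : (0 < p)%N -> frob2 u = 1 ->
  (Kr -> real_mx u) ->
  exists U : seq R -> 'M[C]_p, forall s, s \in signs p ->
   [/\ orthonormal_cols (U s), (Kr -> real_mx (U s)) & conjT (U s) *m u = sgnvec p s].
Proof.
move=> p0 u1 Ku.
have H s : exists U : 'M[C]_p, s \in signs p ->
   [/\ orthonormal_cols U, (Kr -> real_mx U) & conjT U *m u = sgnvec p s].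
  case: (boolP (s \in signs p)) => [sp|_]; last by exists 1%:M.
  have [|U [HU KU UE]] := unitary_transport (Kr := Kr) (frob2_sgnvec p0 sp) u1.
    by move=> K1; split; [exact: sgnvec_real|exact: Ku].
  by exists U => _; split => //; rewrite -UE mulmxA HU mul1mx.
by have [U HU] := choice H; exists U.
Qed.

(** Lets the moments in [v] be read as moments in [u] of X^H. Conjugation negates imaginary parts,
    so the sets testing them are pulled back along negation. *)
Lemma biinvariant_conjT d (T : measurableType d) (P : probability T R) Kr p q
    (Y : T -> 'M[C]_(p, q)) :
  biinvariant P Kr Y -> biinvariant P Kr (fun w => conjT (Y w)).
Proof.
move=> invY U V HU HV HK A B mAB.
have flip (Z : T -> 'M[C]_(p, q)) :
    [set w | forall i j, A i j (complex.Re (conjT (Z w) i j)) /\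
                         B i j (complex.Im (conjT (Z w) i j))] =
    [set w | forall i j, A j i (complex.Re (Z w i j)) /\
                         (-%R @^-1` B j i) (complex.Im (Z w i j))].
  apply/seteqP; split => w /= Hw i j; have := Hw j i; rewrite conjTE;
  by case: (Z w _ _).
have -> : [set w | forall i j, A i j (complex.Re ((U *m conjT (Y w) *m V) i j)) /\
                         B i j (complex.Im ((U *m conjT (Y w) *m V) i j))] =
    [set w | forall i j,
       A i j (complex.Re (conjT (conjT V *m Y w *m conjT U) i j)) /\
       B i j (complex.Im (conjT (conjT V *m Y w *m conjT U) i j))].
  by apply/seteqP; split => w /= Hw i j; have := Hw i j; rewrite !conjT_mul !conjTK mulmxA.
rewrite (flip Y) (flip (fun w => conjT V *m Y w *m conjT U)).
apply: (invY (conjT V) (conjT U) _ _ _ (fun i j => A j i)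
  (fun i j => -%R @^-1` B j i)) => [||/HK[rU rV]|i j].
- exact: orthonormal_cols_conjT.
- exact: orthonormal_cols_conjT.
- by split; exact: real_mx_conjT.
- have [mA mB] := mAB j i; split => //.
  by rewrite -[X in measurable X]setTI; exact: oppr_measurable.
Qed.

Section FixedSize.
Variables (p q : nat) (Kr : bool) (d : measure_display) (T : measurableType d).
Variables (P : probability T R) (Y : T -> 'M[C]_(p, q)).
Variables (u : 'cV[C]_p) (v : 'cV[C]_q).
Hypothesis p0 : (0 < p)%N.
Hypotheses (mY : rand_mx Y) (invY : biinvariant P Kr Y).
Hypotheses (u1 : frob2 u = 1) (Ku : Kr -> real_mx u).

(** With A = (X X^H)^k, the bounded quantity is |A|_F^2 / p, which is both invariant under the
    rotations and what the fourth moment of the quadratic form in the signs requires. *)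
Lemma left_quadratic_tail k (e M : R) : 0 < e -> 0 <= M ->
  (P [set w | (e < `|complex.Re (ip u ((Y w *m conjT (Y w)) ^+ k *m u))
                    - complex.Re (\tr ((Y w *m conjT (Y w)) ^+ k)) / p%:R|)%R /\
     (complex.Re (\tr ((Y w *m conjT (Y w)) ^+ (2 * k))) / p%:R <= M)%R]
   <= ((18 * (M / p%:R)) ^+ 2 / e ^+ 4)%:E)%E.
Proof.
move=> e0 M0; have [U HU] := sign_rotation p0 u1 Ku.
have conjE s (X : 'M[C]_(p, q)) j : s \in signs p ->
    (U s *m X *m 1%:M *m conjT (U s *m X *m 1%:M)) ^+ j =
    U s *m (X *m conjT X) ^+ j *m conjT (U s).
  by move=> /HU[HUs _ _]; rewrite mulmx1 conjT_mul -(unitary_conj_exp _ _ HUs) !mulmxA.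
apply: (@invariant_markov _ _ T P Kr _ _ Y p U (fun=> 1%:M)
  (fun X => complex.Re (ip u ((X *m conjT X) ^+ k *m u))
                    - complex.Re (\tr ((X *m conjT X) ^+ k)) / p%:R)
  (fun X => complex.Re (\tr ((X *m conjT X) ^+ (2 * k))) / p%:R) M);
  [exact: mY|exact: invY| | | |exact: e0| |].
- move=> d' T' Y' mY'; apply: measurable_funB.
    have mA := rand_mxX k (rand_mxM mY' (rand_mx_conjT mY')).
    by have [] := rand_mx_ip u (rand_mxM mA (rand_mx_cst _ u)).
  apply: measurable_funM => //.
  exact: (rand_mx_Re_trace (rand_mxX k (rand_mxM mY' (rand_mx_conjT mY')))).
- move=> d' T' Y' mY'; apply: measurable_funM => //.
  exact: (rand_mx_Re_trace (rand_mxX (2 * k) (rand_mxM mY' (rand_mx_conjT mY')))).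
- move=> s sp; have [HUs KUs _] := HU s sp; split; first exact: HUs.
  + exact: orthonormal_cols1.
  + by move=> K1; split; [exact: KUs|exact: real_mx1].
  + by move=> X; rewrite (conjE _ _ _ sp) (unitary_conj_trace _ HUs).
- exact: sqr_ge0.
- move=> X gM.
  rewrite (@eq_avg _ p _ (fun s =>
    (complex.Re (ip (sgnvec p s) ((X *m conjT X) ^+ k *m sgnvec p s))
     - complex.Re (\tr ((X *m conjT X) ^+ k)) / p%:R) ^+ 4)); last first.
    move=> s sp; have [HUs _ Us] := HU s sp; rewrite (conjE _ _ _ sp) (unitary_conj_trace _ HUs).
    by rewrite -!mulmxA ip_adj Us.
  apply: (le_trans (sgnvec_quadratic_moment4 _ p0)).
  have pp : 0 < p%:R :> R by rewrite ltr0n.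
  apply: lerXn2r.
  - by rewrite nnegrE mulr_ge0// divr_ge0 ?frob2_ge0 ?sqr_ge0.
  - by rewrite nnegrE mulr_ge0// divr_ge0// ltW.
  apply: ler_wpM2l => //; rewrite frob2_herm_exp ?gram_conjT// expr2 invfM mulrA.
  by rewrite ler_wpM2r// invr_ge0 ltW.
Qed.

(** Only the left factor is rotated, so (X X^H)^k X v changes by a unitary and the pairing becomes
    linear in the signs. *)
Lemma cross_tail k (e M : R) (h : C -> R) : 0 < e -> 0 <= M ->
  h = @complex.Re R \/ h = @complex.Im R ->
  (P [set w | (e < `|h (ip u ((Y w *m conjT (Y w)) ^+ k *m (Y w *m v)))|)%R /\
     (frob2 ((Y w *m conjT (Y w)) ^+ k *m (Y w *m v)) <= M)%R]
   <= (3 * (M / p%:R) ^+ 2 / e ^+ 4)%:E)%E.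
Proof.
move=> e0 M0 hE; have [U HU] := sign_rotation p0 u1 Ku.
have conjE s (X : 'M[C]_(p, q)) : s \in signs p ->
    (U s *m X *m 1%:M *m conjT (U s *m X *m 1%:M)) ^+ k *m (U s *m X *m 1%:M *m v) =
    U s *m ((X *m conjT X) ^+ k *m (X *m v)).
  move=> /HU[HUs _ _]; rewrite mulmx1 conjT_mul.
  have -> : U s *m X *m (conjT X *m conjT (U s)) = U s *m (X *m conjT X) *m conjT (U s).
    by rewrite !mulmxA.
  rewrite unitary_conj_exp// -!mulmxA; congr (_ *m (_ *m _)).
  by rewrite mulmxA HUs mul1mx.
apply: (@invariant_markov _ _ T P Kr _ _ Y p U (fun=> 1%:M)
  (fun X => h (ip u ((X *m conjT X) ^+ k *m (X *m v))))
  (fun X => frob2 ((X *m conjT X) ^+ k *m (X *m v))) M);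
  [exact: mY|exact: invY| | | |exact: e0| |].
- move=> d' T' Y' mY'.
  have mA := rand_mxX k (rand_mxM mY' (rand_mx_conjT mY')).
  have [] := rand_mx_ip u (rand_mxM mA (rand_mxM mY' (rand_mx_cst _ v))).
  by case: hE => ->.
- move=> d' T' Y' mY'.
  have mA := rand_mxX k (rand_mxM mY' (rand_mx_conjT mY')).
  exact: (rand_mx_frob2 (rand_mxM mA (rand_mxM mY' (rand_mx_cst _ v)))).
- move=> s sp; have [HUs KUs _] := HU s sp; split; first exact: HUs.
  + exact: orthonormal_cols1.
  + by move=> K1; split; [exact: KUs|exact: real_mx1].
  + by move=> X; rewrite (conjE _ _ sp) (frob2_isometry _ HUs).
- by rewrite mulr_ge0// sqr_ge0.
- move=> X gM.
  rewrite (@eq_avg _ p _ (fun s =>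
    h (ip (sgnvec p s) ((X *m conjT X) ^+ k *m (X *m v))) ^+ 4)); last first.
    by move=> s sp; have [HUs _ Us] := HU s sp; rewrite (conjE _ _ sp) ip_adj Us.
  have pp : 0 < p%:R :> R by rewrite ltr0n.
  apply: (@le_trans _ _ (3 * (frob2 ((X *m conjT X) ^+ k *m (X *m v)) / p%:R) ^+ 2)).
    by case: hE => ->; [exact: sgnvec_Re_moment4|exact: sgnvec_Im_moment4].
  apply: ler_wpM2l => //.
  apply: lerXn2r; rewrite ?nnegrE ?divr_ge0 ?frob2_ge0 ?sqr_ge0//.
  by rewrite ler_wpM2r// invr_ge0 ltW.
Qed.

End FixedSize.

End AlmostSureMoments.

(** * Almost sure limits of the quadratic and cross moments *)

Section MomentLimits.
Context {R : realType}.
Local Notation C := R[i].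
Local Notation "x %:CC" := (real_complex R x) (at level 2, format "x %:CC").

(** The exponent is positive because at 0 the two traces are [q] and [p]. *)
Lemma trace_gram_swap p q (Y : 'M[C]_(p, q)) k :
  \tr ((conjT Y *m Y) ^+ k.+1) = \tr ((Y *m conjT Y) ^+ k.+1).
Proof.
have H j : (conjT Y *m Y) ^+ j.+1 = conjT Y *m (Y *m conjT Y) ^+ j *m Y.
  elim: j => [|j IH]; first by rewrite expr1 expr0 mulmx1.
  by rewrite exprS IH [in RHS]exprS -!mulmxE !mulmxA.
by rewrite H -mulmxA mxtrace_mulC -mulmxA -[Y *m conjT Y in LHS]expr1 mulmxE -exprD addn1.
Qed.

Lemma Re_real (x : R) : complex.Re x%:CC = x.
Proof. by []. Qed.

Section SvdBounds.
Variables (Kr : bool) (p q : nat) (M : 'M[C]_(p.+1, q)) (s : 'I_p.+1 -> R).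
Variables (U : 'M[C]_p.+1) (V : 'M[C]_(q, p.+1)).
Hypothesis svd : is_svd Kr M s U V.

Lemma trace_gram_le k :
  complex.Re (\tr ((M *m conjT M) ^+ k)) <= p.+1%:R * s ord0 ^+ (2 * k).
Proof.
rewrite (svd_trace svd) Re_real mulr_natl -[in leRHS](card_ord p.+1) -sumr_const.
apply: ler_sum => i _; rewrite !exprM; apply: lerXn2r; rewrite ?nnegrE ?sqr_ge0//.
exact: (svd_le0 svd).
Qed.

Lemma trace_gram_adj_le k : (p.+1 <= q)%N ->
  complex.Re (\tr ((conjT M *m M) ^+ k)) <= q%:R * s ord0 ^+ (2 * k).
Proof.
move=> pq; case: k => [|k].
  by rewrite muln0 !expr0 mxtrace1 mulr1 -(rmorph_nat (real_complex R)) Re_real.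
rewrite trace_gram_swap (le_trans (trace_gram_le _))//.
by rewrite ler_wpM2r ?ler_nat// exprM exprn_ge0// sqr_ge0.
Qed.

Lemma frob2_gram_exp_le k (v : 'cV[C]_q) :
  frob2 ((M *m conjT M) ^+ k *m (M *m v)) <=
  ((s ord0 ^+ 2) ^+ k) ^+ 2 * (s ord0 ^+ 2 * frob2 v).
Proof.
have HA (y : 'cV[C]_p.+1) : frob2 (M *m conjT M *m y) <= (s ord0 ^+ 2) ^+ 2 * frob2 y.
  rewrite -mulmxA; apply: (le_trans (svd_op_norm svd _)).
  have -> : (s ord0 ^+ 2) ^+ 2 * frob2 y = s ord0 ^+ 2 * (s ord0 ^+ 2 * frob2 y).
    by rewrite mulrA -expr2.
  by apply: ler_wpM2l; [exact: sqr_ge0|exact: (svd_op_norm_adj svd)].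
apply: (le_trans (frob2_exp k _ HA)).
by apply: ler_wpM2l; [exact: sqr_ge0|exact: (svd_op_norm svd)].
Qed.

End SvdBounds.

Lemma bounded_of_cvg (f g : nat -> R) (h : R -> R) (L : R) :
  (forall n, f n <= h (g n)) -> g n @[n --> \oo] --> L -> {for L, continuous h} ->
  exists M : R, \forall n \near \oo, f n <= M.
Proof.
move=> fh gL hL; exists (h L + 1).
have hg : h (g n) @[n --> \oo] --> h L by exact: cvg_comp gL hL.
have : \forall n \near \oo, h (g n) <= h L + 1.
  by apply: (cvgr_le _ hg); rewrite ltrDl.
by apply: filterS => n; exact: le_trans.
Qed.

(** The null set does not depend on [k]. Convergence of the top singular value serves only to bound
    the traces and norms along the sample, as [ae_cvg0] demands. *)
Lemma ae_moments (Kr : bool) (d : measure_display) (T : measurableType d)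
    (P : probability T R) (m : nat -> nat)
    (X : forall n : nat, T -> 'M[C]_(n.+1, m n))
    (u : forall n : nat, 'cV[C]_(n.+1)) (v : forall n : nat, 'cV[C]_(m n)) :
  (forall n, (n.+1 <= m n)%N) ->
  (forall n, rand_mx (X n)) ->
  (forall n, biinvariant P Kr (X n)) ->
  (forall n, frob2 (u n) = 1) -> (forall n, frob2 (v n) = 1) ->
  (Kr -> forall n, real_mx (u n) /\ real_mx (v n)) ->
  {ae P, forall w, (exists L : R, svals (X n w) ord0 @[n --> \oo] --> L) -> forall k,
   [/\ complex.Re (ip (u n) ((X n w *m conjT (X n w)) ^+ k *m u n))
       - complex.Re (\tr ((X n w *m conjT (X n w)) ^+ k)) / n.+1%:R @[n --> \oo] --> (0 : R),
      complex.Re (ip (v n) ((conjT (X n w) *m X n w) ^+ k *m v n))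
       - complex.Re (\tr ((conjT (X n w) *m X n w) ^+ k)) / (m n)%:R @[n --> \oo] --> (0 : R),
      complex.Re (ip (u n) ((X n w *m conjT (X n w)) ^+ k *m (X n w *m v n)))
        @[n --> \oo] --> (0 : R) &
      complex.Im (ip (u n) ((X n w *m conjT (X n w)) ^+ k *m (X n w *m v n)))
        @[n --> \oo] --> (0 : R)]}.
Proof.
move=> nm mX invX u1 v1 Kuv.
have m0 n : (0 < m n)%N by exact: leq_trans (nm n).
have Ku n : Kr -> real_mx (u n) by move=> /Kuv/(_ n)[].
have Kv n : Kr -> real_mx (v n) by move=> /Kuv/(_ n)[].
have mXX n := rand_mxM (mX n) (rand_mx_conjT (mX n)).
have mXX' n := rand_mxM (rand_mx_conjT (mX n)) (mX n).
have svdX n w : exists U V, is_svd false (X n w) (svals (X n w)) U V.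
  exact: svals_svd (nm n).
have HA k : {ae P, forall w, (exists M : R, \forall n \near \oo,
      complex.Re (\tr ((X n w *m conjT (X n w)) ^+ (2 * k))) / n.+1%:R <= M) ->
    complex.Re (ip (u n) ((X n w *m conjT (X n w)) ^+ k *m u n))
       - complex.Re (\tr ((X n w *m conjT (X n w)) ^+ k)) / n.+1%:R @[n --> \oo] --> (0 : R)}.
  apply: ae_cvg0.
  - move=> n; apply: measurable_funB.
      by have [] := rand_mx_ip (u n) (rand_mxM (rand_mxX k (mXX n)) (rand_mx_cst _ (u n))).
    by apply: measurable_funM => //; exact: (rand_mx_Re_trace (rand_mxX k (mXX n))).
  - move=> n; apply: measurable_funM => //.
    exact: (rand_mx_Re_trace (rand_mxX (2 * k) (mXX n))).
  - move=> e e0 M; exists ((18 * M%:R) ^+ 2 / e ^+ 4) => n.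
    apply: le_trans (left_quadratic_tail (ltn0Sn n) (mX n) (invX n) (u1 n) (Ku n) k e0 (ler0n _ M)) _.
    by rewrite lee_fin le_eqVlt mulrA !expr_div_n mulrAC eqxx.
have HB k : {ae P, forall w, (exists M : R, \forall n \near \oo,
      complex.Re (\tr ((conjT (X n w) *m X n w) ^+ (2 * k))) / (m n)%:R <= M) ->
    complex.Re (ip (v n) ((conjT (X n w) *m X n w) ^+ k *m v n))
       - complex.Re (\tr ((conjT (X n w) *m X n w) ^+ k)) / (m n)%:R @[n --> \oo] --> (0 : R)}.
  apply: ae_cvg0.
  - move=> n; apply: measurable_funB.
      by have [] := rand_mx_ip (v n) (rand_mxM (rand_mxX k (mXX' n)) (rand_mx_cst _ (v n))).
    by apply: measurable_funM => //; exact: (rand_mx_Re_trace (rand_mxX k (mXX' n))).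
  - move=> n; apply: measurable_funM => //.
    exact: (rand_mx_Re_trace (rand_mxX (2 * k) (mXX' n))).
  - move=> e e0 M; exists ((18 * M%:R) ^+ 2 / e ^+ 4) => n.
    (* The right moments are the left moments of X^H; the tail is then of order 1/m^2, at most
       1/(n+1)^2 since [n.+1 <= m n]. *)
    rewrite (_ : [set w | _] = [set w |
      (e < `|complex.Re (ip (v n) ((conjT (X n w) *m conjT (conjT (X n w))) ^+ k *m v n))
             - complex.Re (\tr ((conjT (X n w) *m conjT (conjT (X n w))) ^+ k)) / (m n)%:R|)%R /\
      (complex.Re (\tr ((conjT (X n w) *m conjT (conjT (X n w))) ^+ (2 * k)))
         / (m n)%:R <= M%:R)%R]); last by apply/seteqP; split => w /=; rewrite conjTK.
    apply: le_trans (left_quadratic_tail (m0 n) (rand_mx_conjT (mX n))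
      (biinvariant_conjT (invX n)) (v1 n) (Kv n) k e0 (ler0n _ M)) _.
    rewrite lee_fin mulrA expr_div_n mulrAC.
    have ni (j : nat) : 0 <= j%:R :> R by exact: ler0n.
    apply: ler_wpM2l.
      by rewrite divr_ge0 ?sqr_ge0// exprn_ge0// ltW.
    rewrite lef_pV2 ?posrE ?exprn_gt0 ?ltr0n//.
    by apply: lerXn2r; rewrite ?nnegrE ?ni ?ler_nat.
have HC (h : C -> R) k : h = @complex.Re R \/ h = @complex.Im R ->
   {ae P, forall w, (exists M : R, \forall n \near \oo,
      frob2 ((X n w *m conjT (X n w)) ^+ k *m (X n w *m v n)) <= M) ->
    h (ip (u n) ((X n w *m conjT (X n w)) ^+ k *m (X n w *m v n))) @[n --> \oo] --> (0 : R)}.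
  move=> hE; apply: ae_cvg0.
  - move=> n.
    have [] := rand_mx_ip (u n) (rand_mxM (rand_mxX k (mXX n)) (rand_mxM (mX n) (rand_mx_cst _ (v n)))).
    by case: hE => ->.
  - move=> n; exact: (rand_mx_frob2 (rand_mxM (rand_mxX k (mXX n)) (rand_mxM (mX n) (rand_mx_cst _ (v n))))).
  - move=> e e0 M; exists (3 * M%:R ^+ 2 / e ^+ 4) => n.
    apply: le_trans (cross_tail (v n) (ltn0Sn n) (mX n) (invX n) (u1 n) (Ku n) k e0 (ler0n _ M) hE) _.
    by rewrite lee_fin le_eqVlt expr_div_n mulrA mulrAC eqxx.
have HCR k := HC _ k (or_introl erefl); have HCI k := HC _ k (or_intror erefl).
apply: filterS2 (filterI (ae_foralln HA) (ae_foralln HB))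
  (filterI (ae_foralln HCR) (ae_foralln HCI)) => w [HA' HB'] [HR' HI'] [L sL] k.
have cX (a : R) j : {for a, continuous (fun x : R => x ^+ j)} by exact: exprn_continuous.
have bA : exists M : R, \forall n \near \oo,
    complex.Re (\tr ((X n w *m conjT (X n w)) ^+ (2 * k))) / n.+1%:R <= M.
  apply: (bounded_of_cvg (h := fun x => x ^+ (2 * (2 * k))) _ sL (cX _ _)) => n.
  have [U [V svd]] := svdX n w.
  by rewrite ler_pdivrMr ?ltr0n// mulrC; exact: (trace_gram_le svd).
have bB : exists M : R, \forall n \near \oo,
    complex.Re (\tr ((conjT (X n w) *m X n w) ^+ (2 * k))) / (m n)%:R <= M.
  apply: (bounded_of_cvg (h := fun x => x ^+ (2 * (2 * k))) _ sL (cX _ _)) => n.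
  have [U [V svd]] := svdX n w.
  by rewrite ler_pdivrMr ?ltr0n// mulrC; exact: (trace_gram_adj_le svd _ (nm n)).
have bC : exists M : R, \forall n \near \oo,
    frob2 ((X n w *m conjT (X n w)) ^+ k *m (X n w *m v n)) <= M.
  apply: (bounded_of_cvg (h := fun x => x ^+ (2 * k * 2 + 2)) _ sL (cX _ _)) => n.
  have [U [V svd]] := svdX n w.
  apply: (le_trans (frob2_gram_exp_le svd k (v n))).
  by rewrite v1 mulr1 /= exprD !exprM lexx.
by split; [exact: HA' bA|exact: HB' bB|exact: HR' bC|exact: HI' bC].
Qed.

End MomentLimits.

(** * The limiting spectral measure *)

Section SpectralMeasure.
Context {R : realType}.

Lemma measurable_funV : measurable_fun [set: R] (fun x : R => x^-1).
Proof.
have -> : [set: R] = [set 0] `|` [set x | x != 0].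
  by apply/seteqP; split => // x _; have [->|] := eqVneq x 0; [left|right].
have oN0 : open [set x : R | x != 0].
  rewrite (_ : [set x | x != 0] = ~` [set 0]); last first.
    by apply/seteqP; split => x /= /eqP.
  by apply: closed_openC; exact: closed_eq.
apply/measurable_funU => //; first exact: open_measurable.
split; first exact: measurable_fun_set1.
apply: open_continuous_measurable_fun => // x; rewrite inE /=.
exact: inv_continuous.
Qed.

Lemma is_derive_kernel (x y : R) : x ^+ 2 - y ^+ 2 != 0 ->
  is_derive x 1 (fun x : R => x / (x ^+ 2 - y ^+ 2))
    (- ((x ^+ 2 + y ^+ 2) / (x ^+ 2 - y ^+ 2) ^+ 2)).
Proof.
move=> h.
have h1 : is_derive x 1 (fun x : R => x ^+ 2 - y ^+ 2) (2 * x).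
  by apply: is_derive_eq; rewrite /GRing.scale /=; ring.
have h2 := @is_deriveV _ (fun x : R => x ^+ 2 - y ^+ 2) _ _ _ h h1.
have h3 := is_deriveM (is_derive_id x 1) h2.
apply: (is_derive_eq h3); rewrite /GRing.scale /=; by field.
Qed.

Variables (mu : probability R R) (b : R).
Hypothesis b0 : 0 <= b.
Let D : set R := [set` `[0, b]].
Hypothesis muD : mu D = 1%E.

Let mD : measurable D. Proof. exact: measurable_itv. Qed.

Lemma Rintegral_support (f : R -> R) : measurable_fun setT f ->
  Rintegral mu setT f = Rintegral mu D f.
Proof.
move=> mf; rewrite [RHS]Rintegral_mkcond /Rintegral; congr fine.
have muN : mu (~` D) = 0%E.
  by rewrite probability_setC// muD subee.
apply: ae_eq_integral => //.
- exact/measurable_EFinP.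
- apply/measurable_EFinP; apply/(measurable_restrictT _ mD).
  exact: measurable_funS mf.
- exists (~` D); split => //; first exact: measurableC.
  move=> x /= H Dx; apply: H => _; congr EFin.
  by rewrite patchE mem_set.
Qed.

Lemma integrable_on_support (f : R -> R) (M : R) : measurable_fun setT f ->
  (forall t, D t -> `|f t| <= M) -> mu.-integrable D (EFin \o f).
Proof.
move=> mf fM; apply: measurable_bounded_integrable => //.
- by rewrite -[X in (X < _)%E]/(mu D) muD ltry.
- exact: measurable_funS mf.
- exists M; split; first exact: num_real.
  by move=> x Mx t Dt; apply: (le_trans (fM t Dt)); exact: ltW.
Qed.

Lemma measurable_kernel (z : R) :
  measurable_fun setT (fun t : R => z / (z ^+ 2 - t ^+ 2)).
Proof.
apply: measurable_funM => //; apply: (measurableT_comp measurable_funV).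
by apply: measurable_funB => //; exact: measurable_funX.
Qed.

Lemma kernel_den (z t : R) : b < z -> D t -> 0 < z ^+ 2 - b ^+ 2 <= z ^+ 2 - t ^+ 2.
Proof.
rewrite /D /= in_itv /= => bz /andP[t0 tb].
have z0 : 0 < z by exact: le_lt_trans bz.
apply/andP; split.
  by rewrite subr_gt0 ltrXn2r ?nnegrE// ltW.
by rewrite lerD2l lerN2 lerXn2r ?nnegrE.
Qed.

Lemma kernel_bounds (z t : R) : b < z -> D t ->
  z^-1 <= z / (z ^+ 2 - t ^+ 2) <= z / (z ^+ 2 - b ^+ 2).
Proof.
move=> bz Dt; have /andP[d0 d1] := kernel_den bz Dt.
have d2 : 0 < z ^+ 2 - t ^+ 2 by exact: lt_le_trans d1.
have z0 : 0 < z by exact: le_lt_trans bz.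
apply/andP; split; last by rewrite ler_pM2l// lef_pV2 ?posrE.
rewrite ler_pdivlMr// mulrBr expr2 mulrA mulVf ?gt_eqF// mul1r.
by rewrite gerBl mulr_ge0 ?sqr_ge0// invr_ge0 ltW.
Qed.

Lemma phi_mu_support (z : R) :
  phi_mu mu z = Rintegral mu D (fun t => z / (z ^+ 2 - t ^+ 2)).
Proof. by apply: Rintegral_support; exact: measurable_kernel. Qed.

Lemma kernel_integrable (z : R) : b < z ->
  mu.-integrable D (EFin \o (fun t : R => z / (z ^+ 2 - t ^+ 2))).
Proof.
move=> bz; have z0 : 0 < z by exact: le_lt_trans bz.
apply: (@integrable_on_support _ (z / (z ^+ 2 - b ^+ 2))) => [|t Dt].
  exact: measurable_kernel.
have /andP[k1 k2] := kernel_bounds bz Dt; rewrite ger0_norm//.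
by apply: le_trans k1; rewrite invr_ge0 ltW.
Qed.

Lemma cst_integrable (r : R) : mu.-integrable D (EFin \o (fun=> r)).
Proof. by apply: (@integrable_on_support _ `|r|). Qed.

Lemma Rintegral_cst_support (r : R) : Rintegral mu D (fun=> r) = r.
Proof. by rewrite Rintegral_cst// [X in fine X](_ : _ = 1%E)// mulr1. Qed.

Lemma phi_mu_bounds (z : R) : b < z ->
  z^-1 <= phi_mu mu z <= z / (z ^+ 2 - b ^+ 2).
Proof.
move=> bz; rewrite phi_mu_support.
rewrite -[z^-1 in X in X && _]Rintegral_cst_support.
rewrite -[z / (z ^+ 2 - b ^+ 2)]Rintegral_cst_support.
apply/andP; split; apply: le_Rintegral => //; try exact: cst_integrable;
  try exact: kernel_integrable.
- by move=> t Dt; have /andP[] := kernel_bounds bz Dt.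
- by move=> t Dt; have /andP[] := kernel_bounds bz Dt.
Qed.

(** Differentiation under the integral on an interval ]u, v[ around [z] with u > b. The kernel has
    derivative -(z^2 + t^2)/(z^2 - t^2)^2, which is at most -1/z^2. *)
Lemma phi_mu_derive (z : R) : b < z ->
  derivable (phi_mu mu) z 1 /\ derive1 (phi_mu mu) z <= - (z ^+ 2)^-1.
Proof.
move=> bz; have z0 : 0 < z by exact: le_lt_trans bz.
pose u := (b + z) / 2; pose v := z + 1.
have bu : b < u by rewrite /u; lra.
have u0 : 0 < u by exact: le_lt_trans bu.
have uz : u < z by rewrite /u; lra.
pose f (z t : R) := z / (z ^+ 2 - t ^+ 2).
have phiE : phi_mu mu = (fun z => Rintegral mu D (f z)).
  by apply/funext => x; exact: phi_mu_support.
(* A constant domination: the numerator is largest at x = v and t = b, the denominator smallest at x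
   = u and t = b. *)
pose G (t : R) := (v ^+ 2 + b ^+ 2) / (u ^+ 2 - b ^+ 2) ^+ 2.
have Iz : `]u, v[%classic z by rewrite /= in_itv /= uz /v ltrDl ltr01.
have Ib x : `]u, v[%classic x -> b < x /\ (u < x /\ x < v).
  by rewrite /= in_itv /= => /andP[ux xv]; split => //; exact: lt_trans ux.
have intf x : `]u, v[%classic x -> mu.-integrable D (EFin \o f x).
  by move=> /Ib[bx _]; exact: kernel_integrable.
have dfE x t : `]u, v[%classic x -> D t ->
    is_derive x 1 (f ^~ t) (- ((x ^+ 2 + t ^+ 2) / (x ^+ 2 - t ^+ 2) ^+ 2)).
  move=> /Ib[bx _] Dt; apply: is_derive_kernel.
  by have /andP[d0 d1] := kernel_den bx Dt; rewrite gt_eqF// (lt_le_trans d0).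
have df x t : `]u, v[%classic x -> D t -> derivable (f ^~ t) x 1.
  by move=> Ix Dt; have [] := dfE x t Ix Dt.
have pdE x t : `]u, v[%classic x -> D t ->
    partial1of2 f x t = - ((x ^+ 2 + t ^+ 2) / (x ^+ 2 - t ^+ 2) ^+ 2).
  by move=> Ix Dt; rewrite partial1of2E; have [_ ->] := dfE x t Ix Dt.
have G0 t : 0 <= G t by rewrite divr_ge0 ?sqr_ge0// addr_ge0 ?sqr_ge0.
have intG : mu.-integrable D (EFin \o G) by exact: cst_integrable.
have pdG x t : `]u, v[%classic x -> D t -> `|partial1of2 f x t| <= G t.
  move=> Ix Dt; rewrite pdE// normrN; have [bx [ux xv]] := Ib x Ix.
  have := Dt; rewrite /D /= in_itv /= => /andP[t0 tb].
  have x0 : 0 < x by exact: lt_trans ux.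
  have /andP[d0 d1] := kernel_den bx Dt.
  have d0u : 0 < u ^+ 2 - b ^+ 2 by rewrite subr_gt0 ltrXn2r ?nnegrE// ltW.
  have d2 : u ^+ 2 - b ^+ 2 <= x ^+ 2 - t ^+ 2.
    apply: le_trans d1; rewrite lerD2r; apply: lerXn2r; rewrite ?nnegrE ltW//.
  have d3 : 0 < x ^+ 2 - t ^+ 2 by exact: lt_le_trans d2.
  rewrite ger0_norm; last by rewrite divr_ge0 ?sqr_ge0// addr_ge0 ?sqr_ge0.
  apply: ler_pM.
  - by rewrite addr_ge0 ?sqr_ge0.
  - by rewrite invr_ge0 sqr_ge0.
  - apply: lerD; apply: lerXn2r; rewrite ?nnegrE//; try exact: ltW.
    by apply: ltW; exact: lt_trans xv.
  - rewrite lef_pV2 ?posrE ?exprn_gt0//.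
    by apply: lerXn2r; rewrite ?nnegrE ?(ltW d0u) ?(ltW d3) ?d2.
split.
  by rewrite phiE; exact: (derivable_under_integral mD Iz intf df G0 intG pdG).
rewrite phiE (differentiation_under_integral mD Iz intf df G0 intG pdG).
rewrite -[- (z ^+ 2)^-1]Rintegral_cst_support.
rewrite (@eq_Rintegral _ _ _ mu D
   (fun t => - ((z ^+ 2 + t ^+ 2) / (z ^+ 2 - t ^+ 2) ^+ 2)) (partial1of2 f z)); last first.
  move=> t; rewrite inE => Dt; exact: pdE.
apply: le_Rintegral => //; last 2 first.
- exact: cst_integrable.
- move=> t Dt; rewrite lerN2.
  have /andP[d0 d1] := kernel_den bz Dt.
  have d2 : 0 < z ^+ 2 - t ^+ 2 by exact: lt_le_trans d1.
  rewrite ler_pdivlMr ?exprn_gt0//.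
  have zz : 0 < z ^+ 2 by rewrite exprn_gt0.
  rewrite mulrC ler_pdivrMr//.
  by have := sqr_ge0 t; move: (z ^+ 2) (t ^+ 2) zz d2 => x y *; nra.
- apply: (@integrable_on_support _ (G z)).
  + apply: measurableT_comp => //; apply: measurable_funM.
      by apply: measurable_funD => //; exact: measurable_funX.
    apply: (measurableT_comp measurable_funV); apply: measurable_funX.
    by apply: measurable_funB => //; exact: measurable_funX.
  + by move=> t Dt; have := pdG z t Iz Dt; rewrite pdE.
Qed.

(** The limit of tr (X X^H)^l / n, which only sees even powers of the singular values. *)
Definition moment (l : nat) : R := Rintegral mu D (fun t => t ^+ (2 * l)).

Lemma power_integrable l : mu.-integrable D (EFin \o (fun t : R => t ^+ l)).
Proof.
apply: (@integrable_on_support _ (b ^+ l)); first exact: measurable_funX.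
move=> t; rewrite /D /= in_itv /= => /andP[t0 tb].
by rewrite ger0_norm ?exprn_ge0// lerXn2r// nnegrE.
Qed.

Lemma moment_ge0 l : 0 <= moment l.
Proof.
apply: Rintegral_ge0 => t; rewrite /D /= in_itv /= => /andP[t0 tb].
by rewrite exprn_ge0.
Qed.

Lemma moment0 : moment 0 = 1.
Proof.
rewrite /moment (@eq_Rintegral _ _ _ mu D (fun=> 1)) ?Rintegral_cst_support//.
Qed.

Lemma integrable_scale (r : R) (f : R -> R) :
  mu.-integrable D (EFin \o f) -> mu.-integrable D (EFin \o (fun t => r * f t)).
Proof.
by move=> intf; rewrite /comp; under eq_fun do rewrite EFinM; exact: integrableZl.
Qed.

(** The Laurent expansion of [phi_mu] at infinity, cut after [L] terms. *)
Definition phi_trunc (L : nat) (z : R) := \sum_(l < L) z ^- (2 * l).+1 * moment l.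

Lemma phi_truncE L z :
  phi_trunc L z = Rintegral mu D (fun t => \sum_(l < L) z ^- (2 * l).+1 * t ^+ (2 * l))
  /\ mu.-integrable D (EFin \o (fun t => \sum_(l < L) z ^- (2 * l).+1 * t ^+ (2 * l))).
Proof.
elim: L => [|L [IH IHint]].
  rewrite /phi_trunc big_ord0; split.
    by rewrite (@eq_Rintegral _ _ _ mu D (fun=> 0)) ?Rintegral_cst_support// => t _; rewrite big_ord0.
  rewrite (_ : _ \o _ = EFin \o (fun=> 0)); first exact: cst_integrable.
  by apply/funext => t /=; rewrite big_ord0.
have intL : mu.-integrable D (EFin \o (fun t : R => z ^- (2 * L).+1 * t ^+ (2 * L))).
  exact: (integrable_scale _ (power_integrable _)).
have E : (fun t => \sum_(l < L.+1) z ^- (2 * l).+1 * t ^+ (2 * l)) =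
   (fun t => \sum_(l < L) z ^- (2 * l).+1 * t ^+ (2 * l) + z ^- (2 * L).+1 * t ^+ (2 * L)).
  by apply/funext => t; rewrite big_ord_recr.
rewrite E; split.
  rewrite RintegralD// RintegralZl//; last exact: power_integrable.
  by rewrite -IH /phi_trunc big_ord_recr.
by rewrite /comp; under eq_fun do rewrite EFinD; exact: integrableD.
Qed.

Lemma geometric_kernel L (z t : R) : z != 0 -> z ^+ 2 - t ^+ 2 != 0 ->
  \sum_(l < L) z ^- (2 * l).+1 * t ^+ (2 * l) =
  z / (z ^+ 2 - t ^+ 2) * (1 - (t / z) ^+ (2 * L)).
Proof.
move=> z0 d0; elim: L => [|L IH]; first by rewrite big_ord0 muln0 expr0 subrr mulr0.
rewrite big_ord_recr /= IH mulnS; move: (2 * L)%N => e.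
rewrite (exprS z e) (exprD (t / z) 2 e) !expr_div_n.
move: (z ^+ e) (t ^+ e) (expf_neq0 e z0) => x y x0.
by field; rewrite z0 x0.
Qed.

(** The geometric sum multiplies the kernel by 1 - (t/z)^(2L), which lies between 1 - (b/z)^(2L) and
    1 on the support. *)
Lemma phi_trunc_bounds L (z : R) : b < z ->
  phi_mu mu z * (1 - (b / z) ^+ (2 * L)) <= phi_trunc L z <= phi_mu mu z.
Proof.
move=> bz; have z0 : 0 < z by exact: le_lt_trans bz.
have [-> int] := phi_truncE L z.
have geo t : D t -> \sum_(l < L) z ^- (2 * l).+1 * t ^+ (2 * l) =
    z / (z ^+ 2 - t ^+ 2) * (1 - (t / z) ^+ (2 * L)).
  move=> Dt; apply: geometric_kernel; first by rewrite gt_eqF.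
  by have /andP[d0 d1] := kernel_den bz Dt; rewrite gt_eqF// (lt_le_trans d0).
have k0 t : D t -> 0 <= z / (z ^+ 2 - t ^+ 2).
  move=> Dt; have /andP[k1 _] := kernel_bounds bz Dt.
  by apply: le_trans k1; rewrite invr_ge0 ltW.
have kint := kernel_integrable bz.
rewrite phi_mu_support mulrC -RintegralZl//; apply/andP; split.
- apply: le_Rintegral => //.
    exact: integrable_scale.
  move=> t Dt; rewrite geo// mulrC; apply: ler_wpM2l; first exact: k0.
  rewrite lerD2l lerN2; have := Dt; rewrite /D /= in_itv /= => /andP[t0 tb].
  apply: lerXn2r; rewrite ?nnegrE ?divr_ge0// ?(ltW z0)//.
  by rewrite ler_wpM2r// invr_ge0 ltW.
- apply: le_Rintegral => // t Dt; rewrite geo// -[leRHS]mulr1.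
  apply: ler_wpM2l; first exact: k0.
  by rewrite gerBl exprM exprn_ge0// sqr_ge0.
Qed.

End SpectralMeasure.

(** * The top singular value of a rank-one perturbation *)

Section Hermitization.
Context {R : realType}.
Local Notation C := R[i].
Local Notation "x %:CC" := (real_complex R x) (at level 2, format "x %:CC").

Definition herm p q (X : 'M[C]_(p, q)) : 'M[C]_(p + q) :=
  block_mx 0 X (conjT X) 0.

Lemma conjT_herm p q (X : 'M[C]_(p, q)) : conjT (herm X) = herm X.
Proof.
rewrite /conjT /herm tr_block_mx map_block_mx !trmx0 !map_mx0.
by rewrite -[map_mx _ (conjT X)^T]/(conjT (conjT X)) conjTK.
Qed.

Lemma herm_mul p q (X : 'M[C]_(p, q)) (x : 'cV[C]_p) (y : 'cV[C]_q) :
  herm X *m col_mx x y = col_mx (X *m y) (conjT X *m x).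
Proof. by rewrite mul_block_col !mul0mx addr0 add0r. Qed.

Lemma ip_col_mx p q (x x' : 'cV[C]_p) (y y' : 'cV[C]_q) :
  ip (col_mx x y) (col_mx x' y') = ip x x' + ip y y'.
Proof.
rewrite !ipE big_split_ord /=; congr (_ + _); apply: eq_bigr => i _.
  by rewrite !col_mxEu.
by rewrite !col_mxEd.
Qed.

Lemma frob2_col_mx p q (x : 'cV[C]_p) (y : 'cV[C]_q) :
  frob2 (col_mx x y) = frob2 x + frob2 y.
Proof. by rewrite -!Re_ipxx ip_col_mx ReD. Qed.

Lemma frob2_0 p : frob2 (0 : 'cV[C]_p) = 0.
Proof. by apply/eqP; rewrite frob2_eq0. Qed.

Lemma ip0l p (y : 'cV[C]_p) : ip 0 y = 0.
Proof. by rewrite ipC ip0r conjc0. Qed.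

Lemma gram_intertwine p q (X : 'M[C]_(p, q)) l :
  (X *m conjT X) ^+ l *m X = X *m (conjT X *m X) ^+ l.
Proof.
elim: l => [|l IH]; first by rewrite !expr0 mul1mx mulmx1.
by rewrite exprS [in RHS]exprS -!mulmxE -mulmxA IH !mulmxA.
Qed.

Lemma herm_exp_left p q (X : 'M[C]_(p, q)) (u : 'cV[C]_p) l :
  herm X ^+ (2 * l) *m col_mx u 0 = col_mx ((X *m conjT X) ^+ l *m u) 0 /\
  herm X ^+ (2 * l).+1 *m col_mx u 0 =
    col_mx 0 (conjT X *m ((X *m conjT X) ^+ l *m u)).
Proof.
have step j : herm X ^+ j.+1 *m col_mx u 0 = herm X *m (herm X ^+ j *m col_mx u 0).
  by rewrite exprS -mulmxE mulmxA.
have H : herm X ^+ (2 * l) *m col_mx u 0 = col_mx ((X *m conjT X) ^+ l *m u) 0.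
  elim: l => [|l IH]; first by rewrite muln0 !expr0 !mul1mx.
  rewrite mulnS !addSn add0n step step IH herm_mul mulmx0 herm_mul mulmx0.
  by rewrite [(_ *m _) ^+ l.+1]exprS -mulmxE !mulmxA.
by split=> //; rewrite step H herm_mul mulmx0.
Qed.

Lemma herm_exp_right p q (X : 'M[C]_(p, q)) (v : 'cV[C]_q) l :
  herm X ^+ (2 * l) *m col_mx 0 v = col_mx 0 ((conjT X *m X) ^+ l *m v) /\
  herm X ^+ (2 * l).+1 *m col_mx 0 v =
    col_mx ((X *m conjT X) ^+ l *m (X *m v)) 0.
Proof.
have step j : herm X ^+ j.+1 *m col_mx 0 v = herm X *m (herm X ^+ j *m col_mx 0 v).
  by rewrite exprS -mulmxE mulmxA.
have H : herm X ^+ (2 * l) *m col_mx 0 v = col_mx 0 ((conjT X *m X) ^+ l *m v).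
  elim: l => [|l IH]; first by rewrite muln0 !expr0 !mul1mx.
  rewrite mulnS !addSn add0n step step IH herm_mul mulmx0 herm_mul mulmx0.
  by rewrite [(_ *m _) ^+ l.+1]exprS -mulmxE !mulmxA.
split=> //; rewrite step H herm_mul mulmx0.
by rewrite [in RHS]mulmxA gram_intertwine -mulmxA.
Qed.

(* Interleaving: even Laurent coefficients [a], odd ones [g]. *)
Definition interleave (A : Type) (a g : nat -> A) (k : nat) : A :=
  if odd k then g k./2 else a k./2.

Lemma interleave_even (A : Type) (a g : nat -> A) l : interleave a g (2 * l) = a l.
Proof. by rewrite /interleave mul2n odd_double doubleK. Qed.

Lemma interleave_odd (A : Type) (a g : nat -> A) l : interleave a g (2 * l).+1 = g l.
Proof. by rewrite /interleave mul2n /= odd_double /= uphalf_double. Qed.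

Lemma nat_parity (Q : nat -> Prop) :
  (forall l, Q (2 * l)%N) -> (forall l, Q (2 * l).+1) -> forall k, Q k.
Proof.
move=> He Ho k; rewrite -(odd_double_half k) -mul2n.
by case: (odd k); [exact: Ho|exact: He].
Qed.

Lemma herm_moment_left p q (X : 'M[C]_(p, q)) (u : 'cV[C]_p) k :
  ip (col_mx u 0) (herm X ^+ k *m col_mx u 0) =
  interleave (fun l => ip u ((X *m conjT X) ^+ l *m u)) (fun=> 0) k.
Proof.
move: k; apply: nat_parity => l; have [E O] := herm_exp_left X u l.
  by rewrite interleave_even E ip_col_mx ip0r addr0.
by rewrite interleave_odd O ip_col_mx ip0r ip0l addr0.
Qed.

Lemma herm_moment_right p q (X : 'M[C]_(p, q)) (v : 'cV[C]_q) k :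
  ip (col_mx 0 v) (herm X ^+ k *m col_mx 0 v) =
  interleave (fun l => ip v ((conjT X *m X) ^+ l *m v)) (fun=> 0) k.
Proof.
move: k; apply: nat_parity => l; have [E O] := herm_exp_right X v l.
  by rewrite interleave_even E ip_col_mx ip0r add0r.
by rewrite interleave_odd O ip_col_mx ip0r ip0l addr0.
Qed.

Lemma herm_moment_cross p q (X : 'M[C]_(p, q)) (u : 'cV[C]_p) (v : 'cV[C]_q) k :
  ip (col_mx u 0) (herm X ^+ k *m col_mx 0 v) =
  interleave (fun=> 0) (fun l => ip u ((X *m conjT X) ^+ l *m (X *m v))) k.
Proof.
move: k; apply: nat_parity => l; have [E O] := herm_exp_right X v l.
  by rewrite interleave_even E ip_col_mx ip0r ip0l addr0.
by rewrite interleave_odd O ip_col_mx ip0l addr0.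
Qed.

Lemma herm_op_norm (p q : nat) (X : 'M[C]_(p.+1, q)) s U V B (y : 'cV[C]_(p.+1 + q)) :
  is_svd false X s U V -> s ord0 <= B ->
  frob2 (herm X *m y) <= B ^+ 2 * frob2 y.
Proof.
move=> svd sB; have s0 : 0 <= s ord0 by case: svd.
rewrite -[y]vsubmxK herm_mul !frob2_col_mx mulrDr addrC.
have sB2 : s ord0 ^+ 2 <= B ^+ 2 by apply: lerXn2r; rewrite ?nnegrE// (le_trans s0).
apply: lerD.
  apply: (le_trans (svd_op_norm_adj svd _)).
  by apply: ler_wpM2r; [exact: frob2_ge0|].
apply: (le_trans (svd_op_norm svd _)).
by apply: ler_wpM2r; [exact: frob2_ge0|].
Qed.

Lemma conjT_rank1_pert p q (X : 'M[C]_(p, q)) (u : 'cV[C]_p) (v : 'cV[C]_q) (tau : R) :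
  conjT (X + tau%:CC *: (u *m conjT v)) = conjT X + tau%:CC *: (v *m conjT u).
Proof. by rewrite conjTD conjTZ conjc_real conjT_rank1. Qed.

(** The rank-one change of X is a rank-two change of its dilation, in exactly the form assumed by
    [rank2_upper]. *)
Lemma herm_top_eigenvector (Kr : bool) (p q : nat) (X : 'M[C]_(p.+1, q)) s U V
    (u : 'cV[C]_p.+1) (v : 'cV[C]_q) (tau : R) :
  is_svd Kr (X + tau%:CC *: (u *m conjT v)) s U V ->
  let w := col_mx (col ord0 U) (col ord0 V) in
  [/\ w != 0 &
  herm X *m w + tau%:CC *: (ip (col_mx 0 v) w *: col_mx u 0
                          + ip (col_mx u 0) w *: col_mx 0 v) =
  (s ord0)%:CC *: w].
Proof.
move=> svd w; have [[HU HV] _ _ _ _] := svd; split.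
  rewrite -frob2_eq0 frob2_col_mx !frob2_col_orthonormal//.
rewrite /w herm_mul !ip_col_mx !ip0l addr0 add0r.
rewrite !(scale_col_mx, add_col_mx) !scaler0 !addr0 !add0r.
have := svd_top_right svd; have := svd_top_left svd.
rewrite conjT_rank1_pert !mulmxDl -!scalemxAl !rank1_mul => -> ->.
by [].
Qed.

(** Translates an upper bound on the top singular value into the quadratic form hypothesis of
    [rank2_lower]. *)
Lemma herm_form_le (Kr : bool) (p q : nat) (X : 'M[C]_(p.+1, q)) s U V
    (u : 'cV[C]_p.+1) (v : 'cV[C]_q) (tau z : R) (x : 'cV[C]_(p.+1 + q)) :
  is_svd Kr (X + tau%:CC *: (u *m conjT v)) s U V -> s ord0 <= z ->
  complex.Re (ip x (herm X *m x)) +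
    2 * tau * complex.Re ((ip (col_mx u 0) x)^*%C * ip (col_mx 0 v) x)
  <= z * frob2 x.
Proof.
move=> svd sz; rewrite -[x]vsubmxK; set x1 := usubmx x; set x2 := dsubmx x.
rewrite herm_mul !ip_col_mx !ip0l addr0 add0r frob2_col_mx ReD.
have -> : complex.Re (ip x2 (conjT X *m x1)) = complex.Re (ip x1 (X *m x2)).
  by rewrite ip_adj conjTK ipC; case: (ip x1 _).
have := svd_form_le svd x1 x2.
rewrite mulmxDl -scalemxAl rank1_mul ipDr !ipZr ReD ReZ [ip x1 u]ipC.
rewrite [ip v x2 * _]mulrC => H.
have H2 : s ord0 * (frob2 x1 + frob2 x2) <= z * (frob2 x1 + frob2 x2).
  by apply: ler_wpM2r => //; rewrite addr_ge0 ?frob2_ge0.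
by move: H H2; lra.
Qed.

(** The top singular vectors at [tau] are test vectors for the matrix at [tau'], whose form differs
    by a term linear in [tau' - tau]. No uniqueness of the vectors is involved. *)
Lemma top_sval_subgradient (Kr : bool) (p q : nat) (X : 'M[C]_(p.+1, q)) s U V s' U' V'
    (u : 'cV[C]_p.+1) (v : 'cV[C]_q) (tau tau' : R) :
  is_svd Kr (X + tau%:CC *: (u *m conjT v)) s U V ->
  is_svd false (X + tau'%:CC *: (u *m conjT v)) s' U' V' ->
  s ord0 + (tau' - tau) * complex.Re (ip (col ord0 U) u * ip v (col ord0 V)) <= s' ord0.
Proof.
move=> svd svd'; have [[HU HV] _ _ _ _] := svd.
have := svd_form_le svd' (col ord0 U) (col ord0 V).
rewrite !frob2_col_orthonormal//.
have -> : X + tau'%:CC *: (u *m conjT v) =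
   X + tau%:CC *: (u *m conjT v) + (tau' - tau)%:CC *: (u *m conjT v).
  by rewrite -addrA -scalerDl -rmorphD [tau + _]addrC subrK.
rewrite mulmxDl (svd_top_right svd) -scalemxAl rank1_mul ipDr !ipZr ReD !ReZ.
rewrite ipxx frob2_col_orthonormal// [ip v _ * _]mulrC /= mulr1 => H; lra.
Qed.

Lemma wsum_interleave (z : R) L (a g : nat -> R) :
  wsum z (2 * L) (interleave a g) =
  \sum_(l < L) z ^- (2 * l).+1 * a l + \sum_(l < L) z ^- (2 * l).+2 * g l.
Proof.
rewrite /wsum; elim: L => [|L IH]; first by rewrite muln0 !big_ord0 addr0.
rewrite [in LHS]mulnS !addSn add0n !big_ord_recr /= IH.
by rewrite interleave_even interleave_odd addrACA -!addrA.
Qed.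

Lemma cvg_wsum (z : R) K (h : nat -> nat -> R) (h0 : nat -> R) :
  (forall k, h n k @[n --> \oo] --> h0 k) ->
  wsum z K (h n) @[n --> \oo] --> wsum z K h0.
Proof.
move=> hh; rewrite /wsum; elim: K => [|K IH].
  under eq_cvg do rewrite big_ord0.
  by rewrite big_ord0; exact: cvg_cst.
under eq_cvg do rewrite big_ord_recr /=.
rewrite big_ord_recr /=; apply: cvgD => //.
by apply: cvgM => //; exact: cvg_cst.
Qed.

End Hermitization.

(** * Thresholds for the top singular value along one sample *)

Section EventualBounds.
Context {R : realType}.
Local Notation C := R[i].
Local Notation "x %:CC" := (real_complex R x) (at level 2, format "x %:CC").

Variables (mu : probability R R) (b c : R).
Hypothesis b0 : 0 <= b.
Hypothesis muD : mu [set` `[0, b]] = 1%E.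
Hypotheses (c0 : 0 <= c) (c1 : c <= 1).

Let phi := phi_mu mu.
Let psi z := c * phi z + (1 - c) / z.
Let phiL L z := phi_trunc mu b L z.

(* The limits of [tr (X^H X)^l / m]: the [m - n] extra zero eigenvalues only
   contribute for [l = 0]. *)
Definition comoment l := if l is 0 then 1 else c * moment mu b l.
Let psiL L z := \sum_(l < L) z ^- (2 * l).+1 * comoment l.

(** The term l = 0 splits as 1 = c + (1 - c), which produces the extra (1 - c)/z; [L.+1] ensures
    that this term is present. *)
Lemma psi_truncE L z : psiL L.+1 z = c * phiL L.+1 z + (1 - c) / z.
Proof.
rewrite /psiL /phiL /phi_trunc !big_ord_recl /= moment0// muln0 expr1.
rewrite mulrDr !mulr1 mulr_sumr.
rewrite (eq_bigr (fun l : 'I_L => c * (z ^- (2 * bump 0 l).+1 * moment mu b (bump 0 l)))).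
  by ring.
by move=> l _; rewrite mulrCA.
Qed.

Lemma comoment_ge0 l : 0 <= comoment l.
Proof. by case: l => [|l]//=; rewrite mulr_ge0// moment_ge0. Qed.

Lemma phi_mu_gt0 z : b < z -> 0 < phi z.
Proof.
move=> bz; have /andP[h _] := phi_mu_bounds b0 muD bz.
by apply: lt_le_trans h; rewrite invr_gt0; exact: le_lt_trans bz.
Qed.

Lemma psi_gt0 z : b < z -> 0 < psi z.
Proof.
move=> bz; have z0 : 0 < z by exact: le_lt_trans bz.
have p0 := phi_mu_gt0 bz; rewrite /psi.
have [->|cN0] := eqVneq c 0; first by rewrite mul0r add0r subr0 divr_gt0.
have cp : 0 < c by rewrite lt_neqAle eq_sym cN0.
by rewrite ltr_pwDl ?mulr_gt0// divr_ge0 ?subr_ge0// ltW.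
Qed.

Lemma trunc_product_bounds L z : b < z ->
  [/\ 0 <= phiL L.+1 z, 0 <= psiL L.+1 z,
      phiL L.+1 z * psiL L.+1 z <= phi z * psi z &
      phi z * psi z * (1 - (b / z) ^+ (2 * L.+1)) ^+ 2 <= phiL L.+1 z * psiL L.+1 z].
Proof.
move=> bz; have z0 : 0 < z by exact: le_lt_trans bz.
have p0 := phi_mu_gt0 bz; have q0 := psi_gt0 bz.
have /andP[h1 h2] := phi_trunc_bounds b0 muD L.+1 bz.
rewrite -/phi -/(phiL _ _) in h1 h2.
have r1 : 0 <= (b / z) ^+ (2 * L.+1) <= 1.
  have z0' := ltW z0; apply/andP; split; first by rewrite exprn_ge0// divr_ge0.
  by apply: exprn_ile1; [rewrite divr_ge0|rewrite ler_pdivrMr// mul1r ltW].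
move: r1 h1; set r := (b / z) ^+ _ => /andP[r0 r1] h1.
have e0 : 0 <= (1 - c) / z by rewrite divr_ge0 ?subr_ge0// ltW.
have h0 : 0 <= phiL L.+1 z by apply: le_trans h1; apply: mulr_ge0; rewrite ?subr_ge0// ltW.
have k2 : psiL L.+1 z <= psi z by rewrite psi_truncE /psi lerD2r ler_wpM2l.
have k1 : psi z * (1 - r) <= psiL L.+1 z.
  rewrite psi_truncE /psi mulrDl; apply: lerD; first by rewrite -mulrA ler_wpM2l.
  by rewrite mulrBr mulr1 gerBl mulr_ge0.
have k0 : 0 <= psiL L.+1 z by apply: le_trans k1; apply: mulr_ge0; rewrite ?subr_ge0// ltW.
split=> //; first exact: ler_pM.
rewrite expr2 mulrACA; by apply: ler_pM => //; apply: mulr_ge0; rewrite ?subr_ge0// ltW.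
Qed.

Lemma DtrE z : Dtr c mu z = phi z * psi z.
Proof. by []. Qed.

Lemma geometric_eventually (r e : R) : 0 <= r -> r < 1 -> 0 < e ->
  \forall L \near \oo, r ^+ (2 * L.+1) < e.
Proof.
move=> r0 r1 e0.
have H : r ^+ n @[n --> \oo] --> (0 : R) by apply: cvg_expr; rewrite ger0_norm.
have [N _ HN] := cvgr_lt _ H _ e0; exists N => // L /= NL; apply: HN => /=.
by rewrite (leq_trans NL)// mul2n -addnn (leq_trans (leqnSn L))// leq_addr.
Qed.

Variables (m : nat -> nat) (X : forall n : nat, 'M[C]_(n.+1, m n)).
Variables (sX : forall n : nat, 'I_n.+1 -> R) (UX : forall n : nat, 'M[C]_(n.+1)).
Variable VX : forall n : nat, 'M[C]_(m n, n.+1).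
Hypothesis svdX : forall n, is_svd false (X n) (@sX n) (UX n) (VX n).
Hypothesis sXb : @sX n ord0 @[n --> \oo] --> b.
Variables (u : forall n : nat, 'cV[C]_(n.+1)) (v : forall n : nat, 'cV[C]_(m n)).
Hypotheses (u1 : forall n, frob2 (u n) = 1) (v1 : forall n, frob2 (v n) = 1).
Hypothesis cvg_left : forall l,
  complex.Re (ip (u n) ((X n *m conjT (X n)) ^+ l *m u n)) @[n --> \oo] --> moment mu b l.
Hypothesis cvg_right : forall l,
  complex.Re (ip (v n) ((conjT (X n) *m X n) ^+ l *m v n)) @[n --> \oo] --> comoment l.
Hypothesis cvg_crossR : forall l,
  complex.Re (ip (u n) ((X n *m conjT (X n)) ^+ l *m (X n *m v n))) @[n --> \oo] --> (0 : R).
Hypothesis cvg_crossI : forall l,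
  complex.Im (ip (u n) ((X n *m conjT (X n)) ^+ l *m (X n *m v n))) @[n --> \oo] --> (0 : R).

Let e n := col_mx (u n) (0 : 'cV[C]_(m n)).
Let f n := col_mx (0 : 'cV[C]_n.+1) (v n).
Let H n := herm (X n).

Let e1 n : frob2 (e n) = 1.
Proof. by rewrite /e frob2_col_mx u1 frob2_0 addr0. Qed.

Let f1 n : frob2 (f n) = 1.
Proof. by rewrite /f frob2_col_mx v1 frob2_0 add0r. Qed.

Let HH n : conjT (H n) = H n. Proof. exact: conjT_herm. Qed.

Lemma cvg_interleave_l (A : nat -> nat -> R) (a : nat -> R) :
  (forall l, A n l @[n --> \oo] --> a l) -> forall k,
  interleave (A n) (fun=> 0) k @[n --> \oo] --> interleave a (fun=> 0) k.
Proof.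
move=> Aa; apply: nat_parity => l.
  by under eq_cvg do rewrite interleave_even; rewrite interleave_even; exact: Aa.
by under eq_cvg do rewrite interleave_odd; rewrite interleave_odd; exact: cvg_cst.
Qed.

Lemma apply_interleave (A B : Type) (h : A -> B) (a g : nat -> A) k :
  h (interleave a g k) = interleave (h \o a) (h \o g) k.
Proof. by rewrite /interleave; case: odd. Qed.

Let lim_e k : complex.Re (ip (e n) (H n ^+ k *m e n)) @[n --> \oo] -->
  interleave (moment mu b) (fun=> 0) k.
Proof.
under eq_cvg do rewrite herm_moment_left apply_interleave.
exact: cvg_interleave_l.
Qed.

Let lim_f k : complex.Re (ip (f n) (H n ^+ k *m f n)) @[n --> \oo] -->
  interleave comoment (fun=> 0) k.
Proof.
under eq_cvg do rewrite herm_moment_right apply_interleave.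
exact: cvg_interleave_l.
Qed.

Let lim_gR k : complex.Re (ip (e n) (H n ^+ k *m f n)) @[n --> \oo] --> (0 : R).
Proof.
move: k; apply: (nat_parity (Q := fun k =>
  (fun n => complex.Re (ip (e n) (H n ^+ k *m f n))) @ \oo --> (0 : R))) => l.
  by under eq_cvg do rewrite herm_moment_cross interleave_even; exact: cvg_cst.
by under eq_cvg do rewrite herm_moment_cross interleave_odd; exact: cvg_crossR.
Qed.

Let lim_gI k : complex.Im (ip (e n) (H n ^+ k *m f n)) @[n --> \oo] --> (0 : R).
Proof.
move: k; apply: (nat_parity (Q := fun k =>
  (fun n => complex.Im (ip (e n) (H n ^+ k *m f n))) @ \oo --> (0 : R))) => l.
  by under eq_cvg do rewrite herm_moment_cross interleave_even; exact: cvg_cst.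
by under eq_cvg do rewrite herm_moment_cross interleave_odd; exact: cvg_crossI.
Qed.

Lemma interleave_ge0 (a : nat -> R) k : (forall l, 0 <= a l) ->
  0 <= interleave a (fun=> 0) k.
Proof. by rewrite /interleave; case: odd. Qed.

Lemma wsum_interleave0 z L (a : nat -> R) :
  wsum z (2 * L) (interleave a (fun=> 0)) = \sum_(l < L) z ^- (2 * l).+1 * a l.
Proof. by rewrite wsum_interleave [X in _ + X]big1 ?addr0// => l _; rewrite mulr0. Qed.

Lemma wsum0 (z : R) K : wsum z K (fun=> 0) = 0.
Proof. by rewrite /wsum big1// => k _; rewrite mulr0. Qed.

(** Were z <= s_0 for some decomposition, [rank2_upper] would give (1 - eta)^2 <= tau^2 A_n B_n,
    while the limit of the right side is at most tau^2 D(z) < 1 and eta is small. The rank [n] from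
    which this is impossible does not depend on the decomposition. *)
Lemma upper_eventually (tau z : R) : b < z -> tau ^+ 2 * Dtr c mu z < 1 ->
  \forall n \near \oo, forall Kr s U V,
    is_svd Kr (X n + tau%:CC *: (u n *m conjT (v n))) s U V -> s ord0 < z.
Proof.
move=> bz; set q := tau ^+ 2 * _ => q1; have z0 : 0 < z by exact: le_lt_trans bz.
have q0 : 0 <= q.
  by rewrite mulr_ge0 ?sqr_ge0// DtrE mulr_ge0// ltW ?phi_mu_gt0 ?psi_gt0.
(* Eventually ||X|| < B, and B < z leaves a gap that makes the remainder decay geometrically. *)
pose B := (b + z) / 2; have bB : b < B by rewrite /B; lra.
have Bz : B < z by rewrite /B; lra.
have B0 : 0 <= B by apply: ltW; exact: le_lt_trans bB.
(* Then (1 - d)^2 = ((1 + q)/2)^2 > q, so an [eta] below [d] suffices. The truncation order is fixed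
   by this requirement before [n] grows. *)
pose d := (1 - q) / 2; have d0 : 0 < d by rewrite /d; lra.
have d1 : d <= 1 by rewrite /d; lra.
have [L HL] : exists L, 2 * `|tau| * (B / z) ^+ (2 * L.+1) / (z - B) < d.
  have zB : 0 < z - B by rewrite subr_gt0.
  pose k := 2 * `|tau| / (z - B) + 1.
  have k0 : 0 < k by rewrite ltr_wpDl// divr_ge0 ?mulr_ge0// ltW.
  have [|||N _ /(_ N (leqnn _)) HN] := @geometric_eventually (B / z) (d / k).
  - by rewrite divr_ge0// ltW.
  - by rewrite ltr_pdivrMr// mul1r.
  - by rewrite divr_gt0.
  exists N; rewrite mulrAC.
  have p0 : 0 <= (B / z) ^+ (2 * N.+1) by rewrite exprn_ge0// divr_ge0// ltW.
  move: HN p0; rewrite ltr_pdivlMr// /k.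
  by move: (_ ^+ _) => p HN p0; apply: le_lt_trans HN; rewrite mulrC ler_wpM2l// lerDl ler01.
set K := (2 * L.+1)%N in HL.
pose Gn n := wsum z K (fun k => Normc.normc (ip (e n) (H n ^+ k *m f n))).
pose An n := wsum z K (fun k => Normc.normc (ip (e n) (H n ^+ k *m e n))).
pose Bn n := wsum z K (fun k => Normc.normc (ip (f n) (H n ^+ k *m f n))).
have limA : An n @[n --> \oo] --> phiL L.+1 z.
  rewrite /phiL /phi_trunc -wsum_interleave0; apply: cvg_wsum => k.
  under eq_cvg do rewrite moment_real// normc_real.
  have := cvg_norm (@lim_e k); rewrite ger0_norm; first exact.
  by apply: interleave_ge0 => l; exact: moment_ge0.
have limB : Bn n @[n --> \oo] --> psiL L.+1 z.
  rewrite /psiL -wsum_interleave0; apply: cvg_wsum => k.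
  under eq_cvg do rewrite moment_real// normc_real.
  have := cvg_norm (@lim_f k); rewrite ger0_norm; first exact.
  by apply: interleave_ge0 => l; exact: comoment_ge0.
have limG : Gn n @[n --> \oo] --> (0 : R).
  rewrite -(wsum0 z K); apply: cvg_wsum => k.
  apply: (@squeeze_cvgr _ _ _ _ (fun=> 0) (fun n => `|complex.Re (ip (e n) (H n ^+ k *m f n))|
     + `|complex.Im (ip (e n) (H n ^+ k *m f n))|)).
  - by apply: nearW => n; rewrite normc_ge0 normc_le_ReIm.
  - exact: cvg_cst.
  - have := cvgD (cvg_norm (@lim_gR k)) (cvg_norm (@lim_gI k)).
    by rewrite normr0 addr0; exact.
have [t0 t1 t2 _] := trunc_product_bounds L bz.
have limAB : tau ^+ 2 * An n * Bn n @[n --> \oo] --> tau ^+ 2 * phiL L.+1 z * psiL L.+1 z.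
  by apply: cvgM => //; apply: cvgM => //; exact: cvg_cst.
have limE : `|tau| * Gn n + 2 * `|tau| * (B / z) ^+ K / (z - B) @[n --> \oo] -->
    `|tau| * 0 + 2 * `|tau| * (B / z) ^+ K / (z - B).
  by apply: cvgD; [apply: cvgM => //; exact: cvg_cst|exact: cvg_cst].
have lim1 : tau ^+ 2 * phiL L.+1 z * psiL L.+1 z < (1 - d) ^+ 2.
  apply: (@le_lt_trans _ _ q).
    by rewrite -mulrA /q DtrE ler_wpM2l ?sqr_ge0.
  by rewrite /d; nra.
have nearAB : \forall n \near \oo, tau ^+ 2 * An n * Bn n < (1 - d) ^+ 2.
  exact: (cvgr_lt _ limAB _ lim1).
rewrite mulr0 add0r in limE; have nearE : \forall n \near \oo,
    `|tau| * Gn n + 2 * `|tau| * (B / z) ^+ K / (z - B) < d.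
  exact: (cvgr_lt _ limE _ HL).
have nearB : \forall n \near \oo, @sX n ord0 < B by exact: (cvgr_lt _ sXb _ bB).
move: nearAB nearE nearB; apply: filterS3 => n ABn En sB Kr s U V svd.
rewrite ltNge; apply/negP => zs.
have [w0 wE] := herm_top_eigenvector svd.
have HB (y : 'cV[C]_(n.+1 + m n)) : frob2 (H n *m y) <= B ^+ 2 * frob2 y.
  exact: (herm_op_norm y (svdX n) (ltW sB)).
have := rank2_upper (@HH n) (K := K) B0 Bz zs w0 (@e1 n) (@f1 n) HB wE.
move: En ABn; rewrite /Gn /An /Bn; set eta := _ + _ / _ => En ABn.
have e_le1 : eta <= 1 by apply: ltW; exact: lt_le_trans d1.
move=> /(_ e_le1); rewrite leNgt => /negP; apply; apply: (lt_le_trans ABn).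
by apply: lerXn2r; rewrite ?nnegrE ?subr_ge0// lerD2l lerN2 ltW.
Qed.

(** Were s_0 <= z, [rank2_lower] would bound the form at the truncated resolvent vector, but the
    limit of that inequality reads 0 <= F (1 - tau^2 F G) minus a nonnegative tail, with F G close
    to D(z). *)
Lemma lower_eventually (tau z : R) : b < z -> 0 < tau -> 1 < tau ^+ 2 * Dtr c mu z ->
  \forall n \near \oo, forall Kr s U V,
    is_svd Kr (X n + tau%:CC *: (u n *m conjT (v n))) s U V -> z < s ord0.
Proof.
move=> bz tau0; rewrite DtrE => q1; have z0 : 0 < z by exact: le_lt_trans bz.
have p0 := phi_mu_gt0 bz; have q0 := psi_gt0 bz.
have [L HL] : exists L, 1 < tau ^+ 2 * (phiL L.+1 z * psiL L.+1 z).
  pose q := tau ^+ 2 * (phi z * psi z); have qp : 0 < q by exact: lt_trans q1.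
  (* For r < d one has (1 - r)^2 >= 1 - 2 r > 1/q, so truncation keeps the product above 1. *)
  pose d := (1 - q^-1) / 2.
  have d0 : 0 < d by rewrite divr_gt0// subr_gt0 invf_lt1.
  have [|||N _ /(_ N (leqnn _)) HN] := @geometric_eventually (b / z) d.
  - by rewrite divr_ge0// ltW.
  - by rewrite ltr_pdivrMr// mul1r.
  - by [].
  exists N; have [_ _ _ h] := trunc_product_bounds N bz.
  apply: (@lt_le_trans _ _ (q * (1 - (b / z) ^+ (2 * N.+1)) ^+ 2)); last first.
    by rewrite /q -mulrA ler_wpM2l ?sqr_ge0.
  have r0 : 0 <= (b / z) ^+ (2 * N.+1) by rewrite exprn_ge0// divr_ge0// ltW.
  rewrite -ltr_pdivrMl// mulr1; move: HN r0; move: (_ ^+ _) => r rd r0.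
  move: rd; rewrite /d; move: (q^-1) => y; nra.
have [t0 t1 _ _] := trunc_product_bounds L bz.
set F := phiL L.+1 z in HL t0; set G := psiL L.+1 z in HL t1.
have Fp : 0 < F.
  rewrite lt_neqAle t0 andbT; apply/eqP => F0; move: HL.
  by rewrite -F0 mul0r mulr0 ltNge ler01.
set K := (2 * L.+1)%N.
pose a n k := complex.Re (ip (e n) (H n ^+ k *m e n)).
pose b' n k := complex.Re (ip (f n) (H n ^+ k *m f n)).
pose gr n k := complex.Re (ip (e n) (H n ^+ k *m f n)).
pose gi n k := complex.Im (ip (e n) (H n ^+ k *m f n)).
(* With p = 1 this minimizes F + q^2 G - 2 tau q F G, and the minimum is F (1 - tau^2 F G) < 0. *)
pose q := tau * F.
have limA : wsum z K (a n) @[n --> \oo] --> F.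
  by rewrite /F /phiL /phi_trunc -wsum_interleave0; apply: cvg_wsum => k; exact: lim_e.
have limB : wsum z K (b' n) @[n --> \oo] --> G.
  by rewrite /G /psiL -wsum_interleave0; apply: cvg_wsum => k; exact: lim_f.
have limR : wsum z K (gr n) @[n --> \oo] --> (0 : R).
  by rewrite -(wsum0 z K); apply: cvg_wsum => k; exact: lim_gR.
have limI : wsum z K (gi n) @[n --> \oo] --> (0 : R).
  by rewrite -(wsum0 z K); apply: cvg_wsum => k; exact: lim_gI.
pose tl k := 1 ^+ 2 * interleave (moment mu b) (fun=> 0) (k + K)%N
   + q ^+ 2 * interleave comoment (fun=> 0) (k + K)%N + 2 * 1 * q * 0.
have limT : wsum z K (fun k => 1 ^+ 2 * a n (k + K)%N + q ^+ 2 * b' n (k + K)%N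
                         + 2 * 1 * q * gr n (k + K)%N) @[n --> \oo] --> wsum z K tl.
  apply: cvg_wsum => k; apply: cvgD.
    by apply: cvgD; apply: cvgM; [exact: cvg_cst|exact: lim_e|exact: cvg_cst|exact: lim_f].
  by apply: cvgM; [exact: cvg_cst|exact: lim_gR].
(* The truncation tail does not have to be small: it enters with a favourable sign, its limit being
   built from nonnegative moments. *)
have tl0 : 0 <= z ^- K * wsum z K tl.
  apply: mulr_ge0; first by rewrite invr_ge0 exprn_ge0// ltW.
  apply: sumr_ge0 => k _; apply: mulr_ge0; first by rewrite invr_ge0 exprn_ge0// ltW.
  rewrite /tl mulr0 addr0 addr_ge0// mulr_ge0 ?sqr_ge0//; apply: interleave_ge0 => l.
    exact: moment_ge0.
  exact: comoment_ge0.
pose lhs n := 2 * tau * (1 ^+ 2 * wsum z K (a n) * wsum z K (gr n)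
    + 1 * q * wsum z K (a n) * wsum z K (b' n)
    + 1 * q * (wsum z K (gr n) ^+ 2 - wsum z K (gi n) ^+ 2)
    + q ^+ 2 * wsum z K (b' n) * wsum z K (gr n)).
pose rhs n := 1 ^+ 2 * wsum z K (a n) + q ^+ 2 * wsum z K (b' n) + 2 * 1 * q * wsum z K (gr n)
   - z ^- K * wsum z K (fun k => 1 ^+ 2 * a n (k + K)%N + q ^+ 2 * b' n (k + K)%N
                         + 2 * 1 * q * gr n (k + K)%N).
have cc (r : R) : (fun _ : nat => r) @ \oo --> r by exact: cvg_cst.
have cX (h : nat -> R) (l : R) : h n @[n --> \oo] --> l -> h n ^+ 2 @[n --> \oo] --> l ^+ 2.
  by move=> hl; under eq_cvg do rewrite expr2; rewrite expr2; exact: cvgM.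
have cD (g h : nat -> R) (x y : R) : g n @[n --> \oo] --> x -> h n @[n --> \oo] --> y ->
    g n + h n @[n --> \oo] --> x + y by move=> ? ?; exact: cvgD.
have cB (g h : nat -> R) (x y : R) : g n @[n --> \oo] --> x -> h n @[n --> \oo] --> y ->
    g n - h n @[n --> \oo] --> x - y by move=> ? ?; exact: cvgB.
have cM (g h : nat -> R) (x y : R) : g n @[n --> \oo] --> x -> h n @[n --> \oo] --> y ->
    g n * h n @[n --> \oo] --> x * y by move=> ? ?; exact: cvgM.
have limD : rhs n - lhs n @[n --> \oo] -->
  (1 ^+ 2 * F + q ^+ 2 * G + 2 * 1 * q * 0 - z ^- K * wsum z K tl) -
  2 * tau * (1 ^+ 2 * F * 0 + 1 * q * F * G + 1 * q * (0 ^+ 2 - 0 ^+ 2) + q ^+ 2 * G * 0).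
  have l1 := cD _ _ _ _ (cD _ _ _ _ (cM _ _ _ _ (cc (1 ^+ 2)) limA)
    (cM _ _ _ _ (cc (q ^+ 2)) limB)) (cM _ _ _ _ (cc (2 * 1 * q)) limR).
  have l2 := cB _ _ _ _ l1 (cM _ _ _ _ (cc (z ^- K)) limT).
  have l3 := cD _ _ _ _ (cD _ _ _ _ (cD _ _ _ _
    (cM _ _ _ _ (cM _ _ _ _ (cc (1 ^+ 2)) limA) limR)
    (cM _ _ _ _ (cM _ _ _ _ (cc (1 * q)) limA) limB))
    (cM _ _ _ _ (cc (1 * q)) (cB _ _ _ _ (cX _ _ limR) (cX _ _ limI))))
    (cM _ _ _ _ (cM _ _ _ _ (cc (q ^+ 2)) limB) limR).
  exact: (cB _ _ _ _ l2 (cM _ _ _ _ (cc (2 * tau)) l3)).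
have lim0 : (1 ^+ 2 * F + q ^+ 2 * G + 2 * 1 * q * 0 - z ^- K * wsum z K tl) -
  2 * tau * (1 ^+ 2 * F * 0 + 1 * q * F * G + 1 * q * (0 ^+ 2 - 0 ^+ 2) + q ^+ 2 * G * 0) < 0.
  move: tl0; set tl' := z ^- K * _ => tl0; rewrite /q.
  have : F * (1 - tau ^+ 2 * (F * G)) < 0 by rewrite pmulr_rlt0// subr_lt0.
  by rewrite !expr2; lra.
have nearD : \forall n \near \oo, rhs n - lhs n < 0 by exact: (cvgr_lt _ limD _ lim0).
move: nearD; apply: filterS => n Dn Kr s U V svd; rewrite ltNge; apply/negP => sz.
move: Dn; rewrite ltNge => /negP; apply; rewrite subr_ge0.
apply: (rank2_lower (@HH n) 1 q K _ _) => //; first by rewrite gt_eqF.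
by move=> x; exact: (herm_form_le x svd sz).
Qed.

End EventualBounds.

(** * Support of the limiting singular value distribution *)

Section WeakLimit.
Context {R : realType}.

Variables (mu : probability R R) (a b : R) (S : forall n : nat, 'I_n.+1 -> R).
Hypothesis muab : mu [set` `[a, b]] = 1%E.
Hypothesis S0 : forall n i, 0 <= @S n i.
Hypothesis weak : forall f : R -> R, continuous f ->
  (exists M : R, forall x, `|f x| <= M) ->
  ((n.+1%:R)^-1 * \sum_(i < n.+1) f (@S n i)) @[n --> \oo] --> Rintegral mu setT f.

Lemma continuous_clamp (x y : R) : continuous (fun t : R => Num.min x (Num.max y t)).
Proof.
move=> t; apply: continuous_min; first exact: cst_continuous.
by apply: continuous_max; [exact: cst_continuous|exact: cvg_id].
Qed.

Lemma weak_limit_support : mu [set` `[0, b]] = 1%E.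
Proof.
(* A bounded continuous function, positive exactly on the negative half-line; it vanishes at all
   singular values, so its limit integral is 0 and [mu] has no mass below 0, whatever the sign of
   [a]. *)
pose f (t : R) := Num.min 1 (Num.max 0 (- t)).
have f0 t : 0 <= f t by rewrite le_min ler01 le_max lexx.
have fc : continuous f.
  move=> t; apply: (@continuous_comp _ _ _ (fun x : R => - x) (fun t => Num.min 1 (Num.max 0 t))).
    exact: opp_continuous.
  exact: continuous_clamp.
have f1 t : `|f t| <= 1 by rewrite ger0_norm// ge_min lexx.
have intf0 : Rintegral mu setT f = 0.
  have := weak fc (ex_intro _ 1 f1).
  under eq_cvg => n.
    rewrite big1 ?mulr0; last first.
      by move=> i _; rewrite /f max_l ?oppr_le0// min_r ?ler01.
    over.
  by move=> /(cvg_lim (@Rhausdorff R)) <-; exact: lim_cst.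
have mf : measurable_fun setT f by exact: continuous_measurable_fun.
have intf : mu.-integrable setT (EFin \o f).
  apply: measurable_bounded_integrable => //.
    by rewrite [X in (X < _)%E](probability_setT mu) ltry.
  by exists 1; split; [exact: num_real|move=> x x1 t _; apply: (le_trans (f1 t)); exact: ltW].
have mneg : measurable [set t : R | t < 0].
  by rewrite [X in measurable X](_ : _ = [set` `]-oo, 0[])//; apply/seteqP; split => t /=; rewrite in_itv.
have neg0 : mu [set t : R | t < 0] = 0%E.
  have : (\int[mu]_x `|(EFin \o f) x| = 0)%E.
    rewrite (eq_integral (EFin \o f)); last by move=> t _ /=; rewrite ger0_norm.
    have fin := integrable_fin_num measurableT intf.
    by rewrite -(fineK fin) -[fine _]/(Rintegral mu setT f) intf0.
  have mEf : measurable_fun setT (EFin \o f) by exact/measurable_EFinP.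
  move=> /(ae_eq_integral_abs mu measurableT mEf) [N [mN N0 sub]].
  apply: (@subset_measure0 _ _ _ mu _ N) => // t /= t0; apply: sub => /= H.
  have := H I; rewrite /f => -[].
  have ft : 0 < Num.min 1 (Num.max 0 (- t)) by rewrite lt_min ltr01 lt_max oppr_gt0 t0 orbT.
  by move=> E; rewrite E ltxx in ft.
have muC (A : set R) : measurable A -> mu (~` A) = 0%E -> mu A = 1%E.
  move=> mA H; rewrite -[A]setCK probability_setC ?H ?sube0//; exact: measurableC.
apply: muC => //.
apply: (@subset_measure0 _ _ _ mu _ (~` [set` `[a, b]] `|` [set t | t < 0])).
- exact: measurableC.
- by apply: measurableU => //; exact: measurableC.
- move=> t /= ; rewrite !in_itv /= => H; have [t0|t0] := ltP t 0; first by right.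
  by left; apply: contra_not H => /andP[_ tb]; rewrite t0 tb.
- have abC0 : mu (~` [set` `[a, b]]) = 0%E by rewrite probability_setC// muab subee.
  by apply: null_set_setU => //; exact: measurableC.
Qed.

End WeakLimit.

(** * Monotonicity and inversion of the D-transform *)

Section DTransform.
Context {R : realType}.
Variables (mu : probability R R) (b c : R).
Hypothesis b0 : 0 <= b.
Hypothesis muD : mu [set` `[0, b]] = 1%E.
Hypotheses (c0 : 0 <= c) (c1 : c <= 1).

(** Both factors of D are positive and nonincreasing, and the strict sign comes from phi' <=
    -1/z^2. *)
Lemma Dtr_derive (z : R) : b < z ->
  derivable (Dtr c mu) z 1 /\ derive1 (Dtr c mu) z < 0.
Proof.
move=> bz; have z0 : 0 < z by exact: le_lt_trans bz.
have [dphi phi'] := phi_mu_derive b0 muD bz.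
have phi0 := phi_mu_gt0 b0 muD bz.
have d1 : is_derive z 1 (phi_mu mu) (derive1 (phi_mu mu) z).
  by rewrite derive1E; exact: derivableP.
have d2 : is_derive z 1 (fun x : R => x^-1) (- z ^- 2).
  have := @is_deriveV _ id z 1 1 (lt0r_neq0 z0) (is_derive_id z 1).
  by rewrite /GRing.scale /= mulr1.
have d3 := is_deriveD (is_deriveZ c d1) (is_deriveZ (1 - c) d2).
have d4 := is_deriveM d1 d3.
have d5 : is_derive z 1 (Dtr c mu)
  (phi_mu mu z * (c * derive1 (phi_mu mu) z - (1 - c) * z ^- 2) +
   (c * phi_mu mu z + (1 - c) / z) * derive1 (phi_mu mu) z).
  apply: (is_derive_eq d4).
  rewrite [(c \*: _ + _) z](_ : _ = c * phi_mu mu z + (1 - c) / z)//.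
  by rewrite /GRing.scale /=; ring.
split; first by case: d5.
rewrite derive1E; have [_ ->] := d5.
have zz : 0 < z ^- 2 by rewrite invr_gt0 exprn_gt0.
have zi : 0 < z^-1 by rewrite invr_gt0.
move: phi' phi0 zz zi; rewrite expr2 invfM; set p' := derive1 _ z.
move: (phi_mu mu z) (z^-1) => p y p'y p0 yy y0.
have p'0 : p' < 0 by lra.
have h1 : p * (c * p' - (1 - c) * (y * y)) <= 0.
  rewrite pmulr_rle0// subr_le0 (@le_trans _ _ 0)//.
    by rewrite mulr_ge0_le0// ltW.
  by rewrite mulr_ge0 ?subr_ge0// ltW.
have h2 : 0 < c * p + (1 - c) * y.
  have [cp|] := ltP 0 c; first by rewrite ltr_pwDl ?mulr_gt0// mulr_ge0 ?subr_ge0// ltW.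
  move=> c00; rewrite (_ : c = 0); last by apply/eqP; rewrite eq_le c00 c0.
  by rewrite mul0r add0r subr0 mul1r.
have h3 : (c * p + (1 - c) * y) * p' < 0 by rewrite pmulr_rlt0.
lra.
Qed.

Lemma Dtr_mvt (y z : R) : b < y -> y < z ->
  exists2 x, x \in `]y, z[ & Dtr c mu z - Dtr c mu y = derive1 (Dtr c mu) x * (z - y).
Proof.
move=> bY yz; apply: MVT => // [x|].
  rewrite in_itv /= => /andP[yx _]; rewrite derive1E; apply: derivableP.
  by have [] := Dtr_derive (lt_trans bY yx).
apply: derivable_within_continuous => x; rewrite in_itv /= => /andP[yx _].
by have [] := Dtr_derive (lt_le_trans bY yx).
Qed.

Lemma Dtr_decreasing (y z : R) : b < y -> y < z -> Dtr c mu z < Dtr c mu y.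
Proof.
move=> bY yz; have [x xyz E] := Dtr_mvt bY yz.
rewrite -subr_lt0 E pmulr_llt0 ?subr_gt0//.
move: xyz; rewrite in_itv /= => /andP[yx _].
by have [] := Dtr_derive (lt_trans bY yx).
Qed.

Lemma Dtr_small (e : R) : 0 < e -> exists2 z, b < z & Dtr c mu z < e.
Proof.
move=> e0; pose z := 2 * b + 1 + 4 / e.
have e4 : 0 < 4 / e by rewrite divr_gt0.
have [bz z1] : b < z /\ 1 <= z by move: b0 e4; rewrite /z; move: (4 / e) => w *; split; lra.
have z0 : 0 < z by lra.
exists z => //; have /andP[_ h] := phi_mu_bounds b0 muD bz.
have phi0 := phi_mu_gt0 b0 muD bz.
have den : 0 < z ^+ 2 - b ^+ 2 by rewrite subr_gt0 ltrXn2r ?nnegrE// ltW.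
have h2 : phi_mu mu z <= 2 / z.
  apply: (le_trans h); rewrite ler_pdivrMr// mulrAC ler_pdivlMr// -expr2.
  have : 2 * b <= z by move: b0 e4; rewrite /z; move: (4 / e) => w *; lra.
  by move: (z) b0 => y *; nra.
have zi : 0 < z^-1 by rewrite invr_gt0.
have h3 : z^-1 < e / 4 by rewrite -[e / 4]invrK ltf_pV2 ?posrE ?invr_gt0 ?divr_gt0// invf_div /z; move: b0 => *; lra.
have h4 : z^-1 <= 1 by rewrite invf_le1.
rewrite /Dtr; move: (phi_mu mu z) phi0 h2 => p p0.
move: (z^-1) zi h3 h4 => y y0 h3 h4 h2.
have h5 : c * p + (1 - c) * y <= 2 * y.
  have cp : c * p <= c * (2 * y) by rewrite ler_wpM2l.
  have : 0 <= (1 - c) * y by rewrite mulr_ge0 ?subr_ge0// ltW.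
  by rewrite mulrBl mul1r; lra.
have h6 : p * (c * p + (1 - c) * y) <= (2 * y) * (2 * y).
  apply: ler_pM => //; first exact: ltW.
  by apply: addr_ge0; apply: mulr_ge0; rewrite ?subr_ge0// ltW.
apply: (le_lt_trans h6); nra.
Qed.

(** D is decreasing, so its right limit at [b] is its supremum, possibly infinite; a strict
    inequality for a supremum is attained at some point. *)
Lemma supercritical_equiv (t : R) : 0 < t ->
  (1 < t%:E * Dbplus c mu b)%E <-> exists2 z, b < z & 1 < t * Dtr c mu z.
Proof.
move=> t0.
have DE : Dbplus c mu b = ereal_sup [set (Dtr c mu x)%:E | x in [set` `]b, +oo[]].
  apply/cvg_lim => //; apply: (nonincreasing_at_right_cvge +oo%O) => //.
  move=> x y; rewrite !in_itv /= !andbT => bx _ xy.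
  rewrite lee_fin; move: xy; rewrite le_eqVlt => /orP[/eqP ->//|xy].
  by apply: ltW; exact: Dtr_decreasing.
have inf_t : (1 < t%:E * Dbplus c mu b)%E = ((t^-1)%:E < Dbplus c mu b)%E.
  by rewrite -[in RHS](mule1 (t^-1)%:E) lte_pdivrMl.
rewrite inf_t DE; split=> [/ereal_sup_gt[_ [z /= bz <-]]|[z bz h]].
  rewrite lte_fin => h; exists z; first by move: bz; rewrite in_itv /= andbT.
  by rewrite -(ltr_pM2l t0) mulfV ?gt_eqF// in h.
apply: (@lt_le_trans _ _ (Dtr c mu z)%:E).
  by rewrite lte_fin -(ltr_pM2l t0) mulfV ?gt_eqF.
by apply: ereal_sup_ubound; exists z => //; rewrite /= in_itv /= bz.
Qed.

(** The intermediate value theorem between [z] and a distant point where D is below [t] shows that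
    the choice in [Dinv] is made from a nonempty set. *)
Lemma Dtr_inverse (t : R) : 0 < t -> (exists2 z, b < z & t < Dtr c mu z) ->
  b < Dinv c mu b t /\ Dtr c mu (Dinv c mu b t) = t.
Proof.
move=> t0 [z bz tz]; have [y bY yt] := Dtr_small t0.
have zy : z < y.
  rewrite ltNge le_eqVlt; apply/negP => /orP[/eqP yz|yz].
    by move: (lt_trans yt tz); rewrite yz ltxx.
  by have := Dtr_decreasing bY yz; rewrite ltNge ltW// (lt_trans yt tz).
have [||x xzy xt] := @IVT R (Dtr c mu) z y t (ltW zy).
- apply: derivable_within_continuous => x; rewrite in_itv /= => /andP[zx _].
  by have [] := Dtr_derive (lt_le_trans bz zx).
- have yz' := ltW (lt_trans yt tz).
  by rewrite (min_r yz') (max_l yz') (ltW yt) (ltW tz).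
- have H : exists r, [set z : R | b < z /\ Dtr c mu z = t] r.
    exists x; split => //; move: xzy; rewrite in_itv /= => /andP[zx _].
    exact: lt_le_trans zx.
  by have := getPex H.
Qed.

End DTransform.

(** * Convergence of the empirical even moments *)

Section PowerMeans.
Context {R : realType}.
Variables (mu : probability R R) (b : R) (S : forall n : nat, 'I_n.+1 -> R).
Hypothesis b0 : 0 <= b.
Hypothesis muD : mu [set` `[0, b]] = 1%E.
Hypothesis S0 : forall n i, 0 <= @S n i.
Hypothesis Smax : forall n i, @S n i <= @S n ord0.
Hypothesis Sb : @S n ord0 @[n --> \oo] --> b.
Hypothesis weak : forall f : R -> R, continuous f ->
  (exists M : R, forall x, `|f x| <= M) ->
  ((n.+1%:R)^-1 * \sum_(i < n.+1) f (@S n i)) @[n --> \oo] --> Rintegral mu setT f.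

(** Powers are unbounded, so weak convergence is applied to the power of the clamp to [0, b].
    Singular values above [b] change the mean by at most [r n], which is governed by the largest one
    and tends to 0. *)
Lemma cvg_power_mean l :
  ((n.+1%:R)^-1 * \sum_(i < n.+1) @S n i ^+ (2 * l)) @[n --> \oo] --> moment mu b l.
Proof.
pose g (t : R) := Num.min b (Num.max 0 t); pose f t := g t ^+ (2 * l).
have g0 t : 0 <= g t by rewrite le_min b0 le_max lexx.
have gb t : g t <= b by rewrite ge_min lexx.
have fc : continuous f.
  move=> t; apply: (@continuous_comp _ _ _ g (fun x => x ^+ (2 * l))).
    exact: continuous_clamp.
  exact: exprn_continuous.
have fb x : `|f x| <= b ^+ (2 * l).
  by rewrite ger0_norm ?exprn_ge0// lerXn2r ?nnegrE.
have fint : Rintegral mu setT f = moment mu b l.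
  rewrite (Rintegral_support muD); last exact: continuous_measurable_fun.
  apply: eq_Rintegral => t; rewrite inE /= in_itv /= => /andP[t0 tb].
  by rewrite /f /g max_r// min_r.
have H := weak fc (ex_intro _ _ fb); rewrite fint in H.
pose r n := Num.max b (@S n ord0) ^+ (2 * l) - b ^+ (2 * l).
have rc : r n @[n --> \oo] --> (0 : R).
  have mc : {for b, continuous (fun t : R => Num.max b t)}.
    by apply: continuous_max; [exact: cst_continuous|exact: cvg_id].
  have h1 : Num.max b (@S n ord0) @[n --> \oo] --> Num.max b b by exact: cvg_comp Sb mc.
  have cX : {for Num.max b b, continuous (fun t : R => t ^+ (2 * l))}.
    exact: exprn_continuous.
  have h2 : Num.max b (@S n ord0) ^+ (2 * l) @[n --> \oo] --> Num.max b b ^+ (2 * l).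
    exact: cvg_comp h1 cX.
  have h3 : r n @[n --> \oo] --> Num.max b b ^+ (2 * l) - b ^+ (2 * l).
    by apply: cvgB; [exact: h2|exact: cvg_cst].
  by rewrite maxxx subrr in h3.
have H2 : (n.+1%:R)^-1 * \sum_(i < n.+1) f (@S n i) + r n @[n --> \oo] --> moment mu b l.
  by rewrite -[moment mu b l]addr0; apply: cvgD; [exact: H|exact: rc].
apply: (squeeze_cvgr _ H H2); apply: nearW => n.
have n0 : 0 < (n.+1%:R)^-1 :> R by rewrite invr_gt0 ltr0n.
have SE i : f (@S n i) <= @S n i ^+ (2 * l) <= f (@S n i) + r n.
  rewrite /f /g (max_r (S0 i)) /r.
  have bm : b ^+ (2 * l) <= Num.max b (@S n ord0) ^+ (2 * l).
    by apply: lerXn2r; rewrite ?nnegrE ?le_max ?b0 ?lexx.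
  have [Sib|bSi] := leP (@S n i) b.
    by rewrite lexx lerDl subr_ge0 bm.
  have b0' : b ^+ (2 * l) <= @S n i ^+ (2 * l).
    by apply: lerXn2r; rewrite ?nnegrE ?S0 ?b0 ?(ltW bSi).
  rewrite b0' /= addrC subrK; apply: lerXn2r; rewrite ?nnegrE ?S0 ?le_max ?b0//.
  by rewrite Smax orbT.
apply/andP; split.
  by rewrite ler_pM2l//; apply: ler_sum => i _; have /andP[] := SE i.
have -> : r n = (n.+1%:R)^-1 * \sum_(i < n.+1) r n.
  by rewrite sumr_const card_ord -[r n *+ _]mulr_natl mulrA mulVf ?mul1r// pnatr_eq0.
rewrite -mulrDr -big_split ler_pM2l//; apply: ler_sum => i _.
by have /andP[] := SE i.
Qed.

End PowerMeans.

(** * The loss as a quadratic function of the weight *)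

Section ShrinkageRisk.
Context {R : realType}.
Local Notation C := R[i].
Local Notation "x %:CC" := (real_complex R x) (at level 2, format "x %:CC").

(** The real inner product of the matrices u v^H and uh vh^H; it is unchanged when [uh] and [vh] are
    multiplied by a common phase, so that ambiguity of the decomposition is invisible. *)
Definition alignment p q (u uh : 'cV[C]_p) (v vh : 'cV[C]_q) : R :=
  complex.Re (ip uh u * ip v vh).

Lemma frob2D_mx p q (A B : 'M[C]_(p, q)) :
  frob2 (A + B) = frob2 A + frob2 B + 2 * complex.Re (\tr (conjT A *m B)).
Proof.
have trE (M : 'M[C]_(p, q)) : frob2 M = complex.Re (\tr (conjT M *m M)).
  by rewrite -frob2_trace.
rewrite !trE conjTD mulmxDl !mulmxDr !mxtraceD !ReD.
have -> : complex.Re (\tr (conjT B *m A)) = complex.Re (\tr (conjT A *m B)).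
  rewrite -[A in LHS]conjTK -conjT_mul /mxtrace !Re_sum; apply: eq_bigr => i _.
  by rewrite conjTE; case: (_ i i).
by ring.
Qed.

Lemma trace_rank1 p q (u u' : 'cV[C]_p) (v v' : 'cV[C]_q) :
  \tr (conjT (u *m conjT v) *m (u' *m conjT v')) = ip u u' * ip v' v.
Proof.
rewrite conjT_rank1 mulmxA mxtrace_mulC rank1_mul -scalemxAr mxtraceZ.
by rewrite trace_mx11.
Qed.

Lemma MSE1E p q (u uh : 'cV[C]_p) (v vh : 'cV[C]_q) (theta w : R) :
  frob2 u = 1 -> frob2 v = 1 -> frob2 uh = 1 -> frob2 vh = 1 ->
  MSE1 (theta%:CC *: (u *m conjT v)) uh vh w =
  theta ^+ 2 + w ^+ 2 - 2 * w * (theta * alignment u uh v vh).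
Proof.
move=> u1 v1 uh1 vh1; rewrite /MSE1 frob2D_mx frob2N !frob2Z !csq_real.
have F (x : 'cV[C]_p) (y : 'cV[C]_q) : frob2 x = 1 -> frob2 y = 1 ->
    frob2 (x *m conjT y) = 1.
  move=> x1 y1; have := frob2_trace (x *m conjT y); rewrite trace_rank1 !ipxx x1 y1 mulr1.
  by move=> /(congr1 (@complex.Re R)).
rewrite !F// !mulr1 conjTZ conjc_real mulmxN -scalemxAl -scalemxAr linearN /= !mxtraceZ.
rewrite ReN trace_rank1 !ReZ /alignment [ip u uh]ipC [ip vh v]ipC.
by case: (ip uh u) (ip v vh) => [x y] [x' y'] /=; ring.
Qed.

(** Strict convexity makes the constrained minimizer unique, so the choice in [wopt] can only be the
    projection of the vertex [k] onto the half-line. *)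
Lemma woptE p q (S : 'M[C]_(p, q)) (uh : 'cV[C]_p) (vh : 'cV[C]_q) (t k : R) :
  (forall w, MSE1 S uh vh w = t ^+ 2 + w ^+ 2 - 2 * w * k) ->
  wopt S uh vh = Num.max 0 k.
Proof.
move=> ME.
have H : exists r, [set w : R | 0 <= w /\ forall w', 0 <= w' ->
    MSE1 S uh vh w <= MSE1 S uh vh w'] r.
  exists (Num.max 0 k); split; first by rewrite le_max lexx.
  move=> w' w0; rewrite !ME; have [k0|k0] := leP 0 k.
    by have := sqr_ge0 (w' - k); nra.
  by have := sqr_ge0 w'; nra.
have := getPex H; rewrite -/(wopt S uh vh); set w := wopt S uh vh => -[w0 wmin].
have := wmin (Num.max 0 k); rewrite le_max lexx => /(_ isT); rewrite !ME.
have [k0|k0] := leP 0 k => h.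
  have : (w - k) ^+ 2 <= 0 by nra.
  by rewrite real_exprn_even_le0 ?num_real//= subr_eq0 => /eqP.
have : w ^+ 2 <= 0 by nra.
by rewrite real_exprn_even_le0 ?num_real//= => /eqP.
Qed.

(* [kappa n] is a subgradient at 0 of the functions bounded below by
   [s n + h * kappa n], so it converges to the derivative of their limit. *)
Lemma cvg_subgradient (s kappa : nat -> R) (F : R -> nat -> R) (rho k : R) :
  (forall h n, s n + h * kappa n <= F h n) ->
  s n @[n --> \oo] --> rho ->
  (forall sg e, sg = 1 \/ sg = -1 -> 0 < e -> exists2 h, 0 < h &
     \forall n \near \oo, F (sg * h) n <= rho + h * (sg * k + e)) ->
  kappa n @[n --> \oo] --> k.
Proof.
move=> sF srho H; apply/cvgrPdist_le => e e0.
(* One half pays for the slope of the upper bound on [F], the other for the lag of [s n] behind its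
   limit. *)
have e2 : 0 < e / 2 by rewrite divr_gt0.
have side sg : sg = 1 \/ sg = -1 -> \forall n \near \oo, sg * (kappa n - k) <= e.
  move=> sg1; have [h h0 Hh] := H sg _ sg1 e2.
  have Hs : \forall n \near \oo, rho - h * (e / 2) < s n.
    by apply: (cvgr_gt _ srho); rewrite gtrBl mulr_gt0.
  move: Hh Hs; apply: filterS2 => n Fn sn.
  have := sF (sg * h) n; move: Fn sn; set Fx := F _ n => Fn sn hF.
  rewrite -(ler_pM2l h0).
  have h1 : rho - h * (e / 2) + sg * h * kappa n <= rho + h * (sg * k + e / 2) by lra.
  have -> : h * (sg * (kappa n - k)) = sg * h * kappa n - h * (sg * k) by ring.
  have -> : h * e = h * (e / 2) + h * (e / 2) by field.
  by move: h1; rewrite mulrDr; lra.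
move: (side 1 (or_introl erefl)) (side (-1) (or_intror erefl)).
apply: filterS2 => n h1 h2; rewrite ler_norml; apply/andP; split; lra.
Qed.

Lemma lt_near_right (g : R -> R) (d : R) : is_derive (0 : R) 1 g d -> d < 0 ->
  exists2 h0, 0 < h0 & forall h, 0 < h -> h < h0 -> g h < g 0.
Proof.
move=> [dg dE] d0.
have : h^-1 *: (g (h *: 1 + 0) - g 0) @[h --> 0^'] --> d by rewrite -dE; exact: dg.
move=> /cvgr_lt/(_ 0 d0)[h0 /= h00 Hh]; exists h0 => // h hp hh.
have := Hh h; rewrite /= sub0r normrN gtr0_norm// => /(_ hh); rewrite gt_eqF// => /(_ isT).
rewrite addr0 [h *: 1]mulr1 /GRing.scale /= => hq.
by rewrite -subr_lt0; move: hq; rewrite pmulr_rlt0 ?invr_gt0.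
Qed.

End ShrinkageRisk.

(** * First-order estimates at the limiting top singular value *)

Section CriticalSteps.
Context {R : realType}.
Variables (mu : probability R R) (b c theta : R).
Hypothesis b0 : 0 <= b.
Hypothesis muD : mu [set` `[0, b]] = 1%E.
Hypotheses (c0 : 0 <= c) (c1 : c <= 1) (th0 : 0 < theta).

(** Here [k] is the slope from implicit differentiation of tau^2 D(F(tau)) = 1 at [theta]. Along the
    steeper line of slope [sg * k + e], the product starts at 1 with derivative theta^2 D' e < 0. *)
Lemma supercritical_step (rho sg e : R) :
  b < rho -> Dtr c mu rho = (theta ^+ 2)^-1 -> sg = 1 \/ sg = -1 -> 0 < e ->
  let k := -2 / (theta ^+ 3 * derive1 (Dtr c mu) rho) in
  exists2 h, 0 < h & b < rho + h * (sg * k + e) /\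
    (theta + sg * h) ^+ 2 * Dtr c mu (rho + h * (sg * k + e)) < 1.
Proof.
move=> brho Drho sg1 e0 k; set s := sg * k + e.
have [dD D'0] := Dtr_derive b0 muD c0 c1 brho.
set D' := derive1 _ rho in k s D'0 *.
have dlin (r t : R) : is_derive (0 : R) 1 (fun h : R => r + h * t) t.
  have d1 := is_deriveD (is_derive_cst r (0 : R) 1)
    (is_deriveM (is_derive_id (0 : R) 1) (is_derive_cst t (0 : R) 1)).
  by apply: (is_derive_eq d1); rewrite /GRing.scale /= /cst; ring.
have dDr : is_derive rho 1 (Dtr c mu) D' by rewrite /D' derive1E; exact: derivableP.
have dDl : is_derive (0 : R) 1 (Dtr c mu \o (fun h : R => rho + h * s)) (s * D').
  have dDr' : is_derive (rho + 0 * s) 1 (Dtr c mu) D' by rewrite mul0r addr0.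
  have dc := @is_derive1_comp _ (Dtr c mu) (fun h : R => rho + h * s) _ _ _ dDr' (dlin rho s).
  by apply: (is_derive_eq dc); rewrite mulrC.
have dsq := is_deriveX 2 (dlin theta sg).
have dg := is_deriveM dsq dDl.
pose g (h : R) := (theta + h * sg) ^+ 2 * Dtr c mu (rho + h * s).
have gE : is_derive (0 : R) 1 g (theta ^+ 2 * D' * e).
  apply: (is_derive_eq dg); rewrite /GRing.scale /= !mul0r !addr0 Drho expr1.
  rewrite [(_ ^+ 2) 0](_ : _ = (theta + 0 * sg) ^+ 2)// mul0r addr0 /s /k.
  by field; rewrite (gt_eqF th0) (lt_eqF D'0).
have neg : theta ^+ 2 * D' * e < 0.
  by rewrite pmulr_llt0// pmulr_rlt0// exprn_gt0.
have [h0 h00 Hh] := lt_near_right gE neg.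
(* Steps shorter than [h1] keep [rho + h * s] to the right of [b]. *)
pose h1 := (rho - b) / (`|s| + 1).
have s1 : 0 < `|s| + 1 by rewrite ltr_wpDl.
have h10 : 0 < h1 by rewrite divr_gt0// subr_gt0.
pose h := Num.min h0 h1 / 2.
have m0 : 0 < Num.min h0 h1 by rewrite lt_min h00.
have hp : 0 < h by rewrite divr_gt0.
have hm : h < Num.min h0 h1 by rewrite /h; lra.
have hh0 : h < h0 by apply: lt_le_trans hm _; rewrite ge_min lexx.
have hh1 : h < h1 by apply: lt_le_trans hm _; rewrite ge_min lexx orbT.
exists h => //; split.
  have : h * (`|s| + 1) < rho - b by rewrite -ltr_pdivlMr.
  have : - `|s| <= s by rewrite lerNl -normrN ler_norm.
  move: (`|s|) => t ts; nra.
have := Hh h hp hh0; rewrite /g !mul0r !addr0 Drho mulfV ?expf_neq0 ?gt_eqF//.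
by rewrite mulrC [h * sg]mulrC [X in X < 1]mulrC.
Qed.

(** Lowering the strength keeps it subcritical. Raising it by [h] multiplies tau^2 by (1 +
    h/theta)^2, and the steep fall of D next to [b] compensates for this within a distance
    [h * e]. *)
Lemma subcritical_step (sg e : R) :
  (forall z, b < z -> theta ^+ 2 * Dtr c mu z < 1) ->
  derive1 (Dtr c mu) z @[z --> b^'+] --> -oo ->
  sg = 1 \/ sg = -1 -> 0 < e ->
  exists2 h, 0 < h & (theta + sg * h) ^+ 2 * Dtr c mu (b + h * e) < 1.
Proof.
move=> sub D'oo sg1 e0.
have D0 z : b < z -> 0 < Dtr c mu z.
  by move=> bz; apply: mulr_gt0; [exact: (phi_mu_gt0 b0 muD bz)|exact: (psi_gt0 b0 muD c0 c1 bz)].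
case: sg1 => ->; last first.
  exists (theta / 2); first by rewrite divr_gt0.
  have bz : b < b + theta / 2 * e by rewrite ltrDl mulr_gt0// divr_gt0.
  apply: le_lt_trans (sub _ bz); rewrite ler_pM2r ?D0//.
  by have th0' := th0; apply: lerXn2r; rewrite ?nnegrE; lra.
(* Chosen so that theta^2 L (h e / 2) = 3 h/theta. With y = h/theta, (1 + y)^2 (1 - 3 y) < 1 for y >
   0, as 3 exceeds the linear coefficient 2 of the square. *)
pose L := 6 / (theta ^+ 3 * e).
have t3 : 0 < theta ^+ 3 * e by rewrite mulr_gt0// exprn_gt0.
have [d /= d0 Hd] : \forall z \near b^'+, derive1 (Dtr c mu) z <= - L.
  by move/cvgrNyPle : D'oo; apply.
pose h := Num.min theta (d / e) / 2.
have m0 : 0 < Num.min theta (d / e) by rewrite lt_min th0 divr_gt0.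
have hp : 0 < h by rewrite divr_gt0.
have hm : h < Num.min theta (d / e) by rewrite /h; lra.
have hth : h < theta by apply: lt_le_trans hm _; rewrite ge_min lexx.
have hd : h * e < d.
  by rewrite -ltr_pdivlMr//; apply: lt_le_trans hm _; rewrite ge_min lexx orbT.
exists h => //; rewrite mul1r.
have he : 0 < h * e by rewrite mulr_gt0.
(* The mean value theorem starts at the half step, since the bound on theta^2 D is known only
   strictly to the right of [b]. *)
have by1 : b < b + h * e / 2 by rewrite ltrDl divr_gt0.
have yz : b + h * e / 2 < b + h * e by lra.
have [x xyz xE] := Dtr_mvt b0 muD c0 c1 by1 yz.
have D'x : derive1 (Dtr c mu) x <= - L.
  move: xyz; rewrite in_itv /= => /andP[yx xz].
  apply: Hd; last exact: lt_trans yx.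
  by rewrite /= ltr_distlC; apply/andP; split; lra.
have th2 : 0 < theta ^+ 2 by rewrite exprn_gt0.
have Dy := sub _ by1.
have Dz : theta ^+ 2 * Dtr c mu (b + h * e) < 1 - 3 * (h / theta).
  have E : Dtr c mu (b + h * e) <= Dtr c mu (b + h * e / 2) - L * (h * e / 2).
    rewrite -lerBlDl xE (_ : b + h * e - (b + h * e / 2) = h * e / 2); last by field.
    by rewrite -mulNr ler_pM2r// divr_gt0.
  have E2 : theta ^+ 2 * (L * (h * e / 2)) = 3 * (h / theta).
    by rewrite /L; field; rewrite (gt_eqF th0) (gt_eqF e0).
  have : theta ^+ 2 * Dtr c mu (b + h * e) <=
      theta ^+ 2 * (Dtr c mu (b + h * e / 2) - L * (h * e / 2)) by rewrite ler_pM2l.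
  by rewrite mulrBr E2; lra.
have x0 : 0 < h / theta by rewrite divr_gt0.
have x1 : h / theta < 1 by rewrite ltr_pdivrMr// mul1r.
have -> : (theta + h) ^+ 2 = (1 + h / theta) ^+ 2 * theta ^+ 2.
  by field; rewrite gt_eqF.
rewrite -mulrA; move: (h / theta) x0 x1 Dz => y y0 y1 Dz.
apply: (@lt_trans _ _ ((1 + y) ^+ 2 * (1 - 3 * y))).
  by rewrite ltr_pM2l// exprn_gt0// addr_gt0.
by nra.
Qed.

End CriticalSteps.

(** * Limits of the top singular value and of the alignment *)

Section SpikeLimits.
Context {R : realType}.
Local Notation C := R[i].
Local Notation "x %:CC" := (real_complex R x) (at level 2, format "x %:CC").

Variables (mu : probability R R) (b c theta : R).
Hypothesis b0 : 0 <= b.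
Hypothesis muD : mu [set` `[0, b]] = 1%E.
Hypotheses (c0 : 0 <= c) (c1 : c <= 1) (th0 : 0 < theta).
Hypothesis D'oo : derive1 (Dtr c mu) z @[z --> b^'+] --> -oo.
Variables (m : nat -> nat) (X : forall n : nat, 'M[C]_(n.+1, m n)).
Variables (sX : forall n : nat, 'I_n.+1 -> R) (UX : forall n : nat, 'M[C]_(n.+1)).
Variable VX : forall n : nat, 'M[C]_(m n, n.+1).
Hypothesis nm : forall n, (n.+1 <= m n)%N.
Hypothesis svdX : forall n, is_svd false (X n) (@sX n) (UX n) (VX n).
Hypothesis sXb : @sX n ord0 @[n --> \oo] --> b.
Variables (u : forall n : nat, 'cV[C]_(n.+1)) (v : forall n : nat, 'cV[C]_(m n)).
Hypotheses (u1 : forall n, frob2 (u n) = 1) (v1 : forall n, frob2 (v n) = 1).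
Hypothesis cvg_left : forall l,
  complex.Re (ip (u n) ((X n *m conjT (X n)) ^+ l *m u n)) @[n --> \oo] --> moment mu b l.
Hypothesis cvg_right : forall l,
  complex.Re (ip (v n) ((conjT (X n) *m X n) ^+ l *m v n)) @[n --> \oo] --> comoment mu b c l.
Hypothesis cvg_crossR : forall l,
  complex.Re (ip (u n) ((X n *m conjT (X n)) ^+ l *m (X n *m v n))) @[n --> \oo] --> (0 : R).
Hypothesis cvg_crossI : forall l,
  complex.Im (ip (u n) ((X n *m conjT (X n)) ^+ l *m (X n *m v n))) @[n --> \oo] --> (0 : R).
Variables (Kr : bool) (s : forall n : nat, 'I_n.+1 -> R) (U : forall n : nat, 'M[C]_(n.+1)).
Variable V : forall n : nat, 'M[C]_(m n, n.+1).
Hypothesis svd : forall n,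
  is_svd Kr (X n + theta%:CC *: (u n *m conjT (v n))) (@s n) (U n) (V n).

Let F (h : R) n := svals (X n + (theta + h)%:CC *: (u n *m conjT (v n))) ord0.
Let kappa n := alignment (u n) (col ord0 (U n)) (v n) (col ord0 (V n)).

Let svdF h n : exists U' V', is_svd false (X n + (theta + h)%:CC *: (u n *m conjT (v n)))
  (svals (X n + (theta + h)%:CC *: (u n *m conjT (v n)))) U' V'.
Proof. exact: svals_svd (nm n). Qed.

Lemma subgradientF h n : @s n ord0 + h * kappa n <= F h n.
Proof.
have [U' [V' svd']] := svdF h n.
have := top_sval_subgradient (@svd n) svd'.
by rewrite (_ : theta + h - theta = h) //; ring.
Qed.

Lemma upperF h z : b < z -> (theta + h) ^+ 2 * Dtr c mu z < 1 ->
  \forall n \near \oo, F h n < z.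
Proof.
move=> bz Dz.
have := upper_eventually b0 muD c0 c1 svdX sXb u1 v1 cvg_left cvg_right
  cvg_crossR cvg_crossI bz Dz.
apply: filterS => n Hn; have [U' [V' svd']] := svdF h n; exact: Hn svd'.
Qed.

Lemma upper_s z : b < z -> theta ^+ 2 * Dtr c mu z < 1 ->
  \forall n \near \oo, @s n ord0 < z.
Proof.
move=> bz Dz.
have := upper_eventually b0 muD c0 c1 svdX sXb u1 v1 cvg_left cvg_right
  cvg_crossR cvg_crossI bz Dz.
by apply: filterS => n Hn; exact: Hn (@svd n).
Qed.

(** As D is strictly decreasing, theta^2 D lies above 1 at rho - d and below 1 at rho + d, which
    traps the top singular value. *)
Lemma supercritical_limits (rho : R) :
  b < rho -> Dtr c mu rho = (theta ^+ 2)^-1 ->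
  @s n ord0 @[n --> \oo] --> rho /\
  kappa n @[n --> \oo] --> -2 / (theta ^+ 3 * derive1 (Dtr c mu) rho).
Proof.
move=> brho Drho.
have th2 : 0 < theta ^+ 2 by rewrite exprn_gt0.
have th2D : theta ^+ 2 * Dtr c mu rho = 1 by rewrite Drho mulfV// gt_eqF.
have srho : @s n ord0 @[n --> \oo] --> rho.
  apply/cvgrPdist_lt => e e0.
  pose d := Num.min e (rho - b) / 2.
  have m0 : 0 < Num.min e (rho - b) by rewrite lt_min e0 subr_gt0.
  have d0 : 0 < d by rewrite divr_gt0.
  have dm : d < Num.min e (rho - b) by rewrite /d; lra.
  have de : d < e by apply: lt_le_trans dm _; rewrite ge_min lexx.
  have db : d < rho - b by apply: lt_le_trans dm _; rewrite ge_min lexx orbT.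
  have bd : b < rho - d by lra.
  have up : \forall n \near \oo, @s n ord0 < rho + d.
    apply: upper_s; first by rewrite ltr_wpDr// ltW.
    rewrite -[X in _ < X]th2D ltr_pM2l//.
    by apply: (Dtr_decreasing b0 muD c0 c1) => //; rewrite ltrDl.
  have lo : \forall n \near \oo, rho - d < @s n ord0.
    have Dd : 1 < theta ^+ 2 * Dtr c mu (rho - d).
      rewrite -[X in X < _]th2D ltr_pM2l//.
      by apply: (Dtr_decreasing b0 muD c0 c1) => //; rewrite gtrBl.
    have := lower_eventually b0 muD c0 c1 cvg_left cvg_right cvg_crossR cvg_crossI bd th0 Dd.
    by apply: filterS => n Hn; exact: Hn (@svd n).
  move: up lo; apply: filterS2 => n h1 h2.
  by rewrite ltr_norml; apply/andP; split; lra.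
split=> //; apply: (cvg_subgradient subgradientF srho) => sg e sg1 e0.
have [h h0 [bh Dh]] := supercritical_step b0 muD c0 c1 th0 brho Drho sg1 e0.
exists h => //; have := upperF bh Dh.
by apply: filterS => n; exact: ltW.
Qed.

(** No z > b satisfies theta^2 D(z) > 1, so [lower_eventually] says nothing. The lower bound comes
    instead from convexity between the strengths -theta and theta, where the upper bounds agree
    because they depend on tau^2 only. *)
Lemma subcritical_limits :
  (forall z, b < z -> theta ^+ 2 * Dtr c mu z <= 1) ->
  @s n ord0 @[n --> \oo] --> b /\ kappa n @[n --> \oo] --> (0 : R).
Proof.
move=> sub1.
have th2 : 0 < theta ^+ 2 by rewrite exprn_gt0.
(* The inequality becomes strict by applying the weak one at the midpoint of [b] and [z], where D is
   larger. *)
have sub z : b < z -> theta ^+ 2 * Dtr c mu z < 1.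
  move=> bz; have bm : b < (b + z) / 2 by lra.
  apply: lt_le_trans (sub1 _ bm); rewrite ltr_pM2l//.
  by apply: (Dtr_decreasing b0 muD c0 c1) => //; lra.
pose kX n := alignment (u n) (col ord0 (UX n)) (v n) (col ord0 (VX n)).
(* convexity of [F], in the strengths [-theta], [0] and [theta] *)
have low n : 2 * @sX n ord0 <= @s n ord0 + F (- (2 * theta)) n.
  have svdX0 : is_svd false (X n + 0%:CC *: (u n *m conjT (v n))) (@sX n) (UX n) (VX n).
    by rewrite scale0r addr0; exact: svdX.
  have svds : is_svd false (X n + theta%:CC *: (u n *m conjT (v n))) (@s n) (U n) (V n)
    by have [? ? ? _ ?] := @svd n; split.
  have [U' [V' svd']] := svdF (- (2 * theta)) n.
  have := top_sval_subgradient svdX0 svds; have := top_sval_subgradient svdX0 svd'.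
  rewrite -/(kX n) -/(F _ n) !subr0 => h1 h2.
  have : (theta + - (2 * theta)) * kX n + theta * kX n = 0 by ring.
  by lra.
have sb : @s n ord0 @[n --> \oo] --> b.
  apply/cvgrPdist_lt => e e0.
  have e3 : b < b + e / 3 by rewrite ltrDl divr_gt0.
  have up : \forall n \near \oo, @s n ord0 < b + e / 3 by exact: upper_s e3 (sub _ e3).
  have upF : \forall n \near \oo, F (- (2 * theta)) n < b + e / 3.
    apply: (upperF e3); rewrite (_ : (theta - 2 * theta) ^+ 2 = theta ^+ 2); first exact: sub.
    by ring.
  have lo : \forall n \near \oo, b - e / 3 < @sX n ord0.
    by apply: (cvgr_gt _ sXb); rewrite gtrBl divr_gt0.
  move: up upF lo; apply: filterS3 => n h1 h2 h3; have := low n.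
  by rewrite ltr_norml => h4; apply/andP; split; lra.
split=> //; apply: (cvg_subgradient subgradientF sb) => sg e sg1 e0.
have [h h0 Dh] := subcritical_step b0 muD c0 c1 th0 sub D'oo sg1 e0.
exists h => //; have bh : b < b + h * e by rewrite ltrDl mulr_gt0.
have := upperF bh Dh.
by apply: filterS => n; rewrite mulr0 add0r; exact: ltW.
Qed.

End SpikeLimits.

(** * Pathwise moments, risk limits and the conclusion *)

Section SpikedRisk.
Context {R : realType}.
Local Notation C := R[i].
Local Notation "x %:CC" := (real_complex R x) (at level 2, format "x %:CC").

Lemma cvg_of_diff (f g : nat -> R) (l : R) :
  f n - g n @[n --> \oo] --> (0 : R) -> g n @[n --> \oo] --> l -> f n @[n --> \oo] --> l.
Proof. by move=> fg gl; apply: cvg_sub0 gl; exact: fg. Qed.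

Section PathwiseMoments.
Variables (mu : probability R R) (b c : R) (m : nat -> nat).
Variable X : forall n : nat, 'M[C]_(n.+1, m n).
Hypothesis nm : forall n, (n.+1 <= m n)%N.
Hypothesis cm : (n.+1%:R / (m n)%:R : R) @[n --> \oo] --> c.
Hypothesis b0 : 0 <= b.
Hypothesis muD : mu [set` `[0, b]] = 1%E.
Hypothesis Xb : svals (X n) ord0 @[n --> \oo] --> b.
Hypothesis weak : forall f : R -> R, continuous f ->
  (exists M : R, forall x, `|f x| <= M) ->
  ((n.+1%:R)^-1 * \sum_(i < n.+1) f (svals (X n) i)) @[n --> \oo] --> Rintegral mu setT f.

Lemma cvg_gram_trace k :
  complex.Re (\tr ((X n *m conjT (X n)) ^+ k)) / n.+1%:R @[n --> \oo] --> moment mu b k.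
Proof.
have svdX n := svals_svd (X n) (nm n).
have trE n : complex.Re (\tr ((X n *m conjT (X n)) ^+ k)) / n.+1%:R =
    (n.+1%:R)^-1 * \sum_(i < n.+1) svals (X n) i ^+ (2 * k).
  by have [U [V svd]] := svdX n; rewrite (svd_trace svd) Re_real mulrC.
under eq_cvg do rewrite trE.
apply: (cvg_power_mean b0 muD) => //.
- by move=> n i; have [U [V [_ s0 _ _ _]]] := svdX n; exact: s0.
- by move=> n i; have [U [V [_ _ sd _ _]]] := svdX n; exact: sd.
Qed.

Lemma cvg_gram_adj_trace k :
  complex.Re (\tr ((conjT (X n) *m X n) ^+ k)) / (m n)%:R @[n --> \oo] --> comoment mu b c k.
Proof.
have m0 n : (m n)%:R != 0 :> R by rewrite pnatr_eq0 -lt0n (leq_trans _ (nm n)).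
case: k => [|k].
  have E n : complex.Re (\tr ((conjT (X n) *m X n) ^+ 0)) / (m n)%:R = 1.
    by rewrite expr0 mxtrace1 -(rmorph_nat (real_complex R)) Re_real mulfV.
  by under eq_cvg do rewrite E; exact: cvg_cst.
have E n : complex.Re (\tr ((conjT (X n) *m X n) ^+ k.+1)) / (m n)%:R =
    (n.+1%:R / (m n)%:R) * (complex.Re (\tr ((X n *m conjT (X n)) ^+ k.+1)) / n.+1%:R).
  have n0 : n.+1%:R != 0 :> R by rewrite pnatr_eq0.
  rewrite trace_gram_swap; move: (complex.Re _) (n.+1%:R) n0 (m0 n) => t x x0 mn.
  by field; rewrite mn x0.
under eq_cvg do rewrite E.
by apply: cvgM; [exact: cm|exact: cvg_gram_trace].
Qed.

End PathwiseMoments.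

Lemma risk_limits (m : nat -> nat) (theta sigma k : R) (s : nat -> R)
    (u uh : forall n : nat, 'cV[C]_(n.+1)) (v vh : forall n : nat, 'cV[C]_(m n)) :
  (forall n, frob2 (u n) = 1) -> (forall n, frob2 (v n) = 1) ->
  (forall n, frob2 (uh n) = 1) -> (forall n, frob2 (vh n) = 1) ->
  s n @[n --> \oo] --> sigma ->
  alignment (u n) (uh n) (v n) (vh n) @[n --> \oo] --> k ->
  let S n := theta%:CC *: (u n *m conjT (v n)) in
  let w := Num.max 0 (theta * k) in
  [/\ wopt (S n) (uh n) (vh n) @[n --> \oo] --> w,
      MSE1 (S n) (uh n) (vh n) (wopt (S n) (uh n) (vh n)) @[n --> \oo] -->
        theta ^+ 2 + w ^+ 2 - 2 * w * (theta * k) &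
      MSE1 (S n) (uh n) (vh n) (s n) @[n --> \oo] -->
        theta ^+ 2 + sigma ^+ 2 - 2 * sigma * (theta * k)].
Proof.
move=> u1 v1 uh1 vh1 ssigma ak S w.
pose al n := theta * alignment (u n) (uh n) (v n) (vh n).
have ME n x : MSE1 (S n) (uh n) (vh n) x = theta ^+ 2 + x ^+ 2 - 2 * x * al n.
  exact: MSE1E.
have tk : al n @[n --> \oo] --> theta * k by apply: cvgM; [exact: cvg_cst|exact: ak].
have wE n : wopt (S n) (uh n) (vh n) = Num.max 0 (al n) by apply: woptE => x; exact: ME.
have wl : wopt (S n) (uh n) (vh n) @[n --> \oo] --> w.
  under eq_cvg do rewrite wE.
  have mc : {for theta * k, continuous (fun t : R => Num.max 0 t)}.
    by apply: continuous_max; [exact: cst_continuous|exact: cvg_id].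
  exact: cvg_comp tk mc.
have lim (x : nat -> R) (y : R) : x n @[n --> \oo] --> y ->
    MSE1 (S n) (uh n) (vh n) (x n) @[n --> \oo] --> theta ^+ 2 + y ^+ 2 - 2 * y * (theta * k).
  move=> xy; under eq_cvg do rewrite ME.
  apply: cvgB; last by apply: cvgM => //; apply: cvgM => //; exact: cvg_cst.
  apply: cvgD; first exact: cvg_cst.
  under eq_cvg do rewrite expr2.
  by rewrite expr2; exact: cvgM.
by split=> //; exact: lim.
Qed.

End SpikedRisk.

Unset Implicit Arguments.

(* Dimensions: for index n the matrices are (n+1) x (m n). *)
Theorem theorem2p3 (R : realType) (Kreal : bool)
  (d : measure_display) (T : measurableType d) (P : probability T R)
  (m : nat -> nat) (c : R) (mu : probability R R) (a b : R)
  (X : forall n : nat, T -> 'M[R[i]]_(n.+1, m n))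
  (theta : R) (u : forall n : nat, 'cV[R[i]]_(n.+1)) (v : forall n : nat, 'cV[R[i]]_(m n)) :
  (forall n, (n.+1 <= m n)%N) ->
  (n.+1%:R / (m n)%:R : R) @[n --> \oo] --> c ->
  (forall n, rand_mx (X n)) ->
  (Kreal -> forall n w, real_mx (X n w)) ->
  (forall n, biinvariant P Kreal (X n)) ->
  mu [set` `[a, b]] = 1%E ->
  (forall e : R, 0 < e -> (0 < mu [set` `](b - e)%R, b%R]])%E) ->
  {ae P, forall w, forall f : R -> R, continuous f -> (exists M : R, forall x, `|f x| <= M) ->
     ((n.+1%:R)^-1 * \sum_(i < n.+1) f (svals (X n w) i)) @[n --> \oo]
       --> Rintegral mu setT f} ->
  {ae P, forall w, svals (X n w) ord0 @[n --> \oo] --> b} ->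
  0 < theta ->
  (forall n, orthonormal_cols (u n) /\ orthonormal_cols (v n)) ->
  (Kreal -> forall n, real_mx (u n) /\ real_mx (v n)) ->
  derive1 (Dtr c mu) z @[z --> b^'+] --> -oo ->
  let Sn := fun n => ((theta%:C)%C *: (u n *m conjT (v n))) : 'M[R[i]]_(n.+1, m n) in
  let supercrit := (1 < (theta ^+ 2)%:E * Dbplus c mu b)%E in
  let rho := Dinv c mu b (theta ^+ 2)^-1 in
  let D'rho := derive1 (Dtr c mu) rho in
  {ae P, forall w,
    forall (s : forall n : nat, 'I_n.+1 -> R) (U : forall n : nat, 'M[R[i]]_(n.+1))
           (V : forall n : nat, 'M[R[i]]_(m n, n.+1)),
    (forall n, is_svd Kreal (Sn n + X n w) (s n) (U n) (V n)) ->
    let uh := fun n => col ord0 (U n) in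
    let vh := fun n => col ord0 (V n) in
    [/\ wopt (Sn n) (uh n) (vh n) @[n --> \oo] -->
          (if supercrit then -2 / (theta ^+ 2 * D'rho) else 0),
        MSE1 (Sn n) (uh n) (vh n) (wopt (Sn n) (uh n) (vh n)) @[n --> \oo] -->
          (if supercrit then theta ^+ 2 - 4 / (theta ^+ 2 * D'rho) ^+ 2 else theta ^+ 2) &
        MSE1 (Sn n) (uh n) (vh n) (s n ord0) @[n --> \oo] -->
          (if supercrit then theta ^+ 2 + rho ^+ 2 + 4 * rho / (theta ^+ 2 * D'rho)
           else theta ^+ 2 + b ^+ 2)]}.
Proof.
move=> nm cm mX _ invX muab _ weak_ae Xb_ae th0 orth real_uv D'oo Sn supercrit rho D'rho.
have u1 n : frob2 (u n) = 1 by have [/orthonormal_col1] := orth n.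
have v1 n : frob2 (v n) = 1 by have [_ /orthonormal_col1] := orth n.
have th2 : 0 < theta ^+ 2 by rewrite exprn_gt0.
move: weak_ae Xb_ae (ae_moments nm mX invX u1 v1 real_uv).
(* The sample is fixed from here on, before the decompositions are introduced, so their choice
   raises no measurability question. *)
apply: filterS3 => w weak Xb mom0 s U V svd; have mom := mom0 (ex_intro _ b Xb).
pose uh n := col ord0 (U n); pose vh n := col ord0 (V n).
have svdX n := svals_svd (X n w) (nm n).
have S0 n i : 0 <= svals (X n w) i by have [? [? [_ s0 _ _ _]]] := svdX n; exact: s0.
have b0 : 0 <= b by apply: (cvgr_to_ge Xb); apply: nearW => n; exact: S0.
have muD := weak_limit_support muab S0 weak.
have c0 : 0 <= c by apply: (cvgr_to_ge cm); apply: nearW => n; rewrite divr_ge0.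
have c1 : c <= 1.
  apply: (cvgr_to_le cm); apply: nearW => n.
  have m0 : 0 < (m n)%:R :> R by rewrite ltr0n (leq_trans _ (nm n)).
  by rewrite ler_pdivrMr// mul1r ler_nat.
have cvg_left l : complex.Re (ip (u n) ((X n w *m conjT (X n w)) ^+ l *m u n))
    @[n --> \oo] --> moment mu b l.
  have [h _ _ _] := mom l; have g := @cvg_gram_trace R mu b m (fun n => X n w) nm b0 muD Xb weak l.
  exact: cvg_of_diff h g.
have cvg_right l : complex.Re (ip (v n) ((conjT (X n w) *m X n w) ^+ l *m v n))
    @[n --> \oo] --> comoment mu b c l.
  have [_ h _ _] := mom l; have g := @cvg_gram_adj_trace R mu b c m (fun n => X n w) nm cm b0 muD Xb weak l.
  exact: cvg_of_diff h g.
have crossR l : complex.Re (ip (u n) ((X n w *m conjT (X n w)) ^+ l *m (X n w *m v n)))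
    @[n --> \oo] --> (0 : R) by have [] := mom l.
have crossI l : complex.Im (ip (u n) ((X n w *m conjT (X n w)) ^+ l *m (X n w *m v n)))
    @[n --> \oo] --> (0 : R) by have [] := mom l.
have [UX HUX] : {UX : forall n : nat, 'M[R[i]]_(n.+1) & forall n, exists VX,
    is_svd false (X n w) (svals (X n w)) (UX n) VX}.
  by exists (fun n => projT1 (cid (svdX n))) => n; exact: projT2 (cid (svdX n)).
pose VX n := projT1 (cid (HUX n)).
have svdVX n : is_svd false (X n w) (svals (X n w)) (UX n) (VX n) := projT2 (cid (HUX n)).
have svd' n : is_svd Kreal (X n w + (theta%:C)%C *: (u n *m conjT (v n))) (s n) (U n) (V n).
  by rewrite addrC; exact: svd.
have uh1 n : frob2 (uh n) = 1 by have [[oU _] _ _ _ _] := svd n; exact: frob2_col_orthonormal.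
have vh1 n : frob2 (vh n) = 1 by have [[_ oV] _ _ _ _] := svd n; exact: frob2_col_orthonormal.
have [sc|nsc] := boolP supercrit.
- have [z bz z1] := (supercritical_equiv b0 muD c0 c1 th2).1 sc.
  have tz : (theta ^+ 2)^-1 < Dtr c mu z by rewrite -[X in X < _]mulr1 ltr_pdivrMl.
  have t0 : 0 < (theta ^+ 2)^-1 by rewrite invr_gt0.
  have [brho Drho] := Dtr_inverse b0 muD c0 c1 t0 (ex_intro2 _ _ z bz tz).
  have [_ D'0] := Dtr_derive b0 muD c0 c1 brho.
  have [srho kl] := supercritical_limits b0 muD c0 c1 th0 nm svdVX Xb u1 v1
    cvg_left cvg_right crossR crossI svd' brho Drho.
  have kE : theta * (-2 / (theta ^+ 3 * D'rho)) = -2 / (theta ^+ 2 * D'rho).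
    by field; rewrite (lt_eqF D'0) (gt_eqF th0).
  (* Since D'(rho) < 0, the limiting vertex is nonnegative and the constraint on the weight is
     inactive. *)
  have k0 : 0 <= -2 / (theta ^+ 2 * D'rho).
    by rewrite mulNr oppr_ge0 mulr_ge0_le0// invr_le0 mulr_ge0_le0 ?ltW.
  have optE : theta ^+ 2 + (-2 / (theta ^+ 2 * D'rho)) ^+ 2 -
      2 * (-2 / (theta ^+ 2 * D'rho)) * (-2 / (theta ^+ 2 * D'rho)) =
      theta ^+ 2 - 4 / (theta ^+ 2 * D'rho) ^+ 2.
    by field; rewrite (lt_eqF D'0) (gt_eqF th0).
  have eymE : theta ^+ 2 + rho ^+ 2 - 2 * rho * (-2 / (theta ^+ 2 * D'rho)) =
      theta ^+ 2 + rho ^+ 2 + 4 * rho / (theta ^+ 2 * D'rho).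
    by field; rewrite (lt_eqF D'0) (gt_eqF th0).
  have [] := risk_limits theta u1 v1 uh1 vh1 srho kl.
  by rewrite -/rho -/D'rho kE max_r// optE eymE.
have sub z : b < z -> theta ^+ 2 * Dtr c mu z <= 1.
  move=> bz; rewrite leNgt; apply: contra nsc => z1.
  by apply/(supercritical_equiv b0 muD c0 c1 th2); exists z.
have [sb kl] := subcritical_limits b0 muD c0 c1 th0 D'oo nm svdVX Xb u1 v1
  cvg_left cvg_right crossR crossI svd' sub.
have [] := risk_limits theta u1 v1 uh1 vh1 sb kl.
by rewrite mulr0 maxxx !mulr0 expr0n addr0 !subr0.
Qed.
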